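(* Let $\mathcal M,\mathcal N$ be von Neumann algebras, $\mathcal N$ acting on a Hilbert space $\mathcal H$, let $f\in\mathrm{OC}(0,+\infty)$ and $\Phi,\Psi\in\mathrm{CP}(\mathcal M,\mathcal N)$. Let $(\pi,V,\mathcal K;A',B')$ be a minimal SRN realization of $(\Phi,\Psi)$, let $A'=\int_{[0,1]}t\,dE'(t)$ be the spectral decomposition of $A'$, put $h_f(t)=\phi_f(t,1-t)$ for $0\le t\le1$, and write $x\vee0=\max\{x,0\}$. (1) Suppose that $f'(+\infty)=+\infty>f(+0)$, and set $Q_1'=\int_{[0,1)}(h_f(t)\vee0)\,dE'(t)$. Then $\widehat S_f(\Phi\|\Psi)$ has a dense domain if and only if $\Phi\ll\Psi$ and $\operatorname{dom}(Q_1'^{1/2}V)$ is dense in $\mathcal H$. If $\Phi\le_{\mathrm{cp}}c\Psi$ for some $c>0$, then $\widehat S_f(\Phi\|\Psi)$ is bounded. (2) Suppose that $f'(+\infty)<+\infty=f(+0)$, and set $Q_0'=\int_{(0,1]}(h_f(t)\vee0)\,dE'(t)$. Then $\widehat S_f(\Phi\|\Psi)$ has a dense domain if and only if $\Psi\ll\Phi$ and $\operatorname{dom}(Q_0'^{1/2}V)$ is dense in $\mathcal H$. If $\Psi\le_{\mathrm{cp}}c\Phi$ for some $c>0$, then $\widehat S_f(\Phi\|\Psi)$ is bounded. (3) Suppose that $f'(+\infty)=f(+0)=+\infty$, and set $Q_{0,1}'=\int_{(0,1)}(h_f(t)\vee0)\,dE'(t)$. Then $\widehat S_f(\Phi\|\Psi)$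 has a dense domain if and only if $\Phi\ll\Psi$, $\Psi\ll\Phi$ and $\operatorname{dom}(Q_{0,1}'^{1/2}V)$ is dense in $\mathcal H$. If $\Phi\le_{\mathrm{cp}}c\Psi$ and $\Psi\le_{\mathrm{cp}}d\Phi$ for some $c,d>0$, then $\widehat S_f(\Phi\|\Psi)$ is bounded. (4) If $f'(+\infty)<+\infty$ and $f(+0)<+\infty$, then $\widehat S_f(\Phi\|\Psi)$ is bounded.
   Context: Conventions. $\mathrm{CP}(\mathcal M,\mathcal N)$ is the set of all completely positive linear maps $\mathcal M\to\mathcal N$ (not assumed normal); $\Phi\le_{\mathrm{cp}}\Gamma$ means that $\Gamma-\Phi$ is completely positive. $\Psi\ll\Phi$ (absolute continuity) means: there exist $\Psi_n\in\mathrm{CP}(\mathcal M,\mathcal N)$ and $c_n>0$ ($n\in\mathbb N$) such that $\Psi_n\uparrow\Psi$ (increasing in the order $\le_{\mathrm{cp}}$ and converging) in the point-$\sigma$-weak topology and $\Psi_n\le_{\mathrm{cp}}c_n\Phi$. $\mathcal N_*^+$ is the positive cone of the predual. Inner products are linear in the first variable. $\mathrm{OC}(0,+\infty)$ is the set of real-valued operator convex functions on $(0,+\infty)$. We put $0\cdot(+\infty)=0$. Extended lower-semibounded part. For a von Neumann algebra $\mathcal N$, $\widehat{\mathcal N}_{\mathrm{lb}}$ is the set of maps $m:\mathcal N_*^+\to(-\infty,+\infty]$ that are positively homogeneous ($m(\lambda\varphi)=\lambda m(\varphi)$, $\lambda\ge0$), additive, norm lower semicontinuous, and satisfy $m(\varphi)\ge\ell\varphi(1)$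 for some $\ell\in\mathbb R$ and all $\varphi$. Each such $m$ has a unique spectral resolution $m(\varphi)=\int t\,d\varphi(e_t)+\infty\cdot\varphi(1-p_0)$ with $p_0\in\mathcal N$ a projection and $(e_t)_{t\in\mathbb R}$ a nondecreasing right-continuous family of projections in $\mathcal N$ with $e_t=0$ for $t<\ell$ and $e_t\to p_0$ as $t\to+\infty$. $m$ has a dense domain if $p_0=1$, equivalently if $\{\varphi\in\mathcal N_*^+:m(\varphi)<+\infty\}$ is norm dense in $\mathcal N_*^+$. $m$ is bounded if it is of the form $\varphi\mapsto\varphi(a)$ for some self-adjoint $a\in\mathcal N$. For $C\in\mathbb B(\mathcal H,\mathcal K)$ and $m\in\widehat{\mathbb B(\mathcal K)}_{\mathrm{lb}}$, $C^*mC\in\widehat{\mathbb B(\mathcal H)}_{\mathrm{lb}}$ is $(C^*mC)(\omega)=m(C\omega C^* )$ with $(C\omega C^* )(X)=\omega(C^*XC)$. If $\mathcal N$ acts on $\mathcal H$, then $m\in\widehat{\mathcal N}_{\mathrm{lb}}$ is identified with $\omega\mapsto m(\omega|_{\mathcal N})$ in $\widehat{\mathbb B(\mathcal H)}_{\mathrm{lb}}$; this identifies $\widehat{\mathcal N}_{\mathrm{lb}}$ with the elements $m$ of $\widehat{\mathbb B(\mathcal H)}_{\mathrm{lb}}$ affiliated with $\mathcal N$ (i.e. $u'^*mu'=m$ for all unitaries $u'\in\mathcal N'$). Perspective. For $f\in\mathrm{OC}(0,+\infty)$ let $f(+0)=\lim_{t\downarrow0}f(t)$, $f'(+\infty)=\lim_{t\to+\infty}f(t)/t$,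 and define $\phi_f:[0,\infty)^2\to(-\infty,+\infty]$ by $\phi_f(s,t)=tf(s/t)$ for $s,t>0$, $\phi_f(s,0)=f'(+\infty)s$, $\phi_f(0,t)=f(+0)t$. If $A,B\in\mathbb B(\mathcal K)_+$ with $A+B=I$ and $A=\int_{[0,1]}t\,dE(t)$, then $\phi_f(A,B)\in\widehat{\mathbb B(\mathcal K)}_{\mathrm{lb}}$ is $\phi_f(A,B)(\omega)=\int_{[0,1]}\phi_f(t,1-t)\,d\omega(E(t))$. Divergence. A minimal Stinespring representation $(\pi,V,\mathcal K)$ of $\Gamma\in\mathrm{CP}(\mathcal M,\mathcal N)$ consists of a unital $*$-representation $\pi$ of $\mathcal M$ on $\mathcal K$ and $V\in\mathbb B(\mathcal H,\mathcal K)$ with $\Gamma(x)=V^*\pi(x)V$ and $\overline{\operatorname{span}}\,\pi(\mathcal M)V\mathcal H=\mathcal K$. A minimal SRN realization $(\pi,V,\mathcal K;A',B')$ of $(\Phi,\Psi)$ consists of a minimal Stinespring representation $(\pi,V,\mathcal K)$ of $\Phi+\Psi$ and the unique positive contractions $A',B'\in\pi(\mathcal M)'$ with $\Phi(x)=V^*A'\pi(x)V$, $\Psi(x)=V^*B'\pi(x)V$ (so $A'+B'=I$). The maximal $f$-divergence is $\widehat S_f(\Phi\|\Psi)=V^*\phi_f(A',B')V\in\widehat{\mathcal N}_{\mathrm{lb}}$, independent of the choices. The operators $Q_1',Q_0',Q_{0,1}'$ are positive self-adjoint (possibly unbounded) operators on $\mathcal K$ given by spectral integrals, and $\operatorname{dom}(Q^{1/2}V)=\{\xi\in\mathcal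 H:V\xi\in\operatorname{dom}(Q^{1/2})\}$. *)

(* Defs.v *)
From HB Require Import structures.
From mathcomp Require Import all_boot all_order all_algebra.
From mathcomp Require Import sesquilinear spectral.
From mathcomp Require Import complex.
From mathcomp Require Import all_classical all_reals all_analysis.

Set Implicit Arguments.
Unset Strict Implicit.
Unset Printing Implicit Defensive.

Import Order.TTheory GRing.Theory Num.Theory.
Import numFieldNormedType.Exports.
Local Open Scope classical_set_scope.
Local Open Scope complex_scope.
Local Open Scope ring_scope.

(* [{dot X for conjC}]: linear in the first variable, conjugate-linear in the
   second one, positive definite. *)
Record hilbertType (R : realType) := Hilbert {
  hilbert_sort :> completeNormedModType R[i];
  inner : {dot hilbert_sort for (@Num.conj R[i])};
  inner_norm : forall x : hilbert_sort, `|x| ^+ 2 = inner x x }.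

(* Operators are plain functions; B(H, K) is the set [bounded_op]. *)
Definition bounded_op (R : realType) (H K : hilbertType R) : set (H -> K) :=
  [set T | linear T /\ continuous T].

(* The adjoint of an operator in B(H, K) exists and is unique (Riesz). *)
Definition adjoint (R : realType) (H K : hilbertType R) (T : H -> K) : K -> H :=
  xget (fun=> 0)
    [set S : K -> H | forall x y, inner K (T x) y = inner H x (S y)].

Definition positive_op (R : realType) (H : hilbertType R) (T : H -> H) : Prop :=
  forall x, 0 <= inner H (T x) x.

Definition span (R : realType) (K : hilbertType R) (S : set K) : set K :=
  [set v | exists (n : nat) (a : 'I_n -> R[i]) (s : 'I_n -> K),
    (forall i, S (s i)) /\ v = \sum_(i < n) a i *: s i].

Definition commutant (R : realType) (H : hilbertType R) (S : set (H -> H)) :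
    set (H -> H) :=
  [set T | bounded_op T /\ forall s, S s -> T \o s = s \o T].

Definition von_neumann (R : realType) (H : hilbertType R) (N : set (H -> H)) :
    Prop :=
  [/\ N `<=` @bounded_op R H H,
      forall x, N x -> N (adjoint x) &
      commutant (commutant N) = N].

(* The sigma-weakly continuous linear functionals on N. A functional on N is a
   function on all operators of which only the values on N matter. *)
Definition predual (R : realType) (H : hilbertType R) (N : set (H -> H)) :
    set ((H -> H) -> R[i]) :=
  [set phi : (H -> H) -> R[i] | exists xi eta : nat -> H,
    [/\ (\sum_(0 <= n <oo) (complex.Re (inner H (xi n) (xi n)))%:E < +oo)%E,
        (\sum_(0 <= n <oo) (complex.Re (inner H (eta n) (eta n)))%:E < +oo)%E &
        forall x, N x ->
          series (fun n => inner H (x (xi n)) (eta n)) @ \oo --> (phi x : R[i]^o)]].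

Definition predual_pos (R : realType) (H : hilbertType R) (N : set (H -> H)) :
    set ((H -> H) -> R[i]) :=
  [set phi : (H -> H) -> R[i] | predual N phi /\
    forall x, N x -> positive_op x -> 0 <= phi x].

Definition norm_dist_le (R : realType) (H : hilbertType R) (N : set (H -> H))
    (phi psi : (H -> H) -> R[i]) (e : R) : Prop :=
  forall x, N x -> (forall v, `|x v| <= `|v|) -> `|phi x - psi x| <= e%:C.

(* Positivity in M_n(M) is positivity as an operator on the n-fold direct sum
   of the underlying Hilbert space. *)
Definition positive_opmx (R : realType) (H : hilbertType R) (n : nat)
    (X : 'I_n -> 'I_n -> H -> H) : Prop :=
  forall v : 'I_n -> H,
    0 <= \sum_(i < n) \sum_(j < n) inner H (X i j (v j)) (v i).

Definition CP (R : realType) (H0 H : hilbertType R) (M : set (H0 -> H0))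
    (N : set (H -> H)) : set ((H0 -> H0) -> H -> H) :=
  [set Phi |
    [/\ forall x, M x -> N (Phi x),
        forall (a : R[i]) x y, M x -> M y ->
          Phi (a *: x + y) = a *: Phi x + Phi y &
        forall (n : nat) (X : 'I_n -> 'I_n -> H0 -> H0),
          (forall i j, M (X i j)) -> positive_opmx X ->
          positive_opmx (fun i j => Phi (X i j))]].

Definition le_cp (R : realType) (H0 H : hilbertType R) (M : set (H0 -> H0))
    (N : set (H -> H)) (Phi Gamma : (H0 -> H0) -> H -> H) : Prop :=
  CP M N (fun x => Gamma x - Phi x).

Definition scale_map (R : realType) (H0 H : hilbertType R) (c : R)
    (Phi : (H0 -> H0) -> H -> H) : (H0 -> H0) -> H -> H :=
  fun x => c%:C *: Phi x.

(* Psi << Phi *)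
Definition abs_cont (R : realType) (H0 H : hilbertType R) (M : set (H0 -> H0))
    (N : set (H -> H)) (Psi Phi : (H0 -> H0) -> H -> H) : Prop :=
  exists (Psin : nat -> (H0 -> H0) -> H -> H) (c : nat -> R),
    [/\ forall n, CP M N (Psin n) /\ 0 < c n,
        forall n, le_cp M N (Psin n) (Psin n.+1),
        forall x phi, M x -> predual N phi ->
          (fun n => phi (Psin n x)) @ \oo --> (phi (Psi x) : R[i]^o) &
        forall n, le_cp M N (Psin n) (scale_map (c n) Phi)].

Definition star_rep (R : realType) (H0 K : hilbertType R) (M : set (H0 -> H0))
    (pi : (H0 -> H0) -> K -> K) : Prop :=
  [/\ forall x, M x -> bounded_op (pi x),
      pi idfun = idfun,
      forall (a : R[i]) x y, M x -> M y ->
        pi (a *: x + y) = a *: pi x + pi y,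
      forall x y, M x -> M y -> pi (x \o y) = pi x \o pi y &
      forall x, M x -> pi (adjoint x) = adjoint (pi x)].

Definition minimal_stinespring (R : realType) (H0 H K : hilbertType R)
    (M : set (H0 -> H0)) (Gamma : (H0 -> H0) -> H -> H)
    (pi : (H0 -> H0) -> K -> K) (V : H -> K) : Prop :=
  [/\ star_rep M pi,
      bounded_op V,
      forall x, M x -> Gamma x = adjoint V \o pi x \o V &
      dense (span [set v : K | exists x xi, M x /\ v = pi x (V xi)])].

Definition positive_contraction (R : realType) (K : hilbertType R)
    (A : K -> K) : Prop :=
  [/\ bounded_op A, positive_op A & forall v, `|A v| <= `|v|].

Definition minimal_SRN (R : realType) (H0 H K : hilbertType R)
    (M : set (H0 -> H0)) (Phi Psi : (H0 -> H0) -> H -> H)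
    (pi : (H0 -> H0) -> K -> K) (V : H -> K) (A B : K -> K) : Prop :=
  [/\ minimal_stinespring M (fun x => Phi x + Psi x) pi V,
      positive_contraction A /\ positive_contraction B,
      commutant (pi @` M) A /\ commutant (pi @` M) B,
      forall x, M x -> Phi x = adjoint V \o A \o pi x \o V &
      forall x, M x -> Psi x = adjoint V \o B \o pi x \o V].

Definition borel_set (R : realType) : set (set R) :=
  @measurable _ (measurableTypeR R).

Definition spectral_measure (R : realType) (K : hilbertType R)
    (E : set R -> K -> K) : Prop :=
  [/\ forall S, borel_set S ->
        [/\ bounded_op (E S), E S \o E S = E S & adjoint (E S) = E S],
      E setT = idfun,
      forall S T, borel_set S -> borel_set T -> E (S `&` T) = E S \o E T &
      forall (F : nat -> set R) (v : K),
        (forall n, borel_set (F n)) -> trivIset setT F ->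
        series (fun n => E (F n) v) @ \oo --> E (\bigcup_n F n) v].

(* The Borel measure S |-> omega(E(S)), omega a positive normal functional on
   B(K), and its special case S |-> <E(S) v, v>. *)
Definition functional_measure (R : realType) (K : hilbertType R)
    (E : set R -> K -> K) (omega : (K -> K) -> R[i]) :
    set (measurableTypeR R) -> \bar R :=
  fun S => (complex.Re (omega (E S)))%:E.

Definition vector_measure (R : realType) (K : hilbertType R)
    (E : set R -> K -> K) (v : K) : set (measurableTypeR R) -> \bar R :=
  functional_measure E (fun X => inner K (X v) v).

(* A = \int_[0,1] t dE(t) *)
Definition spectral_decomposition01 (R : realType) (K : hilbertType R)
    (A : K -> K) (E : set R -> K -> K) : Prop :=
  [/\ spectral_measure E,
      E `[0%R, 1%R]%classic = idfun &
      forall v, (complex.Re (inner K (A v) v))%:E =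
        (\int[vector_measure E v]_(t in `[0%R, 1%R]) t%:E)%E].

(* The domain of the spectral integral \int_D g dE. *)
Definition spectral_integral_dom (R : realType) (K : hilbertType R)
    (E : set R -> K -> K) (D : set R) (g : R -> \bar R) : set K :=
  [set v | (\int[vector_measure E v]_(t in D) (`|g t| ^+ 2) < +oo)%E].

Definition posdefmx (R : realType) (n : nat) (A : 'M[R[i]]_n) : Prop :=
  forall v : 'rV[R[i]]_n, v != 0 ->
    0 < (v *m A *m (map_mx (@Num.conj R[i]) v)^T) 0 0.

Definition possemidefmx (R : realType) (n : nat) (A : 'M[R[i]]_n) : Prop :=
  forall v : 'rV[R[i]]_n, 0 <= (v *m A *m (map_mx (@Num.conj R[i]) v)^T) 0 0.

(* f(A) for a Hermitian matrix A, by diagonalization in an orthonormal basis. *)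
Definition funmx (R : realType) (f : R -> R) (n : nat) (A : 'M[R[i]]_n) :
    'M[R[i]]_n :=
  invmx (spectralmx A)
    *m diag_mx (map_mx (fun z => (f (complex.Re z))%:C) (spectral_diag A))
    *m spectralmx A.

(* OC(0,+oo); only the values of f on (0,+oo) matter. *)
Definition operator_convex (R : realType) (f : R -> R) : Prop :=
  forall (n : nat) (A B : 'M[R[i]]_n) (l : R), 0 <= l <= 1 ->
    posdefmx A -> posdefmx B ->
    possemidefmx (l%:C *: funmx f A + (1 - l)%:C *: funmx f B
                  - funmx f (l%:C *: A + (1 - l)%:C *: B)).

Definition fzero (R : realType) (f : R -> R) : \bar R :=
  lim ((f t)%:E @[t --> 0^'+]).

Definition finfty (R : realType) (f : R -> R) : \bar R :=
  lim ((f t / t)%:E @[t --> +oo]).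

(* To be used for s, t >= 0. *)
Definition perspective (R : realType) (f : R -> R) (s t : R) : \bar R :=
  if t == 0 then (finfty f * s%:E)%E
  else if s == 0 then (fzero f * t%:E)%E
  else (t * f (s / t))%:E.

Definition hfun (R : realType) (f : R -> R) (t : R) : \bar R :=
  perspective f t (1 - t).

(* phi_f(A, 1 - A), where A = \int_[0,1] t dE(t). *)
Definition phi_form (R : realType) (K : hilbertType R) (f : R -> R)
    (E : set R -> K -> K) : ((K -> K) -> R[i]) -> \bar R :=
  fun omega => (\int[functional_measure E omega]_(t in `[0%R, 1%R]) hfun f t)%E.

(* C^* m C *)
Definition conj_form (R : realType) (H K : hilbertType R) (C : H -> K)
    (m : ((K -> K) -> R[i]) -> \bar R) : ((H -> H) -> R[i]) -> \bar R :=
  fun omega => m (fun X => omega (adjoint C \o X \o C)).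

(* Elements m of the extended part of B(H) affiliated with N are identified with
   elements of the extended part of N: m(omega) depends only on the restriction
   of omega to N, so that m can be evaluated at phi in N_*^+ through any positive
   normal extension of phi to B(H). *)
Definition normal_extension (R : realType) (H : hilbertType R)
    (N : set (H -> H)) (phi : (H -> H) -> R[i]) : (H -> H) -> R[i] :=
  xget (fun=> 0)
    [set omega : (H -> H) -> R[i] | predual_pos (@bounded_op R H H) omega /\
                 forall x, N x -> omega x = phi x].

Definition restr_form (R : realType) (H : hilbertType R) (N : set (H -> H))
    (m : ((H -> H) -> R[i]) -> \bar R) : ((H -> H) -> R[i]) -> \bar R :=
  fun phi => m (normal_extension N phi).

(* The maximal f-divergence computed in a minimal SRN realization with operator V
   and spectral measure E of A'. *)
Definition max_divergence (R : realType) (H K : hilbertType R)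
    (N : set (H -> H)) (f : R -> R) (V : H -> K) (E : set R -> K -> K) :
    ((H -> H) -> R[i]) -> \bar R :=
  restr_form N (conj_form V (phi_form f E)).

Definition dense_domain (R : realType) (H : hilbertType R) (N : set (H -> H))
    (m : ((H -> H) -> R[i]) -> \bar R) : Prop :=
  forall phi (e : R), predual_pos N phi -> 0 < e ->
    exists psi, [/\ predual_pos N psi, (m psi < +oo)%E &
                    norm_dist_le N phi psi e].

Definition bounded_form (R : realType) (H : hilbertType R) (N : set (H -> H))
    (m : ((H -> H) -> R[i]) -> \bar R) : Prop :=
  exists a : H -> H, [/\ N a, adjoint a = a &
    forall phi, predual_pos N phi -> m phi = (complex.Re (phi a))%:E].

(* dom(Q^{1/2}V), where Q = \int_D (h_f \/ 0) dE; by the functional calculus,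
   Q^{1/2} = \int_D (h_f \/ 0)^{1/2} dE. *)
Definition dom_sqrtQV (R : realType) (H K : hilbertType R) (f : R -> R)
    (V : H -> K) (E : set R -> K -> K) (D : set R) : set H :=
  V @^-1` spectral_integral_dom E D (fun t => sqrte (maxe (hfun f t) 0%E)).

(* Main.v *)
From HB Require Import structures.
Require Import Defs.
From mathcomp Require Import all_boot all_order all_algebra complex.
From mathcomp Require Import all_classical all_reals all_analysis.
From mathcomp Require Import measurable_realfun sesquilinear spectral ring lra.
Import Order.TTheory GRing.Theory Num.Theory.
Import numFieldNormedType.Exports.
Set Implicit Arguments.
Unset Strict Implicit.
Unset Printing Implicit Defensive.
Local Open Scope classical_set_scope.
Local Open Scope complex_scope.
Local Open Scope ring_scope.

(** Let [A] and [B = 1 - A] be the Radon-Nikodym densities of Phi and Psi in a minimal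
    Stinespring representation of Phi + Psi, and let [E] be the spectral measure of [A]. For a
    positive normal functional phi on N, the divergence at phi is the integral over [0, 1] of
    h_f(t) = (1 - t) f(t / (1 - t)) against the measure S |-> phi(V* E(S) V). By convexity h_f is
    bounded below, and it is bounded above on the parts of [0, 1] that stay away from 0, unless
    f(+0) is finite, and from 1, unless f'(+oo) is finite. Everything is read off this picture.

    Positive normal functionals. Each phi is x |-> sum_n <x th_n, th_n> on N for a single
    square-summable sequence [th] ([positive_normal_vector]). So phi extends to all bounded
    operators, the measure above is a sum of scalar spectral measures of the vectors [V th_n], and
    phi can be approximated by modifying the vectors [th_n].

    Membership in N. An operator y of N' lifts to a bounded operator of the Stinespring space that
    acts on the H-component of the spanning vectors ([rho_exists]). It commutes with [A] and with
    pi, hence with [E] ([spectral_commute]); so V* T pi(x) V is in N for every T in the von Neumann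
    algebra generated by [A] ([bicomm_Theta]), and the domain of Q^(1/2) V is invariant under N'.

    Density. Let Z be the set of those endpoints 0, 1 at which h_f is infinite. If the functionals
    of finite divergence are norm dense, then every x in N at which all of them vanish has zero
    quadratic form ([dense_domain_test]). For x = V* E(Z) V this yields E(Z) = 0 by minimality, and
    for x = 1 - P, with P in N the projection onto the closure of the domain, it yields P = 1.
    Conversely, if E(Z) = 0 and the domain is dense, the vectors [th_n] can be replaced by finitely
    many vectors of the domain ([dense_domain_intro]).

    Absolute continuity. Phi << Psi holds exactly when E({1}) = 0, and Psi << Phi exactly when
    E({0}) = 0. If E({1}) = 0, truncating [A] to [0, 1 - 1/(n+1)] gives maps that increase to Phi
    and are dominated by multiples of Psi ([abs_cont_aff]). Conversely, the approximants of an
    absolutely continuous map annihilate the kernel of [B], by a parallelogram inequality for their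
    quadratic forms, and so does their limit ([abs_cont_kernel]).

    Boundedness. Phi <= c Psi gives A <= c (1 - A), so that [E] is carried by an interval [0, r]
    with r < 1, and dually. Once [E] is carried by a set on which h_f is bounded, the divergence is
    evaluation at V* h_f(A) V ([bounded_form_of]). *)

(** * Real inner products *)

Section complex_re.
Context {R : realType}.
Implicit Types z w : R[i].

Lemma ReD z w : complex.Re (z + w) = complex.Re z + complex.Re w.
Proof. by case: z; case: w. Qed.
Lemma ImD z w : complex.Im (z + w) = complex.Im z + complex.Im w.
Proof. by case: z; case: w. Qed.
Lemma ReN z : complex.Re (- z) = - complex.Re z.
Proof. by case: z. Qed.
Lemma ImN z : complex.Im (- z) = - complex.Im z.
Proof. by case: z. Qed.
Lemma ReZ (a : R) z : complex.Re (a%:C * z) = a * complex.Re z.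
Proof. by case: z => x y /=; rewrite mul0r subr0. Qed.
Lemma Re_sum I (r : seq I) (F : I -> R[i]) :
  complex.Re (\sum_(i <- r) F i) = \sum_(i <- r) complex.Re (F i).
Proof. exact: (big_morph _ ReD erefl). Qed.
Lemma ReconjC z : complex.Re z^* = complex.Re z.
Proof. by case: z. Qed.
Lemma complex_eq z w :
  complex.Re z = complex.Re w -> complex.Im z = complex.Im w -> z = w.
Proof. by case: z; case: w => x y x' y' /= -> ->. Qed.
Lemma complex_ge0 z : complex.Im z = 0 -> 0 <= complex.Re z -> 0 <= z.
Proof. by move=> h0 h1; rewrite lecE h0 h1 /= eqxx. Qed.
Lemma ge0_Re z : 0 <= z -> 0 <= complex.Re z.
Proof. by rewrite lecE => /andP[]. Qed.
Lemma ge0_ReE z : 0 <= z -> z = (complex.Re z)%:C.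
Proof. by rewrite lecE => /andP[/eqP h _]; apply: complex_eq. Qed.
Lemma ler_C (a b : R) : (a%:C <= b%:C) = (a <= b).
Proof. by rewrite lecE /= eqxx. Qed.
Lemma ltr_C (a b : R) : (a%:C < b%:C) = (a < b).
Proof. by rewrite ltcE /= eqxx. Qed.
Lemma mulrC_C (a b : R) : (a * b)%:C = a%:C * b%:C.
Proof. by apply: complex_eq => /=; ring. Qed.
Lemma sqC (a : R) : (a ^+ 2)%:C = a%:C ^+ 2.
Proof. by rewrite expr2 mulrC_C. Qed.

End complex_re.

Section inner_basics.
Context {R : realType} {H : hilbertType R}.
Implicit Types x y z : H.

(** Orders and limits only involve the real inner product; the complex one is recovered from it by
    [innerE]. *)
Definition rip x y : R := complex.Re (inner H x y).
Definition nsq x : R := rip x x.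

Lemma innerDl x y z : inner H (x + y) z = inner H x z + inner H y z.
Proof. exact: linearDl. Qed.
Lemma innerDr x y z : inner H z (x + y) = inner H z x + inner H z y.
Proof. exact: linearDr. Qed.
Lemma innerZl a x y : inner H (a *: x) y = a * inner H x y.
Proof. exact: linearZl_LR. Qed.
Lemma innerZr a x y : inner H x (a *: y) = a^* * inner H x y.
Proof. exact: linearZr_LR. Qed.
Lemma innerC x y : inner H x y = (inner H y x)^*.
Proof. by rewrite (hermC (inner H) x y) /= mul1r. Qed.
Lemma inner0l y : inner H 0 y = 0.
Proof. by rewrite -(scale0r (0 : H)) innerZl mul0r. Qed.
Lemma inner0r y : inner H y 0 = 0.
Proof. by rewrite innerC inner0l; apply: complex_eq => /=; rewrite ?oppr0. Qed.
Lemma innerNl x y : inner H (- x) y = - inner H x y.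
Proof. by rewrite -scaleN1r innerZl mulN1r. Qed.
Lemma innerBl x y z : inner H (x - y) z = inner H x z - inner H y z.
Proof. by rewrite innerDl innerNl. Qed.
Lemma innerNr x y : inner H x (- y) = - inner H x y.
Proof. by apply/eqP; rewrite -addr_eq0 -innerDr addNr inner0r. Qed.
Lemma inner_suml I (r : seq I) (F : I -> H) y :
  inner H (\sum_(i <- r) F i) y = \sum_(i <- r) inner H (F i) y.
Proof. by apply: (big_morph (fun x => inner H x y)) => [u v|]; rewrite ?inner0l ?innerDl. Qed.
Lemma inner_sumr I (r : seq I) (F : I -> H) y :
  inner H y (\sum_(i <- r) F i) = \sum_(i <- r) inner H y (F i).
Proof. by apply: (big_morph (fun x => inner H y x)) => [u v|]; rewrite ?inner0r ?innerDr. Qed.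

Lemma ripC x y : rip x y = rip y x.
Proof. by rewrite /rip innerC ReconjC. Qed.
Lemma ripDl x y z : rip (x + y) z = rip x z + rip y z.
Proof. by rewrite /rip innerDl ReD. Qed.
Lemma ripDr x y z : rip z (x + y) = rip z x + rip z y.
Proof. by rewrite /rip innerDr ReD. Qed.
Lemma ripNl x y : rip (- x) y = - rip x y.
Proof. by rewrite /rip innerNl ReN. Qed.
Lemma ripNr x y : rip x (- y) = - rip x y.
Proof. by rewrite /rip innerNr ReN. Qed.
Lemma ripBl x y z : rip (x - y) z = rip x z - rip y z.
Proof. by rewrite ripDl ripNl. Qed.
Lemma ripBr x y z : rip z (x - y) = rip z x - rip z y.
Proof. by rewrite ripDr ripNr. Qed.
Lemma ripZl (a : R) x y : rip (a%:C *: x) y = a * rip x y.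
Proof. by rewrite /rip innerZl ReZ. Qed.
Lemma ripZr (a : R) x y : rip x (a%:C *: y) = a * rip x y.
Proof. by rewrite ripC ripZl ripC. Qed.
Lemma rip0l y : rip 0 y = 0. Proof. by rewrite /rip inner0l. Qed.
Lemma rip0r y : rip y 0 = 0. Proof. by rewrite /rip inner0r. Qed.
Lemma rip_suml I (r : seq I) (F : I -> H) y :
  rip (\sum_(i <- r) F i) y = \sum_(i <- r) rip (F i) y.
Proof. by rewrite /rip inner_suml Re_sum. Qed.
Lemma rip_sumr I (r : seq I) (F : I -> H) y :
  rip y (\sum_(i <- r) F i) = \sum_(i <- r) rip y (F i).
Proof. by rewrite /rip inner_sumr Re_sum. Qed.
Definition ripE := (ripDl, ripDr, ripNl, ripNr, ripZl, ripZr).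

Lemma Im_inner x y : complex.Im (inner H x y) = rip x ('i *: y).
Proof.
by rewrite /rip innerZr; case: (inner H x y) => a b /=; ring.
Qed.
Lemma innerE x y : inner H x y = rip x y +i* rip x ('i *: y).
Proof. by apply: complex_eq => //=; rewrite Im_inner. Qed.
Lemma inner_nsq x : inner H x x = (nsq x)%:C.
Proof. exact/ge0_ReE/dnorm_ge0. Qed.
Lemma nsq_ge0 x : 0 <= nsq x.
Proof. exact/ge0_Re/dnorm_ge0. Qed.
Lemma nsq_eq0 x : nsq x = 0 -> x = 0.
Proof.
move=> h; apply/eqP; rewrite -(dnorm_eq0 (inner H)); apply/eqP.
by rewrite inner_nsq h.
Qed.
Lemma nsq0 : nsq 0 = 0. Proof. exact: rip0l. Qed.
Lemma nsqN x : nsq (- x) = nsq x.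
Proof. by rewrite /nsq ripNl ripNr opprK. Qed.
Lemma nsqZr (a : R) x : nsq (a%:C *: x) = a ^+ 2 * nsq x.
Proof. by rewrite /nsq ripZl ripZr mulrA. Qed.
Lemma nsqZ (a : R[i]) x : nsq (a *: x) = (complex.Re a ^+ 2 + complex.Im a ^+ 2) * nsq x.
Proof.
rewrite {1}/nsq /rip innerZl innerZr inner_nsq mulrA.
by case: a => u v /=; ring.
Qed.
Lemma nsqD x y : nsq (x + y) = nsq x + 2 * rip x y + nsq y.
Proof. by rewrite /nsq !ripE (ripC y x); ring. Qed.
Lemma nsqB x y : nsq (x - y) = nsq x - 2 * rip x y + nsq y.
Proof. by rewrite /nsq !ripE (ripC y x); ring. Qed.
Lemma nsqBC x y : nsq (x - y) = nsq (y - x).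
Proof. by rewrite -nsqN opprB. Qed.
Lemma parallelogram x y : nsq (x + y) + nsq (x - y) = 2 * nsq x + 2 * nsq y.
Proof. by rewrite nsqD nsqB; ring. Qed.
Lemma nsqD_le x y : nsq (x + y) <= 2 * nsq x + 2 * nsq y.
Proof. by rewrite -parallelogram lerDl nsq_ge0. Qed.
Lemma nsqB_le x y : nsq (x - y) <= 2 * nsq x + 2 * nsq y.
Proof. by rewrite -parallelogram lerDr nsq_ge0. Qed.
Lemma rip_young x y : 2 * rip x y <= nsq x + nsq y.
Proof. by have := nsq_ge0 (x - y); rewrite nsqB; lra. Qed.
Lemma rip_youngN x y : - (2 * rip x y) <= nsq x + nsq y.
Proof. by have := nsq_ge0 (x + y); rewrite nsqD; lra. Qed.

Lemma norm_nsq x : `|x| ^+ 2 = (nsq x)%:C.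
Proof. by rewrite inner_norm inner_nsq. Qed.
Lemma norm_sqrt x : `|x| = (Num.sqrt (nsq x))%:C.
Proof.
apply/eqP; rewrite -(@eqrXn2 _ 2)// ?lecR ?sqrtr_ge0 //.
by rewrite norm_nsq -sqC sqr_sqrtr ?nsq_ge0.
Qed.

End inner_basics.

(** * Convergence in Hilbert spaces through squared norms *)

Section hilbert_topology.
Context {R : realType}.

Lemma gt0_ReE (e : R[i]) : 0 < e -> exists2 r : R, 0 < r & e = r%:C.
Proof.
move=> e0; exists (complex.Re e); last exact/ge0_ReE/ltW.
by move: e0; rewrite ltcE => /andP[].
Qed.

Lemma norm_ltC (H : hilbertType R) (x : H) (e : R) : 0 < e ->
  (`|x| < e%:C) = (nsq x < e ^+ 2).
Proof.
move=> e0; rewrite norm_sqrt ltr_C -{1}(ger0_norm (ltW e0)) -(sqrtr_sqr e).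
by rewrite ltr_sqrt// exprn_gt0.
Qed.

Lemma norm_leE (H G : hilbertType R) (x : H) (y : G) :
  (`|x| <= `|y|) = (nsq x <= nsq y).
Proof. by rewrite !norm_sqrt ler_C ler_sqrt// nsq_ge0. Qed.

(** Norm convergence expressed with squared norms, which take their values in the real field. *)
Definition hcvg (H : hilbertType R) (u : nat -> H) (l : H) : Prop :=
  (fun n => nsq (u n - l)) @ \oo --> (0 : R).

Lemma cvg0P (u : nat -> R) : (forall n, 0 <= u n) ->
  (u @ \oo --> (0 : R)) <->
  (forall e, 0 < e -> exists N, forall n, (N <= n)%N -> u n < e).
Proof.
move=> u0; split=> [/cvgrPdist_lt h e e0|h].
  have [N _ hN] := h _ e0; exists N => n /hN /=.
  by rewrite sub0r normrN ger0_norm.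
apply/cvgrPdist_lt => e e0; have [N hN] := h _ e0.
by exists N => // n /= /hN; rewrite sub0r normrN ger0_norm.
Qed.

Lemma hcvgP (H : hilbertType R) (u : nat -> H) (l : H) : hcvg u l <->
  (forall e, 0 < e -> exists N, forall n, (N <= n)%N -> nsq (u n - l) < e).
Proof. by apply: cvg0P => n; exact: nsq_ge0. Qed.

Lemma cvg_hcvg (H : hilbertType R) (u : nat -> H) (l : H) :
  (u @ \oo --> l) <-> hcvg u l.
Proof.
rewrite hcvgP; split=> [/cvgrPdist_lt h e e0|h].
  have [|N _ hN] := h (Num.sqrt e)%:C; first by rewrite ltr_C sqrtr_gt0.
  exists N => n /hN /=; rewrite norm_ltC ?sqrtr_gt0// nsqBC.
  by rewrite sqr_sqrtr// ltW.
apply/cvgrPdist_lt => e /gt0_ReE[r e0 ->].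
have [N hN] := h _ (exprn_gt0 2 e0).
by exists N => // n /= /hN; rewrite norm_ltC// nsqBC.
Qed.

Lemma dense_nsq (H : hilbertType R) (S : set H) : dense S <->
  (forall x e, 0 < e -> exists2 s, S s & nsq (x - s) < e).
Proof.
split=> [h x e e0|h O [x Ox] oO].
  have s0 : 0 < Num.sqrt e by rewrite sqrtr_gt0.
  have s0' : 0 < (Num.sqrt e)%:C :> R[i] by rewrite ltr_C.
  have [|s [/= hs Ss]] := h (ball x (Num.sqrt e)%:C) _ (ball_open _ _).
    by exists x; exact: ballxx.
  exists s => //; move: hs; rewrite -ball_normE/= norm_ltC//.
  by rewrite sqr_sqrtr// ltW.
move: oO; rewrite openE => /(_ x Ox); rewrite /interior.
move=> /nbhs_ballP[e /= /gt0_ReE[r e0 ->]] hO.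
have [s Ss hs] := h x _ (exprn_gt0 2 e0).
exists s; split=> //; apply: hO; rewrite -ball_normE/=.
by rewrite norm_ltC.
Qed.

Lemma bounded_opP (H G : hilbertType R) (T : H -> G) : bounded_op T <->
  linear T /\ exists C : R, forall x, nsq (T x) <= C * nsq x.
Proof.
split=> -[lT hT]; split=> //; pose T' : {linear H -> G} :=
  HB.pack T (GRing.isLinear.Build _ _ _ _ T lT).
  have : continuous T' by [].
  move=> /linear_bounded_continuous /linear_boundedP.
  rewrite /= => /pinfty_ex_gt0[r r0 hr].
  have [s s0 rE] := gt0_ReE r0; exists (s ^+ 2) => x.
  have h : Num.sqrt (nsq (T x)) <= s * Num.sqrt (nsq x).
    by rewrite -ler_C mulrC_C -!norm_sqrt -rE; exact: hr.
  rewrite -(sqr_sqrtr (nsq_ge0 x)) -(sqr_sqrtr (nsq_ge0 (T x))) -exprMn.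
  by apply: lerXn2r; rewrite // nnegrE ?sqrtr_ge0// mulr_ge0 ?sqrtr_ge0// ?ltW.
change (continuous T'); apply/linear_bounded_continuous/linear_boundedP.
have [C hC] := hT; exists (Num.sqrt C)%:C; split; first by rewrite ger0_real// (ler_C 0) sqrtr_ge0.
move=> e hCe x; apply: (@le_trans _ _ ((Num.sqrt C)%:C * `|x|)); last first.
  by rewrite ler_wpM2r// ltW.
rewrite !norm_sqrt -mulrC_C ler_C.
have [C0|C0] := leP 0 C; first by rewrite -sqrtrM// ler_wsqrtr.
have -> : nsq (T x) = 0.
  apply/eqP; rewrite eq_le nsq_ge0 andbT (le_trans (hC x))//.
  by rewrite mulr_le0_ge0 ?nsq_ge0// ltW.
by rewrite sqrtr0 mulr_ge0 ?sqrtr_ge0.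
Qed.

Lemma hilbert_complete (H : hilbertType R) (u : nat -> H) :
  (forall e, 0 < e -> exists N, forall m n, (N <= m)%N -> (N <= n)%N ->
     nsq (u m - u n) < e) ->
  exists l, hcvg u l.
Proof.
move=> h; have : cauchy (u @ \oo).
  apply/cauchy_ballP => e /gt0_ReE[r e0 ->].
  have [N hN] := h _ (exprn_gt0 2 e0).
  exists (u @` [set n | (N <= n)%N], u @` [set n | (N <= n)%N]).
    by split; exists N => // n /= Nn; exists n.
  move=> [x y] /= [[m Nm <-] [n Nn <-]]; rewrite -ball_normE/=.
  by rewrite norm_ltC ?hN.
move=> /cauchy_cvgP /cvg_ex[l hl]; exists l; exact/cvg_hcvg.
Qed.

Lemma cvgC (u : nat -> R[i]) (z : R[i]) : (u @ \oo --> (z : R[i]^o)) <->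
  ((fun n => complex.Re (u n)) @ \oo --> complex.Re z /\
   (fun n => complex.Im (u n)) @ \oo --> complex.Im z).
Proof.
have nE (w : R[i]) : `|w : R[i]^o| =
  (Num.sqrt (complex.Re w ^+ 2 + complex.Im w ^+ 2))%:C by exact: normc_def.
have s1 (a b : R) : `|a| <= Num.sqrt (a ^+ 2 + b ^+ 2).
  by rewrite -sqrtr_sqr ler_wsqrtr// lerDl sqr_ge0.
have s2 (a b : R) : `|b| <= Num.sqrt (a ^+ 2 + b ^+ 2).
  by rewrite -sqrtr_sqr ler_wsqrtr// lerDr sqr_ge0.
have s3 (a b : R) : Num.sqrt (a ^+ 2 + b ^+ 2) <= `|a| + `|b|.
  rewrite -(@ler_pXn2r _ 2)// ?nnegrE ?sqrtr_ge0 ?addr_ge0//.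
  rewrite sqr_sqrtr ?addr_ge0 ?sqr_ge0// sqrrD !real_normK ?num_real//.
  by rewrite lerD2r lerDl mulrn_wge0// mulr_ge0.
split=> [/(@cvgrPdist_lt _ (R[i]^o)) h|[/cvgrPdist_lt h1 /cvgrPdist_lt h2]].
  split; apply/cvgrPdist_lt => e e0; have e0' : 0 < e%:C :> R[i] by rewrite ltr_C.
    have [N _ hN] := h _ e0'; exists N => // n /hN /=; rewrite nE ltr_C.
    by apply: le_lt_trans; rewrite -ReN -ReD; exact: s1.
  have [N _ hN] := h _ e0'; exists N => // n /hN /=; rewrite nE ltr_C.
  by apply: le_lt_trans; rewrite -ImN -ImD; exact: s2.
apply/(@cvgrPdist_lt _ (R[i]^o)) => e /gt0_ReE[r e0 ->].
have e2 : 0 < r / 2 by rewrite divr_gt0.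
have [N _ hN] := h1 _ e2; have [N' _ hN'] := h2 _ e2.
exists (maxn N N') => // n /=; rewrite geq_max => /andP[/hN/= g1 /hN'/= g2].
rewrite nE ltr_C (le_lt_trans (s3 _ _))// ReD ReN ImD ImN.
by rewrite (splitr r) ltrD.
Qed.

End hilbert_topology.

(** * Adjoints, projections and extensions *)

Section quadratic.
Context {R : realType}.

Lemma discriminant_le (a b c : R) : 0 <= c ->
  (forall t, 0 <= a + 2 * t * b + t ^+ 2 * c) -> b ^+ 2 <= a * c.
Proof.
move=> c0 h; have a0 : 0 <= a by have := h 0; rewrite !(mulr0, mul0r, expr0n) !addr0.
have [c1|c1] := eqVneq c 0.
  have [->|b0] := eqVneq b 0; first by rewrite expr0n mulr_ge0.
  have := h (- (a + 1) / (2 * b)); rewrite c1 mulr0 addr0.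
  have -> : 2 * (- (a + 1) / (2 * b)) * b = - (a + 1) by field.
  by lra.
have {c0}c0 : 0 < c by rewrite lt_neqAle eq_sym c1.
have := h (- b / c).
have -> : a + 2 * (- b / c) * b + (- b / c) ^+ 2 * c = a - b ^+ 2 / c by field.
by rewrite subr_ge0 ler_pdivrMr.
Qed.

Lemma inv_lt_eps (e : R) : 0 < e -> exists N, forall n, (N <= n)%N -> n.+1%:R^-1 < e.
Proof.
move=> e0; have := @cvg_harmonic R; move=> /cvgrPdist_lt /(_ e e0)[N _ h].
exists N => n /h /=; rewrite sub0r normrN ger0_norm//.
Qed.

Lemma le_eps_ge0 (x y C : R) : 0 <= C -> (forall e, 0 < e -> x <= y + C * e) -> x <= y.
Proof.
move=> C0 h; apply/ler_addgt0Pr => e e0.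
have C1 : 0 < C + 1 by lra.
apply: (le_trans (h _ (divr_gt0 e0 C1))); rewrite lerD2l mulrCA -[leRHS]mulr1.
by rewrite ler_pM2l// ler_pdivrMr// mul1r; lra.
Qed.

Lemma le_mulC_max (C x : R) : 0 <= x -> C * x <= Num.max C 0 * x.
Proof. by move=> x0; rewrite ler_wpM2r// le_max lexx. Qed.

End quadratic.

Section pre_riesz.
Context {R : realType} {X : lmodType R[i]} (D : set X) (b : X -> X -> R) (l : X -> R) (C : R).
Hypothesis D0 : D !=set0.
Hypothesis DD : forall x y, D x -> D y -> D (x + y).
Hypothesis DZ : forall (t : R) x, D x -> D (t%:C *: x).
Hypothesis bC : forall x y, D x -> D y -> b x y = b y x.
Hypothesis bD : forall x y z, D x -> D y -> D z -> b (x + y) z = b x z + b y z.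
Hypothesis bZ : forall (t : R) x z, D x -> D z -> b (t%:C *: x) z = t * b x z.
Hypothesis b_ge0 : forall x, D x -> 0 <= b x x.
Hypothesis lD : forall x y, D x -> D y -> l (x + y) = l x + l y.
Hypothesis lZ : forall (t : R) x, D x -> l (t%:C *: x) = t * l x.
Hypothesis C0 : 0 <= C.
Hypothesis lb : forall x, D x -> l x ^+ 2 <= C * b x x.

Let bE (t : R) x y : D x -> D y ->
  b (x + t%:C *: y) (x + t%:C *: y) = b x x + 2 * t * b x y + t ^+ 2 * b y y.
Proof.
move=> Dx Dy; have Dt := DZ t Dy; have Ds := DD Dx Dt.
rewrite bD// bZ// (bC Dx Ds) (bC Dy Ds) !bD// !bZ// (bC Dy Dx); ring.
Qed.

Let lE (t : R) x y : D x -> D y -> l (x + t%:C *: y) = l x + t * l y.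
Proof. by move=> Dx Dy; rewrite lD ?lZ//; exact: DZ. Qed.

Let bZZ (t : R) x : D x -> b (t%:C *: x) (t%:C *: x) = t ^+ 2 * b x x.
Proof. by move=> Dx; have Dt := DZ t Dx; rewrite bZ// (bC Dx Dt) bZ// mulrA. Qed.

Let F y := b y y - 2 * l y.

Let F_ge y : D y -> - C <= F y.
Proof.
move=> Dy; rewrite /F; have := lb Dy; have := b_ge0 Dy.
have := sqr_ge0 (b y y - C) => h1 h2 h3.
have {}h3 : (2 * l y) ^+ 2 <= (b y y + C) ^+ 2 by lra.
have := ler_norm (2 * l y).
have : `|2 * l y| <= b y y + C.
  by rewrite -(@ler_pXn2r _ 2)// ?nnegrE ?addr_ge0// real_normK ?num_real.
lra.
Qed.

(** The form [l] is almost represented by a minimising sequence of [b y y - 2 * l y], by the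
    parallelogram identity. No completeness is assumed: [riesz_on] applies this to vectors, and
    [dominated_step] to operators of N, which converge only after evaluation at a sequence of
    vectors. *)
Lemma pre_riesz : exists y : nat -> X, [/\ forall n, D (y n),
  forall m n, b (y m - y n) (y m - y n) <= 2 * m.+1%:R^-1 + 2 * n.+1%:R^-1 &
  forall x n, D x -> (b x (y n) - l x) ^+ 2 <= b x x * n.+1%:R^-1].
Proof.
pose A := F @` D.
have hA : has_inf A.
  split; first by have [d Dd] := D0; exists (F d), d.
  by exists (- C) => _ [y Dy <-]; exact: F_ge.
have hle y : D y -> inf A <= F y by move=> Dy; apply: ge_inf; [case: hA|exists y].
have /choice[y hy] n : exists y, D y /\ F y < inf A + n.+1%:R^-1.
  have n0 : 0 < n.+1%:R^-1 :> R by [].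
  by have [_ [y Dy <-] hy] := inf_adherent n0 hA; exists y.
exists y; split=> [n|m n|x n Dx]; first by case: (hy n).
- have [Dm hm] := hy m; have [Dn hn] := hy n.
  have -> : y m - y n = y m + (-1)%:C *: y n.
    by rewrite (_ : (-1)%:C = -1) ?scaleN1r//; apply: complex_eq => /=; rewrite ?oppr0.
  have Ds : D (y m + (1%:C *: y n)) by apply: DD => //; exact: DZ.
  have := hle _ (DZ (2^-1) Ds).
  move: hm hn; rewrite /F lZ// lE// bZZ// !bE//.
  rewrite !(expr1n, mulr1, mul1r, mulrN1, mulN1r, sqrrN).
  move: (m.+1%:R^-1) (n.+1%:R^-1) => u w.
  have -> : 2^-1 ^+ 2 = 4^-1 :> R by field.
  lra.
- have [Dn hn] := hy n.
  rewrite mulrC; apply: discriminant_le; first exact: b_ge0.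
  move=> t; have := hle _ (DD Dn (DZ t Dx)); move: hn.
  rewrite /F lE// bE// (bC Dx Dn); move: (n.+1%:R^-1) => u. lra.
Qed.

End pre_riesz.

Section hilbert_operators.
Context {R : realType}.
Implicit Types H K G : hilbertType R.

Lemma cauchy_schwarz H (x y : H) : rip x y ^+ 2 <= nsq x * nsq y.
Proof.
apply: discriminant_le; first exact: nsq_ge0.
by move=> t; have := nsq_ge0 (x + t%:C *: y); rewrite nsqD ripZr nsqZr; lra.
Qed.

Lemma hcvg_uniq H (u : nat -> H) a c : hcvg u a -> hcvg u c -> a = c.
Proof. by move=> /cvg_hcvg h1 /cvg_hcvg h2; exact: (cvg_unique _ h1 h2). Qed.

Lemma hcvg_rip H (u : nat -> H) a x : hcvg u a -> (fun n => rip (u n) x) @ \oo --> rip a x.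
Proof.
move=> h; apply/cvgrPdist_lt => e e0.
have s0 : 0 < nsq x + 1 by have := nsq_ge0 x; lra.
have [N hN] := (hcvgP u a).1 h _ (divr_gt0 (exprn_gt0 2 e0) s0).
exists N => // n /= /hN; rewrite ltr_pdivlMr// => hn.
rewrite -ripBl -(@ltr_pXn2r _ 2)// ?nnegrE ?(ltW e0)// real_normK ?num_real//.
apply: le_lt_trans hn; apply: (le_trans (cauchy_schwarz _ _)).
by rewrite nsqBC ler_wpM2l ?nsq_ge0//; lra.
Qed.

Lemma hcvg_const H (a : H) : hcvg (fun=> a) a.
Proof. by apply/cvg_hcvg; exact: cvg_cst. Qed.
Lemma hcvgD H (u v : nat -> H) a c : hcvg u a -> hcvg v c ->
  hcvg (fun n => u n + v n) (a + c).
Proof. by move=> /cvg_hcvg h1 /cvg_hcvg h2; apply/cvg_hcvg; exact: cvgD. Qed.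
Lemma hcvgZ H (u : nat -> H) a c : hcvg u a -> hcvg (fun n => c *: u n) (c *: a).
Proof. by move=> /cvg_hcvg h; apply/cvg_hcvg; exact: cvgZr. Qed.

Lemma hcvg_op H K (T : H -> K) (u : nat -> H) a :
  bounded_op T -> hcvg u a -> hcvg (fun n => T (u n)) (T a).
Proof. by move=> [_ cT] /cvg_hcvg h; apply/cvg_hcvg; exact: (cvg_comp _ _ h (cT _)). Qed.

Lemma rip_eq H (x y : H) : (forall z, rip x z = rip y z) -> x = y.
Proof.
move=> h; apply/subr0_eq/nsq_eq0; rewrite /nsq ripBl h subrr //.
Qed.

Lemma inner_iZl H (x y : H) : rip ('i *: x) y = - rip x ('i *: y).
Proof. by rewrite -Im_inner /rip innerZl; case: (inner H x y) => a b /=; ring. Qed.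

Section operator_algebra.
Context {H K : hilbertType R} (T : H -> K).
Hypothesis lT : linear T.
Lemma opD x y : T (x + y) = T x + T y.
Proof. by rewrite -{1}(scale1r x) lT scale1r. Qed.
Lemma op0 : T 0 = 0.
Proof. by apply: (@addrI _ (T 0)); rewrite -opD !addr0. Qed.
Lemma opZ a x : T (a *: x) = a *: T x.
Proof. by rewrite -[a *: x]addr0 lT op0 addr0. Qed.
Lemma opN x : T (- x) = - T x.
Proof. by rewrite -scaleN1r opZ scaleN1r. Qed.
Lemma opB x y : T (x - y) = T x - T y.
Proof. by rewrite opD opN. Qed.
Lemma op_sum I (r : seq I) (F : I -> H) : T (\sum_(i <- r) F i) = \sum_(i <- r) T (F i).
Proof. by apply: (big_morph T opD op0). Qed.
End operator_algebra.

Lemma bounded_linear H K (T : H -> K) : bounded_op T -> linear T.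
Proof. by case. Qed.

Lemma bounded_nsq H K (T : H -> K) : bounded_op T ->
  exists2 C, 0 < C & forall x, nsq (T x) <= C * nsq x.
Proof.
move=> /bounded_opP[_ [C hC]]; exists (Num.max C 0 + 1) => [|x].
  by rewrite ltr_wpDl// le_max lexx orbT.
apply: (le_trans (hC x)); apply: (le_trans (le_mulC_max C (nsq_ge0 x))).
by rewrite ler_wpM2r ?nsq_ge0// lerDl.
Qed.

Lemma bounded_intro H K (T : H -> K) C : linear T ->
  (forall x, nsq (T x) <= C * nsq x) -> bounded_op T.
Proof. by move=> lT hC; apply/bounded_opP; split=> //; exists C. Qed.

Lemma rip_inner H K (T : H -> K) (S : K -> H) x y : linear T ->
  (forall z, rip (T z) y = rip z (S y)) -> inner K (T x) y = inner H x (S y).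
Proof.
move=> lT h; rewrite !innerE h; congr (_ +i* _).
by rewrite -[LHS]opprK -inner_iZl -(opZ lT) h inner_iZl opprK.
Qed.

Lemma realZ (V : lmodType R[i]) (x : V) : (-1)%:C *: x = - x.
Proof.
rewrite (_ : (-1)%:C = -1) ?scaleN1r//; apply: complex_eq => //=; by rewrite oppr0.
Qed.

(** [D] need only be closed under real combinations, and the representing vector is a limit of
    elements of [D]; so the same statement gives adjoints and projections. *)
Lemma riesz_on H (D : set H) (l : H -> R) C :
  D !=set0 -> (forall x y, D x -> D y -> D (x + y)) ->
  (forall (t : R) x, D x -> D (t%:C *: x)) ->
  (forall x y, D x -> D y -> l (x + y) = l x + l y) ->
  (forall (t : R) x, D x -> l (t%:C *: x) = t * l x) ->
  (forall x, D x -> l x ^+ 2 <= C * nsq x) ->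
  exists2 z, (forall e, 0 < e -> exists2 d, D d & nsq (z - d) < e) &
    forall x, D x -> l x = rip x z.
Proof.
move=> D0 DD DZ lD lZ hC.
have [y [Dy cy ly]] : exists y : nat -> H, [/\ forall n, D (y n),
  forall m n, nsq (y m - y n) <= 2 * m.+1%:R^-1 + 2 * n.+1%:R^-1 &
  forall x n, D x -> (rip x (y n) - l x) ^+ 2 <= nsq x * n.+1%:R^-1].
  apply: (@pre_riesz R H D (@rip R H) l (Num.max C 0)) => //.
  - by move=> x z _ _; exact: ripC.
  - by move=> x z w _ _ _; exact: ripDl.
  - by move=> t x z _ _; exact: ripZl.
  - by move=> x _; exact: nsq_ge0.
  - by rewrite le_max lexx orbT.
  - by move=> x Dx; apply: (le_trans (hC x Dx)); exact: le_mulC_max (nsq_ge0 _).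
have [z hz] : exists z, hcvg y z.
  apply: hilbert_complete => e e0.
  have e4 : 0 < e / 4 by rewrite divr_gt0.
  have [N hN] := inv_lt_eps e4; exists N => m n /hN hm /hN hn.
  apply: (le_lt_trans (cy m n)); move: hm hn.
  by move: (m.+1%:R^-1) (n.+1%:R^-1) => ? ?; lra.
exists z => [e e0|x Dx].
  have [N hN] := (hcvgP _ _).1 hz e e0; exists (y N) => //.
  by rewrite nsqBC hN.
have h := @hcvg_rip _ _ _ x hz.
apply/eqP; rewrite -subr_eq0 -normr_eq0; apply/eqP/le_anti; rewrite normr_ge0 andbT.
apply/ler_addgt0Pr => e e0; rewrite add0r.
have e2 : 0 < e / 2 by rewrite divr_gt0.
have [N _ hN] := (cvgrPdist_lt _ _).1 h _ e2.
have s0 : 0 < nsq x + 1 by have := nsq_ge0 x; lra.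
have [N' hN'] := inv_lt_eps (divr_gt0 (exprn_gt0 2 e2) s0).
pose n := maxn N N'.
have h1 := hN n (leq_maxl _ _); have := hN' n (leq_maxr _ _); have := ly x n Dx.
rewrite /= in h1; rewrite ltr_pdivlMr// => h2 h3.
have h4 : `|rip x (y n) - l x| < e / 2.
  rewrite -(@ltr_pXn2r _ 2)// ?nnegrE ?(ltW e2)// real_normK ?num_real//.
  apply: le_lt_trans h3; apply: (le_trans h2); rewrite mulrC.
  by rewrite ler_wpM2l ?invr_ge0//; lra.
rewrite [e](splitr e) -normrN opprB (ripC x z).
rewrite (_ : rip z x - l x = (rip z x - rip (y n) x) + (rip x (y n) - l x)); last first.
  by rewrite (ripC x); ring.
by apply: (le_trans (ler_normD _ _)); rewrite lerD ?ltW.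
Qed.

Lemma adjointE H K (T : H -> K) : bounded_op T ->
  forall x y, inner K (T x) y = inner H x (adjoint T y).
Proof.
move=> bT; have [lT _] := bT.
suff [S hS] : exists S : K -> H, forall x y, inner K (T x) y = inner H x (S y).
  by have := xgetPex (fun=> 0) (ex_intro (fun S : K -> H => forall x y, inner K (T x) y = inner H x (S y)) S hS).
have [C C0 hC] := bounded_nsq bT.
suff /choice[S hS] y : exists z, forall x, rip (T x) y = rip x z.
  by exists S => x y; apply: rip_inner.
have [||||||z _ hz] := @riesz_on H setT (fun x => rip (T x) y) (C * nsq y) => //.
- by exists 0.
- by move=> u v _ _; rewrite opD// ripDl.
- by move=> t u _; rewrite opZ// ripZl.
- move=> u _; apply: (le_trans (cauchy_schwarz _ _)).
  by rewrite mulrAC ler_wpM2r ?nsq_ge0.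
by exists z => x; exact: hz.
Qed.

Lemma adjoint_rip H K (T : H -> K) x y : bounded_op T -> rip (T x) y = rip x (adjoint T y).
Proof. by move=> bT; rewrite /rip adjointE. Qed.

Lemma adjoint_eq H K (T : H -> K) (S : K -> H) :
  (forall x y, rip (T x) y = rip x (S y)) -> linear T -> adjoint T = S.
Proof.
move=> h lT; have hS x y : inner K (T x) y = inner H x (S y) by exact: rip_inner.
have := xgetPex (fun=> 0) (ex_intro (fun S : K -> H => forall x y, inner K (T x) y = inner H x (S y)) S hS).
rewrite -/(adjoint T) => h2; apply/funext => y; apply: rip_eq => z.
by rewrite ripC [RHS]ripC /rip -h2 hS.
Qed.

Lemma bounded_adjoint_nsq H K (T : H -> K) C : bounded_op T -> 0 <= C ->
  (forall x, nsq (T x) <= C * nsq x) -> forall y, nsq (adjoint T y) <= C * nsq y.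
Proof.
move=> bT C0 hC y; set z := adjoint T y.
have h1 : nsq z = rip (T z) y by rewrite adjoint_rip.
have := cauchy_schwarz (T z) y; rewrite -h1 => h2.
have [->|z0] := eqVneq (nsq z) 0; first by rewrite mulr_ge0 ?nsq_ge0.
have zp : 0 < nsq z by rewrite lt_neqAle nsq_ge0 andbT eq_sym.
rewrite -(ler_pM2l zp) -expr2; apply: (le_trans h2).
by rewrite [leRHS]mulrCA mulrA ler_wpM2r ?nsq_ge0// mulrC; rewrite mulrC hC.
Qed.

Lemma bounded_adjoint H K (T : H -> K) : bounded_op T -> bounded_op (adjoint T).
Proof.
move=> bT; have [C C0 hC] := bounded_nsq bT.
apply: (@bounded_intro _ _ _ C) => [a x y|]; last exact: bounded_adjoint_nsq (ltW C0) hC.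
apply: rip_eq => z; rewrite ripC [RHS]ripC /rip -adjointE//.
by rewrite !innerDr !innerZr !adjointE.
Qed.

Lemma adjointK H K (T : H -> K) : bounded_op T -> adjoint (adjoint T) = T.
Proof.
move=> bT; apply: adjoint_eq; last by case: (bounded_adjoint bT).
by move=> x y; rewrite ripC -adjoint_rip// ripC.
Qed.

Lemma bounded_comp H K G (S : K -> G) (T : H -> K) :
  bounded_op S -> bounded_op T -> bounded_op (S \o T).
Proof.
move=> bS bT; have [C C0 hC] := bounded_nsq bS; have [B B0 hB] := bounded_nsq bT.
have [lS _] := bS; have [lT _] := bT.
apply: (@bounded_intro _ _ _ (C * B)) => [a x y|x] /=; first by rewrite lT lS.
by apply: (le_trans (hC _)); rewrite -mulrA ler_wpM2l// ltW.
Qed.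

Lemma bounded_comb H K (S T : H -> K) a :
  bounded_op S -> bounded_op T -> bounded_op (a *: S + T).
Proof.
move=> bS bT; have [C C0 hC] := bounded_nsq bS; have [B B0 hB] := bounded_nsq bT.
have [lS _] := bS; have [lT _] := bT.
set m := complex.Re a ^+ 2 + complex.Im a ^+ 2.
apply: (@bounded_intro _ _ _ (2 * (m * C) + 2 * B)) => [c x y|x].
  rewrite !fctE lS lT !scalerDr addrACA; congr (_ + _ + _).
  by rewrite !scalerA mulrC.
rewrite !fctE; apply: (le_trans (nsqD_le _ _)); rewrite nsqZ -/m.
have m0 : 0 <= m by rewrite addr_ge0 ?sqr_ge0.
have := ler_wpM2l m0 (hC x); have := hB x; lra.
Qed.

Lemma bounded_id H : bounded_op (@idfun H).
Proof. by apply: (@bounded_intro _ _ _ 1) => [//|x]; rewrite mul1r. Qed.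

Lemma adjoint_combr H K (S T : H -> K) (t : R) :
  bounded_op S -> bounded_op T -> adjoint (t%:C *: S + T) = t%:C *: adjoint S + adjoint T.
Proof.
move=> bS bT; apply: adjoint_eq => [x y|]; last by case: (bounded_comb t%:C bS bT).
by rewrite !fctE ripDl ripDr ripZl ripZr !adjoint_rip.
Qed.

Lemma adjoint_id H : adjoint (@idfun H) = idfun.
Proof. exact: adjoint_eq. Qed.

Definition approximable H (D : set H) (z : H) : Prop :=
  forall e, 0 < e -> exists2 d, D d & nsq (z - d) < e.

(** The last clause identifies the projection by tests on [D] alone, which is how the projection
    onto the closure of a domain is shown to commute with N'. *)
Lemma projection H (D : set H) : D 0 ->
  (forall a x y, D x -> D y -> D (a *: x + y)) ->
  exists P : H -> H, [/\ bounded_op P,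
    forall x, approximable D (P x) /\ (forall d, D d -> rip (x - P x) d = 0) &
    forall x p, approximable D p -> (forall d, D d -> rip (x - p) d = 0) -> P x = p].
Proof.
move=> D0 Dcomb.
have DD x y : D x -> D y -> D (x + y) by move=> Dx Dy; rewrite -(scale1r x); exact: Dcomb.
have DZ a x : D x -> D (a *: x) by move=> Dx; rewrite -[_ *: _]addr0; exact: Dcomb.
have approxD x y a : approximable D x -> approximable D y -> approximable D (a *: x + y).
  move=> hx hy e e0; set m := complex.Re a ^+ 2 + complex.Im a ^+ 2.
  have m0 : 0 <= m by rewrite addr_ge0 ?sqr_ge0.
  have m1 : 0 < m + 1 by lra.
  have e4 : 0 < e / 4 by rewrite divr_gt0.
  have [d Dd hd] := hx _ (divr_gt0 e4 m1); have [d' Dd' hd'] := hy _ e4.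
  exists (a *: d + d'); first exact: Dcomb.
  rewrite opprD addrACA -scalerBr; apply: (le_lt_trans (nsqD_le _ _)).
  rewrite nsqZ -/m; move: hd; rewrite ltr_pdivlMr// => hd.
  have : m * nsq (x - d) <= nsq (x - d) * (m + 1) by have := nsq_ge0 (x - d); lra.
  by lra.
have orth0 z : approximable D z -> (forall d, D d -> rip z d = 0) -> z = 0.
  move=> hz ho; apply: nsq_eq0; apply/le_anti; rewrite nsq_ge0 andbT.
  apply/ler_addgt0Pr => e e0; rewrite add0r; have [d Dd hd] := hz e e0.
  by move: hd; rewrite nsqB ho// => hd; have := nsq_ge0 d; lra.
have uniq x p q : approximable D p -> (forall d, D d -> rip (x - p) d = 0) ->
    approximable D q -> (forall d, D d -> rip (x - q) d = 0) -> p = q.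
  move=> hp op hq oq; apply/subr0_eq/orth0.
    by rewrite addrC -scaleN1r; exact: approxD.
  move=> d Dd; have := op d Dd; have := oq d Dd; rewrite !ripBl; lra.
have /choice[P hP] x : exists p, approximable D p /\ (forall d, D d -> rip (x - p) d = 0).
  have [||||||z hz hl] := @riesz_on H D (fun y => rip y x) (nsq x) => //.
  - by exists 0.
  - by move=> t y; exact: DZ.
  - by move=> y z _ _; rewrite ripDl.
  - by move=> t y _; rewrite ripZl.
  - by move=> y Dy; rewrite mulrC; exact: cauchy_schwarz.
  by exists z; split=> // d Dd; rewrite ripBl ripC hl// ripC subrr.
have Puniq x p : approximable D p -> (forall d, D d -> rip (x - p) d = 0) -> P x = p.
  by move=> hp op; have [h1 h2] := hP x; exact: (@uniq x).
exists P; split=> //.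
have Porth x : rip (x - P x) (P x) = 0.
  have [h1 h2] := hP x.
  suff h y : approximable D y -> rip (x - P x) y = 0 by exact: h.
  move=> hy; set u := x - P x.
  have hle e : 0 < e -> rip u y ^+ 2 <= 0 + nsq u * e.
    move=> e0; have [d Dd hd] := hy e e0.
    rewrite add0r -(subr0 (rip u y)) -(h2 d Dd) -ripBr.
    apply: (le_trans (cauchy_schwarz _ _)); rewrite ler_wpM2l ?nsq_ge0//; exact: ltW.
  have := le_eps_ge0 (nsq_ge0 u) hle => h.
  by apply/eqP; rewrite -sqrf_eq0 eq_le h sqr_ge0.
apply: (@bounded_intro _ _ _ 1) => [a x y|x].
  have [h1 h2] := hP x; have [h3 h4] := hP y.
  apply: Puniq; first exact: approxD.
  move=> d Dd; rewrite opprD addrACA -scalerBr ripDl h4// addr0 /rip innerZl innerE h2//.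
  by rewrite [rip _ ('i *: d)]h2 ?mulr0//; exact: DZ.
rewrite mul1r; have := Porth x; rewrite ripBl => h.
have : nsq (x - P x) = nsq x - nsq (P x) by rewrite nsqB /nsq; lra.
by have := nsq_ge0 (x - P x); lra.
Qed.

(** The bound makes the closure of the relation single-valued and everywhere defined. A relation
    is used because a vector of the Stinespring space is represented by many lists. *)
Lemma extension K G (P : K -> G -> Prop) C :
  (forall a v w v' w', P v w -> P v' w' -> P (a *: v + v') (a *: w + w')) ->
  0 <= C -> (forall v w, P v w -> nsq w <= C * nsq v) ->
  dense [set v | exists w, P v w] ->
  exists2 T : K -> G, bounded_op T & forall v w, P v w -> T v = w.
Proof.
move=> Pcomb C0 hC /dense_nsq dP.
pose cl v w := forall e, 0 < e -> exists v' w', [/\ P v' w', nsq (v - v') < e & nsq (w - w') < e].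
have clP v w : P v w -> cl v w.
  by move=> Pvw e e0; exists v, w; rewrite !subrr !nsq0.
have clcomb a v w v2 w2 : cl v w -> cl v2 w2 -> cl (a *: v + v2) (a *: w + w2).
  move=> h h' e e0; set m := complex.Re a ^+ 2 + complex.Im a ^+ 2.
  have m0 : 0 <= m by rewrite addr_ge0 ?sqr_ge0.
  have m1 : 0 < m + 1 by lra.
  have e4 : 0 < e / 4 by rewrite divr_gt0.
  have [x [y [Pxy hx hy]]] := h _ (divr_gt0 e4 m1).
  have [x' [y' [Pxy' hx' hy']]] := h' _ e4.
  move: hx hy; rewrite !ltr_pdivlMr// => hx hy.
  exists (a *: x + x'), (a *: y + y'); split; first exact: Pcomb.
    rewrite opprD addrACA -scalerBr; apply: (le_lt_trans (nsqD_le _ _)).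
    by rewrite nsqZ -/m; have := nsq_ge0 (v - x); lra.
  rewrite opprD addrACA -scalerBr; apply: (le_lt_trans (nsqD_le _ _)).
  by rewrite nsqZ -/m; have := nsq_ge0 (w - y); lra.
have clb v w : cl v w -> nsq w <= 4 * C * nsq v.
  move=> h; apply: (@le_eps_ge0 _ _ _ (2 + 4 * C)); first by lra.
  move=> e e0; have [v' [w' [Pvw hv hw]]] := h e e0.
  have h1 := nsqD_le (w - w') w'; rewrite subrK in h1.
  have h2 := nsqD_le (v' - v) v; rewrite subrK nsqBC in h2.
  by have h3 := hC _ _ Pvw; nra.
have /choice[T hT] v : exists w, cl v w.
  have /choice[u hu] n : exists vw : K * G, P vw.1 vw.2 /\ nsq (v - vw.1) < n.+1%:R^-1.
    have [v' [w' Pvw] hv] := dP v n.+1%:R^-1 ltac:(by []).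
    by exists (v', w').
  have [w hw] : exists w, hcvg (fun n => (u n).2) w.
    apply: hilbert_complete => e e0.
    have c0 : 0 < 4 * C + 1 by lra.
    have [N hN] := inv_lt_eps (divr_gt0 e0 c0).
    exists N => m n /hN hm /hN hn; move: hm hn; rewrite !ltr_pdivlMr// => hm hn.
    have [Pm vm] := hu m; have [Pn vn] := hu n.
    have := hC _ _ (Pcomb (-1) _ _ _ _ Pn Pm); rewrite !scaleN1r ![- _ + _]addrC.
    have := nsqD_le ((u m).1 - v) (v - (u n).1); rewrite addrA subrK (nsqBC _ v).
    move=> h1 h2; have := ler_wpM2l C0 h1.
    have := ler_wpM2l C0 (ltW vm); have := ler_wpM2l C0 (ltW vn).
    have : 0 < m.+1%:R^-1 :> R by [].
    have : 0 < n.+1%:R^-1 :> R by [].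
    move: hm hn; move: (m.+1%:R^-1) (n.+1%:R^-1) => a b *; lra.
  exists w => e e0; have [N hN] := inv_lt_eps e0.
  have [N' hN'] := (hcvgP _ _).1 hw e e0.
  pose n := maxn N N'; have [Pn vn] := hu n.
  exists (u n).1, (u n).2; split=> //; first by apply: (lt_trans vn); exact/hN/leq_maxl.
  by rewrite nsqBC; exact/hN'/leq_maxr.
have uniq v w w' : cl v w -> cl v w' -> w = w'.
  move=> h h'; have := clcomb (-1) _ _ _ _ h' h.
  rewrite !scaleN1r addNr => /clb; rewrite nsq0 mulr0 => h0.
  by apply/subr0_eq/nsq_eq0/le_anti; rewrite nsq_ge0 addrC h0.
exists T => [|v w Pvw]; last by apply: (@uniq v) => //; exact: clP.
apply: (@bounded_intro _ _ _ (4 * C)) => [a x y|x]; last exact: clb.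
by apply: (@uniq (a *: x + y)) => //; exact: clcomb.
Qed.

(** [4 * rip (S v) w] is a difference of two values of the quadratic form of [S]; take for [w] the
    multiple of [S v] that balances the two terms. *)
Lemma symmetric_norm_le H (S : H -> H) e : linear S ->
  (forall x y, rip (S x) y = rip x (S y)) -> 0 < e ->
  (forall v, `|rip (S v) v| <= e * nsq v) -> forall v, nsq (S v) <= e ^+ 2 * nsq v.
Proof.
move=> lS symS e0 h v.
have [w [h5 h6]] : exists w, rip (S v) w = e^-1 * nsq (S v) /\ nsq w = e^-1 ^+ 2 * nsq (S v).
  by exists ((e^-1)%:C *: S v); rewrite ripZr nsqZr.
have h1 : rip (S (v + w)) (v + w) - rip (S (v - w)) (v - w) = 4 * rip (S v) w.
  by rewrite !opB// !opD// !ripE (symS w v) (ripC w); lra.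
have h3 := le_trans (ler_norm _) (h (v + w)).
have h2 : - rip (S (v - w)) (v - w) <= e * nsq (v - w).
  by apply: le_trans (h (v - w)); rewrite -normrN ler_norm.
have := parallelogram v w => h4.
have h7 : 4 * (e^-1 * nsq (S v)) <= e * (2 * nsq v + 2 * (e^-1 ^+ 2 * nsq (S v))).
  by rewrite -h5 -h1 -h6 -h4 mulrDr; lra.
have h8 : e * (2 * nsq v + 2 * (e^-1 ^+ 2 * nsq (S v))) = 2 * (e * nsq v) + 2 * (e^-1 * nsq (S v)).
  by field; rewrite gt_eqF.
rewrite h8 in h7.
have h9 : e^-1 * nsq (S v) <= e * nsq v by lra.
by rewrite expr2 -mulrA -ler_pdivrMl.
Qed.

End hilbert_operators.

(** * Integration against countably additive set functions *)

Import HBNNSimple.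

Notation emeas D h := (measurable_fun (D : set (measurableTypeR _)) (h : measurableTypeR _ -> \bar _)).
Notation rmeas g := (measurable_fun (setT : set (measurableTypeR _)) (g : measurableTypeR _ -> measurableTypeR _)).

(** Integrals only see the measures of the level sets of simple functions. *)
Lemma integral_raw (d : measure_display) (T : measurableType d) (R : realType)
    (m1 m2 : set T -> \bar R) (D : set T) (f : T -> \bar R) :
  (forall S, measurable S -> m1 S = m2 S) ->
  (\int[m1]_(x in D) f x = \int[m2]_(x in D) f x)%E.
Proof.
move=> h.
have hs (g : {nnsfun T >-> R}) : sintegral m1 g = sintegral m2 g.
  by apply: eq_fsbigr => r _; rewrite h//; exact: measurable_funPTI.
rewrite /integral; congr (ereal_sup _ - ereal_sup _)%E;
  by apply/seteqP; split=> _ [g hg <-]; exists g.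
Qed.

Section set_functions.
Context {R : realType}.
Implicit Types (nu : set R -> R) (D S : set R) (h : R -> \bar R) (g : R -> R).

(** The measures of the problem are functions on all sets of which only the values on Borel sets
    matter, and all are finite; [measure_of] turns them into bundled measures. *)
Definition countably_additive nu : Prop :=
  (forall S, borel_set S -> 0 <= nu S) /\
  (forall F : nat -> set R, (forall n, borel_set (F n)) -> trivIset setT F ->
     series (fun n => nu (F n)) @ \oo --> nu (\bigcup_n F n)).

(** Convertible to the integrals in the definition of the divergence. *)
Definition sint nu D (h : R -> \bar R) : \bar R :=
  (\int[(fun S => (nu S)%:E) : set (measurableTypeR R) -> \bar R]_(t in D) h t)%E.

Lemma ctbl_add0 nu : countably_additive nu -> nu set0 = 0.
Proof.
move=> [_ h].
have hF : trivIset setT (fun _ : nat => set0 : set R).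
  by apply/trivIsetP => *; rewrite setI0.
have := h (fun=> set0) (fun=> measurable0) hF; rewrite bigcup0// => c.
have : (fun=> nu set0) @ \oo --> (0 : R) by exact: (cvg_series_cvg_0 (cvgP _ c)).
by move=> h2; apply: (cvg_unique _ _ h2) => //; exact: cvg_cst.
Qed.

Lemma measure_of nu : countably_additive nu ->
  {mu : {measure set (measurableTypeR R) -> \bar R} | forall S, borel_set S -> mu S = (nu S)%:E}.
Proof.
move=> hnu; have n0 := ctbl_add0 hnu; case: hnu => nu_ge0 nu_add.
pose m (S : set (measurableTypeR R)) : \bar R := if `[< borel_set S >] then (nu S)%:E else 0%E.
have mE S : borel_set S -> m S = (nu S)%:E by move=> /asboolP h; rewrite /m h.
have m0 : m set0 = 0%E by rewrite mE ?n0//; exact: measurable0.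
have m_ge0 S : (0 <= m S)%E.
  by rewrite /m; case: asboolP => [/nu_ge0|//]; rewrite lee_fin.
have m_add : semi_sigma_additive m.
  move=> F mF tF mU; rewrite mE//.
  have -> : (fun n => \sum_(0 <= i < n) m (F i))%E = EFin \o series (fun n => nu (F n)).
    apply/funext => n /=; rewrite -sumEFin; apply: eq_bigr => i _; by rewrite (mE _ (mF i)).
  by apply/fine_cvgP; split; [exact: nearW|exact: nu_add].
exists (HB.pack_for (measure (measurableTypeR R) R) m (isMeasure.Build _ _ _ m m0 m_ge0 m_add)).
exact: mE.
Qed.

Lemma sintE nu (mu : {measure set (measurableTypeR R) -> \bar R}) D h :
  (forall S, borel_set S -> mu S = (nu S)%:E) -> sint nu D h = (\int[mu]_(t in D) h t)%E.
Proof. by move=> hm; apply: integral_raw => S mS; rewrite hm. Qed.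

Lemma eq_sint nu nu' D h : (forall S, borel_set S -> nu S = nu' S) ->
  sint nu D h = sint nu' D h.
Proof. by move=> e; apply: integral_raw => S mS; rewrite e. Qed.

Lemma nu_le nu A B : countably_additive nu -> borel_set A -> borel_set B ->
  A `<=` B -> nu A <= nu B.
Proof.
move=> hnu bA bB AB; have [mu hm] := measure_of hnu.
by rewrite -lee_fin -!hm//; apply: le_measure => //; rewrite inE.
Qed.

Lemma countably_additiveD nu nu' : countably_additive nu -> countably_additive nu' ->
  countably_additive (fun S => nu S + nu' S).
Proof.
move=> [p a] [p' a']; split=> [S bS|F bF tF]; first by rewrite addr_ge0 ?p ?p'.
rewrite (_ : series _ = series (fun n => nu (F n)) + series (fun n => nu' (F n))).
  by apply: cvgD; [exact: a|exact: a'].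
by apply/funext => n; rewrite /series /= !fctE big_split.
Qed.

Lemma countably_additiveZ nu c : 0 <= c -> countably_additive nu ->
  countably_additive (fun S => c * nu S).
Proof.
move=> c0 [p a]; split=> [S bS|F bF tF]; first by rewrite mulr_ge0 ?p.
rewrite (_ : series _ = c \*o series (fun n => nu (F n))).
  by apply: cvgMl_tmp; exact: a.
by apply/funext => n; rewrite /series /= mulr_sumr.
Qed.

Lemma sint_ge0 nu D h : countably_additive nu -> (forall t, D t -> (0 <= h t)%E) ->
  (0 <= sint nu D h)%E.
Proof.
by move=> hnu h0; have [mu hm] := measure_of hnu; rewrite (sintE _ _ hm) integral_ge0.
Qed.

Lemma sintD nu nu' D h : countably_additive nu -> countably_additive nu' ->
  borel_set D -> emeas D h -> (forall t, D t -> (0 <= h t)%E) ->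
  sint (fun S => nu S + nu' S) D h = (sint nu D h + sint nu' D h)%E.
Proof.
move=> hn hn' bD mh h0; have [mu hm] := measure_of hn; have [mu' hm'] := measure_of hn'.
rewrite (sintE _ _ hm) (sintE _ _ hm') -ge0_integral_measure_add//.
by apply: sintE => S bS; rewrite [LHS]measure_addE hm// hm'.
Qed.

Lemma sintZ nu c D h : 0 <= c -> countably_additive nu ->
  borel_set D -> emeas D h -> (forall t, D t -> (0 <= h t)%E) ->
  sint (fun S => c * nu S) D h = (c%:E * sint nu D h)%E.
Proof.
move=> c0 hn bD mh h0; have [mu hm] := measure_of hn.
rewrite (sintE _ _ hm) -(ge0_integral_mscale mu bD (NngNum c0) mh h0).
by apply: sintE => S bS; rewrite /= /mscale /= hm.
Qed.

Lemma le_sint nu nu' D h : countably_additive nu -> countably_additive nu' ->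
  (forall S, borel_set S -> nu S <= nu' S) -> 
  borel_set D -> emeas D h -> (forall t, D t -> (0 <= h t)%E) ->
  (sint nu D h <= sint nu' D h)%E.
Proof.
move=> hn hn' le bD mh h0.
have hd : countably_additive (fun S => nu' S - nu S).
  split=> [S bS|F bF tF]; first by rewrite subr_ge0 le.
  case: hn hn' => [_ a] [_ a'].
  rewrite (_ : series _ = series (fun n => nu' (F n)) - series (fun n => nu (F n))).
    by apply: cvgB; [exact: a'|exact: a].
  by apply/funext => n; rewrite /series /= !fctE sumrB.
rewrite -(@eq_sint (fun S => nu S + (nu' S - nu S)) nu'); last first.
  by move=> S _; rewrite addrC subrK.
by rewrite sintD// leeDl// sint_ge0.
Qed.

(** The negative part of [h] is bounded and the measure is finite. *)
Lemma sint_nonneg_part nu D h (L : R) : countably_additive nu -> borel_set D ->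
  emeas D h ->
  (forall t, D t -> ((- L)%:E <= h t)%E) ->
  (sint nu D h < +oo)%E <-> (sint nu D (fun t => maxe (h t) 0) < +oo)%E.
Proof.
move=> hn bD mh hL; have [mu hm] := measure_of hn.
rewrite (_ : (fun t => maxe (h t) 0) = (h^\+)%E); last by apply/funext => t; rewrite funeposE.
rewrite !(sintE _ _ hm) integralE.
have neg_fin : (\int[mu]_(x in D) (h^\- x)%E < +oo)%E.
  apply: (@le_lt_trans _ _ (\int[mu]_(x in D) (Num.max L 0)%:E)%E).
    apply: ge0_le_integral => //; first exact: measurable_funeneg.
    move=> t Dt; rewrite funenegE EFin_max ge_max !le_max lexx orbT andbT.
    by rewrite leeNl -EFinN hL.
  by rewrite integral_cst// hm// -EFinM ltry.
have neg0 : (0 <= \int[mu]_(x in D) (h^\- x)%E)%E by exact: integral_ge0.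
have fn : (\int[mu]_(x in D) (h^\- x)%E \is a fin_num)%E by rewrite ge0_fin_numE.
split=> [|h1]; last by apply: (le_lt_trans _ h1); rewrite leeBlDr// leeDl.
by rewrite lteBlDr//; move=> /lt_le_trans; apply; rewrite addye ?leey// -ltNye; apply: lt_le_trans neg0.
Qed.

Lemma sint_pinfty_null nu D Z h : countably_additive nu -> borel_set D -> borel_set Z ->
  Z `<=` D -> emeas D h -> (forall t, D t -> (0 <= h t)%E) ->
  (forall t, Z t -> h t = +oo%E) -> (sint nu D h < +oo)%E -> nu Z = 0.
Proof.
move=> hn bD bZ ZD mh h0 hZ; have [mu hm] := measure_of hn.
rewrite !(sintE _ _ hm) => fin; apply/eqP; apply: contraTT fin => nz.
rewrite -leNgt; apply: (@le_trans _ _ (\int[mu]_(x in Z) h x)%E); last first.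
  exact: ge0_subset_integral.
rewrite (eq_integral (cst +oo%E)) => [|x]; last by rewrite inE => /hZ.
rewrite integral_cst// hm// gt0_mulye// lte_fin lt_neqAle eq_sym nz.
by case: hn => h1 _; exact: h1.
Qed.

Lemma sint_null nu D Z h : countably_additive nu -> borel_set D -> borel_set Z ->
  emeas D h -> (forall t, D t -> (0 <= h t)%E) ->
  nu Z = 0 -> sint nu D h = sint nu (D `\` Z) h.
Proof.
move=> hn bD bZ mh h0 z; have [mu hm] := measure_of hn.
by rewrite !(sintE _ _ hm) (ge0_negligible_integral bZ bD mh h0)// hm// z.
Qed.

Lemma sint_le_cst nu D h (c : R) : countably_additive nu -> borel_set D ->
  emeas D h -> (forall t, D t -> (0 <= h t)%E) ->
  (forall t, D t -> (h t <= c%:E)%E) -> (sint nu D h <= (c * nu D)%:E)%E.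
Proof.
move=> hn bD mh h0 hc; have [mu hm] := measure_of hn.
rewrite (sintE _ _ hm) EFinM -hm// -integral_cst//.
by apply: ge0_le_integral.
Qed.

Lemma sint_ge_cst nu D h (c : R) : countably_additive nu -> borel_set D ->
  emeas D h -> 0 <= c ->
  (forall t, D t -> (c%:E <= h t)%E) -> ((c * nu D)%:E <= sint nu D h)%E.
Proof.
move=> hn bD mh c0 hc; have [mu hm] := measure_of hn.
rewrite (sintE _ _ hm) EFinM -hm// -integral_cst//.
by apply: ge0_le_integral => //.
Qed.

Definition level (g : R -> R) m (i : nat) : set R :=
  g @^-1` `[i%:R / m.+1%:R, i.+1%:R / m.+1%:R[%classic.

Lemma borel_level g m i : rmeas g ->
  borel_set (level g m i).
Proof. by move=> mg; rewrite -[level _ _ _]setTI; apply: mg => //; exact: measurable_itv. Qed.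

Lemma level_trivIset g m (D : set nat) : trivIset D (level g m).
Proof.
apply/trivIsetP => i j _ _ ij; apply/seteqP; split=> // t [].
rewrite /level /= !in_itv /= => /andP[h1 h2] /andP[h3 h4].
have a : (i%:R < j.+1%:R :> R).
  by have := le_lt_trans h1 h4; rewrite ltr_pM2r.
have b : (j%:R < i.+1%:R :> R).
  by have := le_lt_trans h3 h2; rewrite ltr_pM2r.
move: a b; rewrite !ltr_nat !ltnS => a b.
by move/eqP: ij; apply; apply/eqP; rewrite eqn_leq a.
Qed.

Lemma level_cover g (L : R) m n : (forall t, 0 <= g t <= L) -> L * m.+1%:R < n%:R ->
  \bigcup_(i in `I_n) level g m i = setT.
Proof.
move=> hg hn; apply/seteqP; split=> // t _.
have /andP[g0 gL] := hg t.
have p0 : 0 <= g t * m.+1%:R by rewrite mulr_ge0.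
have /andP[h1 h2] := Num.Theory.truncn_itv p0.
exists (Num.truncn (g t * m.+1%:R)) => /=.
  rewrite -(ltr_nat R); apply: (le_lt_trans h1); apply: le_lt_trans hn.
  by rewrite ler_wpM2r.
by rewrite /level /= in_itv /= ler_pdivrMr// ltr_pdivlMr// h1 h2.
Qed.

(** On [level g m i] the function [g] exceeds [i / m.+1] by at most [1 / m.+1]. *)
Lemma level_sum nu g (L : R) m n : countably_additive nu ->
  rmeas g ->
  (forall t, 0 <= g t <= L) -> L * m.+1%:R < n%:R ->
  exists2 I : R, sint nu setT (EFin \o g) = I%:E &
    \sum_(i < n) (i%:R / m.+1%:R) * nu (level g m i) <= I <=
    \sum_(i < n) (i%:R / m.+1%:R) * nu (level g m i) + nu setT / m.+1%:R.
Proof.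
move=> hn mg hg hL; have [mu hm] := measure_of hn.
have bl i : borel_set (level g m i) by exact: borel_level.
have mEg D : emeas D (EFin \o g).
  by apply/measurable_EFinP; exact: measurable_funTS.
have cov : \big[setU/set0]_(i < n) level g m i = setT.
  by rewrite -(level_cover hg hL) bigcup_mkord.
have intE : sint nu setT (EFin \o g) = (\sum_(i < n) sint nu (level g m i) (EFin \o g))%E.
  rewrite (sintE _ _ hm) -[in LHS]cov ge0_integral_bigsetU//=.
  - by apply: eq_bigr => i _; rewrite (sintE _ _ hm).
  - by move=> i; exact: bl.
  - exact: index_enum_uniq.
  - by move=> i j _ _ ne; apply: val_inj; exact: (@level_trivIset g m setT i j I I ne).
  - by move=> x _; rewrite lee_fin; case/andP: (hg x).
have lo (i : 'I_n) : ((i%:R / m.+1%:R * nu (level g m i))%:E <= sint nu (level g m i) (EFin \o g))%E.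
  apply: sint_ge_cst; [exact: hn|exact: bl|exact: mEg|exact: divr_ge0|].
  by move=> t /=; rewrite /level /= in_itv /= lee_fin => /andP[].
have hi (i : 'I_n) : (sint nu (level g m i) (EFin \o g) <= (i.+1%:R / m.+1%:R * nu (level g m i))%:E)%E.
  apply: sint_le_cst; [exact: hn|exact: bl|exact: mEg|move=> t _|move=> t /=].
    by rewrite lee_fin; case/andP: (hg t).
  by rewrite /level /= in_itv /= lee_fin => /andP[_ /ltW].
have s1 : ((\sum_(i < n) i%:R / m.+1%:R * nu (level g m i))%:E <= sint nu setT (EFin \o g))%E.
  by rewrite intE -sumEFin lee_sum.
have s2 : (sint nu setT (EFin \o g) <= (\sum_(i < n) i.+1%:R / m.+1%:R * nu (level g m i))%:E)%E.
  by rewrite intE -sumEFin lee_sum.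
have sn : \sum_(i < n) nu (level g m i) = nu setT.
  apply: EFin_inj; rewrite -sumEFin -hm; last exact: measurableT.
  rewrite -cov measure_bigsetU//; last exact: level_trivIset.
  by apply: eq_bigr => i _; symmetry; apply: hm; exact: bl.
move: s1 s2; case E : (sint _ _ _) => [I| |]; rewrite ?leye_eq ?leeNy_eq// !lee_fin => s1 s2.
exists I => //; rewrite s1 /=; apply: (le_trans s2).
rewrite -sn mulr_suml -big_split /= ler_sum// => i _.
by rewrite -addn1 natrD mulrDl mulrDl mul1r [_^-1 * _]mulrC.
Qed.

End set_functions.

(** * Spectral integrals *)

Section symmetric_zero.
Context {R : realType} {K : hilbertType R}.

Lemma symmetric_zero (T : K -> K) : linear T ->
  (forall x y, rip (T x) y = rip x (T y)) -> (forall v, rip (T v) v = 0) -> forall v, T v = 0.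
Proof.
move=> lT sT h v; apply: rip_eq => w; rewrite rip0l.
have := h (v + w); rewrite opD// !ripDl !ripDr !h (sT w v) (ripC w); lra.
Qed.

Lemma symmetric_norm_le0 (T : K -> K) e : linear T ->
  (forall x y, rip (T x) y = rip x (T y)) -> 0 <= e ->
  (forall v, `|rip (T v) v| <= e * nsq v) -> forall v, nsq (T v) <= e ^+ 2 * nsq v.
Proof.
move=> lT sT; rewrite le_eqVlt => /predU1P[<-|e0] h v; last exact: symmetric_norm_le.
rewrite (symmetric_zero lT sT) ?nsq0 ?mulr_ge0 ?nsq_ge0 ?sqr_ge0// => w.
by apply/eqP; rewrite -normr_le0; have := h w; rewrite mul0r.
Qed.

Lemma geometric_zero (a C s t : R) : 0 <= a -> 0 <= s -> s < t ->
  (forall n, a * t ^+ n <= C * s ^+ n) -> a = 0.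
Proof.
move=> a0 s0 st h; have t0 : 0 < t by exact: le_lt_trans st.
apply/le_anti; rewrite a0 andbT.
have c : (fun n => C * (s / t) ^+ n) @ \oo --> (C * 0 : R).
  apply: cvgMl_tmp; apply: cvg_expr; rewrite ger0_norm ?divr_ge0// ?ltW//.
  by rewrite ltr_pdivrMr// mul1r.
rewrite -(mulr0 C) -(cvg_lim _ c)//; apply: limr_ge; first exact: cvgP c.
apply: nearW => n; rewrite expr_div_n mulrA ler_pdivlMr ?exprn_gt0//.
Qed.

End symmetric_zero.

Section spectral_calculus.
Context {R : realType} {K : hilbertType R} (E : set R -> K -> K).
Hypothesis hE : spectral_measure E.

(** The scalar spectral measure of the vector [v]. *)
Definition ev v (S : set R) : R := rip (E S v) v.

Lemma E_bounded S : borel_set S -> bounded_op (E S).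
Proof. by case: hE => h _ _ _ /h[]. Qed.
Lemma E_idem S v : borel_set S -> E S (E S v) = E S v.
Proof. by case: hE => h _ _ _ /h[_ e _]; rewrite -[in RHS]e. Qed.
Lemma E_adj S : borel_set S -> adjoint (E S) = E S.
Proof. by case: hE => h _ _ _ /h[]. Qed.
Lemma E_sym S x y : borel_set S -> rip (E S x) y = rip x (E S y).
Proof. by move=> bS; rewrite (adjoint_rip _ _ (E_bounded bS)) E_adj. Qed.
Lemma E_setT v : E setT v = v.
Proof. by case: hE => _ -> _ _. Qed.
Lemma E_setI S T v : borel_set S -> borel_set T -> E (S `&` T) v = E S (E T v).
Proof. by move=> bS bT; case: hE => _ _ -> . Qed.
Lemma evE S v : borel_set S -> ev v S = nsq (E S v).
Proof. by move=> bS; rewrite /ev -(E_idem v bS) E_sym// E_idem. Qed.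
Lemma E_comm S T v : borel_set S -> borel_set T -> E S (E T v) = E T (E S v).
Proof. by move=> bS bT; rewrite -!E_setI// setIC. Qed.

Lemma ev_ctbl v : countably_additive (ev v).
Proof.
split=> [S bS|F bF tF]; first by rewrite evE// nsq_ge0.
case: hE => _ _ _ /(_ F v bF tF) /cvg_hcvg /(@hcvg_rip _ _ _ _ v) c.
rewrite (_ : series _ = (fun n => rip (series (fun n => E (F n) v) n) v)) //.
by apply/funext => n; rewrite /series /= rip_suml.
Qed.

Lemma ev_setT v : ev v setT = nsq v.
Proof. by rewrite /ev E_setT. Qed.

Lemma E_le S v : borel_set S -> nsq (E S v) <= nsq v.
Proof.
move=> bS; rewrite -evE// -ev_setT; apply: nu_le => //; first exact: ev_ctbl.
exact: measurableT.
Qed.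

Lemma E_set0 v : E set0 v = 0.
Proof. by apply: nsq_eq0; rewrite -evE ?(ctbl_add0 (ev_ctbl v))//; exact: measurable0. Qed.

Lemma nu_setU (nu : set R -> R) S T : countably_additive nu -> borel_set S -> borel_set T ->
  S `&` T = set0 -> nu (S `|` T) = nu S + nu T.
Proof.
move=> hn bS bT ST; have [mu hm] := measure_of hn.
apply: EFin_inj; rewrite EFinD -!hm//; last exact: measurableU.
by rewrite measureU//; exact/eqP.
Qed.

Lemma nu_setC (nu : set R -> R) S : countably_additive nu -> borel_set S ->
  nu (~` S) = nu setT - nu S.
Proof.
move=> hn bS; rewrite -(setvU S) nu_setU//; first by rewrite addrK.
  exact: measurableC.
by rewrite setICl.
Qed.

Lemma E_setC S v : borel_set S -> E (~` S) v = v - E S v.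
Proof.
move=> bS; have bC : borel_set (~` S) by exact: measurableC.
have [lS _] := E_bounded bS; have [lC _] := E_bounded bC.
suff h : forall v, E (~` S) v + E S v - v = 0 by apply/subr0_eq; rewrite opprB addrA h.
apply: (@symmetric_zero R K (fun v => E (~` S) v + E S v - v)).
- by move=> a x y; rewrite lS lC opprD [X in X + _ = _]addrACA [LHS]addrACA scalerBr scalerDr.
- by move=> x y; rewrite ripBl ripBr ripDl ripDr !E_sym.
- move=> w; rewrite ripBl ripDl; have := nu_setC (ev_ctbl w) bS.
  by rewrite ev_setT /ev /nsq => ->; ring.
Qed.

Lemma E_orth S T v : borel_set S -> borel_set T -> S `&` T = set0 -> E S (E T v) = 0.
Proof. by move=> bS bT ST; rewrite -E_setI// ST E_set0. Qed.

(** [T] is the spectral integral of [g]: being symmetric, it is determined by its quadratic form. *)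
Definition spectral_op (g : R -> R) (T : K -> K) : Prop :=
  [/\ bounded_op T, forall x y, rip (T x) y = rip x (T y) &
     forall v, sint (ev v) setT (EFin \o g) = (rip (T v) v)%:E].

Definition step_op (g : R -> R) m n v : K :=
  \sum_(i < n) (i%:R / m.+1%:R)%:C *: E (level g m i) v.

Section bounded_function.
Variables (g : R -> R) (L : R).
Hypothesis mg : rmeas g.
Hypothesis gL : forall t, 0 <= g t <= L.

Lemma step_op_linear m n : linear (step_op g m n).
Proof.
move=> a x y; rewrite /step_op scaler_sumr -big_split /=; apply: eq_bigr => i _.
have [lE _] := E_bounded (borel_level m i mg).
by rewrite lE scalerDr !scalerA mulrC.
Qed.

Lemma step_op_sym m n x y : rip (step_op g m n x) y = rip x (step_op g m n y).
Proof.
rewrite rip_suml rip_sumr; apply: eq_bigr => i _.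
by rewrite ripZl ripZr E_sym//; exact: borel_level.
Qed.

Lemma step_op_rip m n v : rip (step_op g m n v) v =
  \sum_(i < n) (i%:R / m.+1%:R) * ev v (level g m i).
Proof. by rewrite rip_suml; apply: eq_bigr => i _; rewrite ripZl. Qed.

Lemma step_op_comm m n (T : K -> K) v : linear T ->
  (forall S v, borel_set S -> T (E S v) = E S (T v)) ->
  T (step_op g m n v) = step_op g m n (T v).
Proof.
move=> lT h; rewrite op_sum//; apply: eq_bigr => i _.
by rewrite opZ// h//; exact: borel_level.
Qed.

(** [level_sum] compares the two quadratic forms, and a quadratic form controls the norm. *)
Lemma spectral_op_approx T m n : spectral_op g T -> L * m.+1%:R < n%:R ->
  forall v, nsq (T v - step_op g m n v) <= m.+1%:R^-1 ^+ 2 * nsq v.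
Proof.
move=> [bT sT iT] hn; have [lT _] := bT.
apply: (@symmetric_norm_le0 R K (fun v => T v - step_op g m n v)).
- move=> a x y; rewrite lT step_op_linear scalerBr opprD.
  by rewrite addrACA.
- by move=> x y; rewrite ripBl ripBr sT step_op_sym.
- by rewrite invr_ge0.
- move=> v; have [I hI] := level_sum (ev_ctbl v) mg gL hn.
  rewrite iT in hI; case: hI => <- /andP[h1 h2].
  rewrite ripBl step_op_rip ger0_norm ?subr_ge0//.
  by rewrite lerBlDl mulrC -ev_setT.
Qed.

(** [T] is a norm limit of step operators, which commute with the spectral projections. *)
Lemma spectral_op_comm T S v : spectral_op g T -> borel_set S -> E S (T v) = T (E S v).
Proof.
move=> sT bS; have [bT _ _] := sT; have [lT _] := bT; have [lE _] := E_bounded bS.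
apply/subr0_eq/nsq_eq0/le_anti; rewrite nsq_ge0 andbT.
apply: (@le_eps_ge0 _ _ _ (4 * nsq v)); first by rewrite mulr_ge0 ?nsq_ge0.
move=> e e0; rewrite add0r.
have [N hN] := inv_lt_eps e0; have {}hN := hN N (leqnn _).
have [n hn] : exists n, L * N.+1%:R < n%:R :> R.
  have L0 : 0 <= L by have /andP[/le_trans] := gL 0; apply.
  by exists (Num.bound (L * N.+1%:R)); rewrite archi_boundP ?mulr_ge0.
have app := spectral_op_approx sT hn.
pose Tm := step_op g N n.
have hc : E S (Tm v) = Tm (E S v).
  by apply: step_op_comm => // T' w bT'; exact: E_comm.
have -> : E S (T v) - T (E S v) = E S (T v - Tm v) - (T (E S v) - Tm (E S v)).
  by rewrite opB// hc opprB addrA subrK.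
apply: (le_trans (nsqB_le _ _)).
have h1 := le_trans (E_le (T v - Tm v) bS) (app v).
have h2 := app (E S v); have h3 := E_le v bS.
have u0 : 0 <= N.+1%:R^-1 ^+ 2 :> R by rewrite sqr_ge0.
have u1 : N.+1%:R^-1 ^+ 2 <= e.
  apply: le_trans (ltW hN); rewrite expr2 ler_piMl ?invr_ge0//.
  by rewrite invf_le1// ler1n.
have h4 := ler_wpM2l u0 h3; have h5 := ler_wpM2r (nsq_ge0 v) u1.
move: h1 h2 h4 h5; rewrite -/Tm; move: (_ ^+ 2) => u h1 h2 h4 h5; lra.
Qed.

Lemma spectral_op_bounds T S v a b : spectral_op g T -> borel_set S -> 0 <= a ->
  (forall t, S t -> a <= g t <= b) -> E S v = v ->
  a * nsq v <= rip (T v) v <= b * nsq v.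
Proof.
move=> [_ _ iT] bS a0 hab Sv.
have bC : borel_set (~` S) by exact: measurableC.
have z : ev v (~` S) = 0 by rewrite /ev E_setC// Sv subrr rip0l.
have mEg D : emeas D (EFin \o g) by apply/measurable_EFinP; exact: measurable_funTS.
have := iT v; rewrite (sint_null (ev_ctbl v) measurableT bC (mEg _) _ z)//; last first.
  by move=> t _; rewrite lee_fin; case/andP: (gL t).
rewrite setTD setCK => e; apply/andP; split.
  rewrite -lee_fin -e -{1}Sv -evE//; apply: sint_ge_cst => //; first exact: ev_ctbl.
  by move=> t /hab/andP[]; rewrite lee_fin.
rewrite -lee_fin -e -{2}Sv -evE//; apply: sint_le_cst => //; first exact: ev_ctbl.
  by move=> t _; rewrite lee_fin; case/andP: (gL t).
by move=> t /hab/andP[_]; rewrite lee_fin.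
Qed.

End bounded_function.
End spectral_calculus.

(** * Commutation with spectral projections *)

Section commutation.
Context {R : realType} {K : hilbertType R}.

Lemma positive_op_sym (A : K -> K) : linear A -> positive_op A ->
  forall x y, rip (A x) y = rip x (A y).
Proof.
move=> lA pA x y; have im v : rip (A v) ('i *: v) = 0.
  by rewrite -Im_inner; apply: ger0_Im; exact: pA.
have ii (z : K) : 'i *: ('i *: z) = - z by rewrite scalerA -expr2 sqr_i scaleN1r.
have P u v : rip (A u) ('i *: v) + rip (A v) ('i *: u) = 0.
  have := im (u + v); rewrite (opD lA) scalerDr !ripDl !ripDr !im; lra.
have := P x ('i *: y); rewrite (opZ lA) ii ripNr inner_iZl ii ripNr (ripC x); lra.
Qed.

(** Extends the identity of [0, 1] to a bounded function, so that [A] is a spectral integral over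
    the whole line. *)
Definition clamp (t : R) : R := Num.min (Num.max t 0) 1.

Lemma clamp_bounds t : 0 <= clamp t <= 1.
Proof. by rewrite /clamp le_min ge_min le_max !lexx !orbT ler01. Qed.

Lemma clamp_id t : 0 <= t <= 1 -> clamp t = t.
Proof. by move=> /andP[h0 h1]; rewrite /clamp (max_idPl h0) (min_idPl h1). Qed.

Lemma clamp_meas : rmeas clamp.
Proof. by apply: measurable_minr => //; apply: measurable_maxr. Qed.

Variables (A : K -> K) (E : set R -> K -> K).
Hypothesis hA : positive_contraction A.
Hypothesis sA : spectral_decomposition01 A E.

Let hE : spectral_measure E. Proof. by case: sA. Qed.
Let bA : bounded_op A. Proof. by case: hA. Qed.
Let lA : linear A. Proof. by case: bA. Qed.
Let b01 : borel_set (`[0%R, 1%R]%classic : set R). Proof. exact: measurable_itv. Qed.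

Lemma E01 v : E `[0%R, 1%R]%classic v = v.
Proof. by case: sA => _ -> _. Qed.

Lemma E_restrict01 S v : borel_set S -> E (S `&` `[0%R, 1%R]%classic) v = E S v.
Proof. by move=> bS; rewrite (E_setI hE)// E01. Qed.

Lemma spectral_op_clamp : spectral_op E clamp A.
Proof.
split=> //; first by apply: positive_op_sym => //; case: hA.
move=> v; have bC : borel_set (~` `[0%R, 1%R]%classic : set R) by exact: measurableC.
have z : ev E v (~` `[0%R, 1%R]%classic) = 0 by rewrite /ev (E_setC hE)// E01 subrr rip0l.
have mc : emeas setT (EFin \o clamp) by apply/measurable_EFinP; exact: clamp_meas.
rewrite (sint_null (ev_ctbl hE v) measurableT bC mc _ z); last first.
  by move=> t _; rewrite lee_fin; case/andP: (clamp_bounds t).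
rewrite setTD setCK; case: sA => _ _ /(_ v) ->.
rewrite -[RHS]/(sint (ev E v) `[0%R, 1%R]%classic EFin).
have [mu hm] := measure_of (ev_ctbl hE v); rewrite !(sintE _ _ hm).
apply: eq_integral => t; rewrite inE /= in_itv /= => h.
by rewrite clamp_id.
Qed.

Let A_comm S v : borel_set S -> E S (A v) = A (E S v).
Proof.
by move=> bS; apply: (spectral_op_comm hE clamp_meas clamp_bounds) => //; exact: spectral_op_clamp.
Qed.

Let symA x y : rip (A x) y = rip x (A y).
Proof. by case: spectral_op_clamp. Qed.

Lemma A_bounds S v a b : borel_set S -> 0 <= a ->
  (forall t, S t -> 0 <= t <= 1 -> a <= t <= b) -> E S v = v ->
  a * nsq v <= rip (A v) v <= b * nsq v.
Proof.
move=> bS a0 h Sv.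
apply: (@spectral_op_bounds R K E hE clamp 1 clamp_meas clamp_bounds A (S `&` `[0%R, 1%R]%classic)) => //.
- exact: spectral_op_clamp.
- exact: measurableI.
- by move=> t [/h ht /=]; rewrite in_itv /= => t01; rewrite clamp_id// ht.
- by rewrite E_restrict01.
Qed.

Let Fs (s : R) := E `]-oo, s]%classic.
Let Gs (s : R) := E `]s, +oo[%classic.
Let bF (s : R) : borel_set (`]-oo, s]%classic : set R). Proof. exact: measurable_itv. Qed.
Let bG (s : R) : borel_set (`]s, +oo[%classic : set R). Proof. exact: measurable_itv. Qed.

Let GF s v : Gs s v = v - Fs s v.
Proof. by rewrite /Gs /Fs -(E_setC hE)// setCitvl. Qed.

Let AF_norm s w : 0 <= s -> nsq (A (Fs s w)) <= s ^+ 2 * nsq w.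
Proof.
move=> s0; have [lF _] := E_bounded hE (bF s).
apply: (@symmetric_norm_le0 R K (fun w => A (Fs s w))) => //.
- by move=> a x y; rewrite /Fs lF lA.
- by move=> x y; rewrite symA /Fs (E_sym hE)// A_comm.
move=> v; have -> : rip (A (Fs s v)) v = rip (A (Fs s v)) (Fs s v).
  by rewrite /Fs -[in LHS](E_idem hE v (bF s)) -A_comm// (E_sym hE).
have /andP[h1 h2] : 0 * nsq (Fs s v) <= rip (A (Fs s v)) (Fs s v) <= s * nsq (Fs s v).
  apply: (@A_bounds `]-oo, s]%classic) => //; last exact: E_idem.
  by move=> t /=; rewrite in_itv /= => -> /andP[-> _].
rewrite ger0_norm; last by rewrite mul0r in h1.
by apply: (le_trans h2); rewrite ler_wpM2l// (E_le hE).
Qed.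

Let iter_F s v n : 0 <= s -> Fs s (iter n A (Fs s v)) = iter n A (Fs s v) /\
  nsq (iter n A (Fs s v)) <= nsq v * (s ^+ 2) ^+ n.
Proof.
move=> s0; elim: n => [|n [IH1 IH2]] /=.
  by split; [exact: E_idem|rewrite mulr1 (E_le hE)].
split; first by rewrite /Fs A_comm// -/(Fs s _) IH1.
rewrite -IH1; apply: (le_trans (AF_norm _ s0)).
by rewrite (exprS (s ^+ 2) n) mulrCA ler_wpM2l ?sqr_ge0.
Qed.

Let AG_norm s w : 0 <= s -> Gs s w = w -> s ^+ 2 * nsq w <= nsq (A w).
Proof.
move=> s0 Gw.
have /andP[h1 _] : s * nsq w <= rip (A w) w <= 1 * nsq w.
  apply: (@A_bounds `]s, +oo[%classic) => // t /=; rewrite in_itv /= andbT => /ltW-> /andP[_ ->] //.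
have h2 := cauchy_schwarz (A w) w.
have [->|w0] := eqVneq (nsq w) 0; first by rewrite mulr0 nsq_ge0.
have wp : 0 < nsq w by rewrite lt_neqAle eq_sym w0 nsq_ge0.
rewrite -(ler_pM2r wp); apply: le_trans h2.
have -> : s ^+ 2 * nsq w * nsq w = (s * nsq w) ^+ 2 by ring.
by rewrite ler_sqr ?nnegrE ?mulr_ge0 ?(ltW wp)// (le_trans _ h1)// mulr_ge0 ?(ltW wp).
Qed.

Let iter_G s v n : Gs s (iter n A v) = iter n A (Gs s v).
Proof. by elim: n => //= n IH; rewrite /Gs A_comm// -/(Gs s _) IH. Qed.

Let iter_G_ge s v n : 0 <= s -> nsq (Gs s v) * (s ^+ 2) ^+ n <= nsq (iter n A (Gs s v)).
Proof.
move=> s0; elim: n => [|n IH] /=; first by rewrite mulr1.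
apply: le_trans (AG_norm s0 _); last first.
  by rewrite -iter_G /Gs (E_idem hE).
by rewrite (exprS (s ^+ 2) n) mulrCA ler_wpM2l ?sqr_ge0.
Qed.

Let G_zero s s' v C : 0 <= s -> s < s' ->
  (forall n, nsq (iter n A v) <= C * (s ^+ 2) ^+ n) -> Gs s' v = 0.
Proof.
move=> s0 ss h; apply: nsq_eq0; have s'0 : 0 <= s' by rewrite (le_trans s0)// ltW.
apply: (@geometric_zero R _ C (s ^+ 2) (s' ^+ 2)) => [|||n].
- exact: nsq_ge0.
- exact: sqr_ge0.
- by rewrite ltr_pXn2r.
apply: (le_trans (iter_G_ge v n s'0)); rewrite -iter_G.
by apply: le_trans (h n); exact: E_le.
Qed.

Let G_limit s v : (forall s', s < s' -> Gs s' v = 0) -> Gs s v = 0.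
Proof.
move=> h; apply: nsq_eq0; rewrite /Gs -(evE hE)//.
have [mu hm] := measure_of (ev_ctbl hE v).
have U : `]s, +oo[%classic = \bigcup_n `](s + n.+1%:R^-1), +oo[%classic :> set R.
  apply/seteqP; split=> t /=; rewrite in_itv /= ?andbT.
    move=> st; have [N hN] := inv_lt_eps (ltac:(by rewrite subr_gt0) : 0 < t - s).
    by exists N => //=; rewrite in_itv /= andbT -ltrBrDl hN.
  by move=> [n _] /=; rewrite in_itv /= andbT; apply: lt_trans; rewrite ltrDl.
apply/EFin_inj; rewrite -hm//; apply/le_anti; rewrite measure_ge0 andbT.
rewrite U; apply: (le_trans (generalized_Boole_inequality _ _ _)).
- by move=> i; exact: measurable_itv.
- by rewrite -U; exact: measurable_itv.
rewrite eseries0// => n _ _.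
rewrite hm; last exact: measurable_itv.
by rewrite (evE hE)// [E _ v]h ?nsq0// ltrDl.
Qed.

(** The range of the spectral projection of the half-line below s is the set of the vectors [v] for
    which the powers [A^n v] grow at most like [s^n]. An operator that commutes with [A] preserves
    this growth, hence this range; applied to [x] and to its adjoint, this gives commutation with
    the projection. The sets [S] for which [x] commutes with [E S] form a Dynkin system. *)
Lemma spectral_commute (x : K -> K) : bounded_op x ->
  (forall v, x (A v) = A (x v)) -> (forall v, adjoint x (A v) = A (adjoint x v)) ->
  forall S, borel_set S -> forall v, x (E S v) = E S (x v).
Proof.
have half y : bounded_op y -> (forall v, y (A v) = A (y v)) ->
    forall s v, y (Fs s v) = Fs s (y (Fs s v)).
  move=> bY cY s v; have [lY _] := bY; apply/subr0_eq; rewrite -GF.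
  have [s0|s0] := leP 0 s; last first.
    rewrite /Fs -E_restrict01// (_ : _ `&` _ = set0) ?(E_set0 hE) ?(op0 lY).
      by case: (E_bounded hE (bG s)) => lG _; rewrite /Gs (op0 lG).
    apply/seteqP; split=> // t [] /=; rewrite !in_itv /= => h1 /andP[h2 _].
    by have := le_lt_trans (le_trans h2 h1) s0; rewrite ltxx.
  apply: G_limit => s' ss'; have [C C0 hC] := bounded_nsq bY.
  apply: (G_zero (C := C * nsq v) s0 ss') => n.
  have -> : iter n A (y (Fs s v)) = y (iter n A (Fs s v)).
    by elim: n => //= n ->; rewrite cY.
  apply: (le_trans (hC _)); rewrite -mulrA ler_wpM2l ?(ltW C0)//.
  by case: (iter_F v n s0).
move=> bx cx cx'.
have cF s v : x (Fs s v) = Fs s (x v).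
  rewrite half//; apply: rip_eq => w; rewrite /Fs !(E_sym hE)// !(adjoint_rip _ _ bx) (E_sym hE)//.
  by rewrite -/(Fs s _) -(half _ (bounded_adjoint bx) cx').
have lx := bounded_linear bx.
have mE : @measurable _ (measurableTypeR R) = <<s @RGenOInfty.G R >>.
  exact: RGenOInfty.measurableE.
move=> S bS.
have := @dynkin_induction _ (measurableTypeR R) (@RGenOInfty.G R)
  (fun S => borel_set S -> forall v, x (E S v) = E S (x v)) mE.
apply => //.
- move=> _ _ [a ->] [b ->]; exists (Num.max a b).
  by apply/seteqP; split=> t /=; rewrite !in_itv /= !andbT gt_max => /andP.
- by move=> _ v; rewrite !(E_setT hE).
- move=> _ [a ->] _ v; rewrite -!/(Gs _ _) !GF (opB lx) cF //.
- move=> T bT IH _ v; rewrite !(E_setC hE)// (opB lx) IH//.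
- move=> F bFn tF IH _ v; have [_ _ _ cadd] := hE.
  have /cvg_hcvg h1 := cadd F v bFn tF; have /cvg_hcvg h2 := cadd F (x v) bFn tF.
  apply: hcvg_uniq h2; have := hcvg_op bx h1.
  rewrite (_ : (fun n => x _) = series (fun n => E (F n) (x v)))//.
  apply/funext => n; rewrite /series /= op_sum//; apply: eq_bigr => i _; exact: (IH i (bFn i)).
- by rewrite -mE.
Qed.

End commutation.

(** * Square-summable sequences of vectors *)

Section real_series.
Context {R : realType}.
Implicit Types u v : nat -> R.

Lemma series_cvg_of_bound u C : (forall n, 0 <= u n) -> (forall n, series u n <= C) ->
  cvgn (series u).
Proof.
move=> u0 hC; apply: nondecreasing_is_cvgn; last by exists C => _ [n _ <-].
by apply/nondecreasing_seqP => n; rewrite /series /= big_nat_recr //= lerDl.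
Qed.

Lemma series_le_lim u n : (forall n, 0 <= u n) -> cvgn (series u) -> series u n <= limn (series u).
Proof.
move=> u0 c; apply: nondecreasing_cvgn_le => //.
by apply/nondecreasing_seqP => m; rewrite /series /= big_nat_recr //= lerDl.
Qed.

Lemma series_term_le_lim u n : (forall n, 0 <= u n) -> cvgn (series u) -> u n <= limn (series u).
Proof.
move=> u0 c; apply: le_trans (series_le_lim n.+1 u0 c).
by rewrite /series /= big_nat_recr //= lerDr sumr_ge0.
Qed.

Lemma series_lim_ge0 u : (forall n, 0 <= u n) -> cvgn (series u) -> 0 <= limn (series u).
Proof. by move=> u0 c; apply: le_trans (u0 0%N) (series_term_le_lim 0 u0 c). Qed.

Lemma series_cvg_dominated u v : (forall n, `|u n| <= v n) -> cvgn (series v) -> cvgn (series u).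
Proof.
move=> uv c; apply: normed_cvg; have v0 n : 0 <= v n by exact: le_trans (uv n).
apply: (@series_cvg_of_bound _ (limn (series v))) => n //=.
apply: le_trans (series_le_lim n v0 c).
by rewrite /series /=; apply: ler_sum => i _.
Qed.

Lemma cvg_finsum (I : Type) (r : seq I) (F : I -> nat -> R) (l : I -> R) :
  (forall i, F i @ \oo --> l i) -> (fun n => \sum_(i <- r) F i n) @ \oo --> \sum_(i <- r) l i.
Proof.
move=> h; elim: r => [|i r IH].
  by rewrite big_nil; under eq_fun do rewrite big_nil; exact: cvg_cst.
by rewrite big_cons; under eq_fun do rewrite big_cons; apply: cvgD.
Qed.

(** Dominated convergence for series of real numbers. *)
Lemma tannery (u : nat -> nat -> R) v : (forall n k, 0 <= u n k <= v k) -> cvgn (series v) ->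
  (forall k, (fun n => u n k) @ \oo --> (0 : R)) ->
  (fun n => limn (series (u n))) @ \oo --> (0 : R).
Proof.
move=> uv cv u0.
have v0 k : 0 <= v k by have /andP[] := uv 0%N k; apply: le_trans.
have up n k : 0 <= u n k by case/andP: (uv n k).
have cu n : cvgn (series (u n)).
  apply: series_cvg_dominated cv => k; have /andP[h1 h2] := uv n k.
  by rewrite ger0_norm.
apply/(cvg0P (fun n => series_lim_ge0 (up n) (cu n))) => e e0.
have e2 : 0 < e / 2 by rewrite divr_gt0.
have [N0 _ /(_ N0 (leqnn _)) /= hK] := (cvgrPdist_lt _ _).1 cv _ e2.
have fin : (fun n => series (u n) N0) @ \oo --> (0 : R).
  rewrite (_ : 0 = \sum_(0 <= i < N0) (0 : R)); last by rewrite big1.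
  by apply: cvg_finsum => i; exact: u0.
have [N hN] := (cvg0P (fun n => sumr_ge0 _ (fun i _ => up n i))).1 fin _ e2.
exists N => n /hN h; rewrite (splitr e).
apply: le_lt_trans (ltrD h (le_lt_trans (ler_norm _) hK)).
apply: limr_le; first exact: cu.
exists N0 => // m /= Nm.
have E w : series w m - series w N0 = \sum_(N0 <= i < m) w i.
  by rewrite /series /= (big_cat_nat (leq0n N0) Nm) /= addrAC subrr add0r.
have h1 : series (u n) m - series (u n) N0 <= series v m - series v N0.
  rewrite !E.
  by apply: ler_sum => i _; case/andP: (uv n i).
have := series_le_lim m v0 cv; move: h1.
by rewrite lerBlDl => h1 h2; rewrite addrC -lerBlDr (le_trans _ (lerB h2 (lexx _)))// lerBlDl.
Qed.

End real_series.

Section l2_sequences.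
Context {R : realType} {H : hilbertType R}.

Lemma hcvg_nsq (u : nat -> H) x : hcvg u x -> (fun n => nsq (u n)) @ \oo --> nsq x.
Proof.
move=> h; have e n : nsq (u n) = nsq x + 2 * (rip (u n) x - nsq x) + nsq (u n - x).
  by rewrite nsqB; lra.
under eq_fun do rewrite e.
suff : (fun n => nsq x + 2 * (rip (u n) x - nsq x) + nsq (u n - x)) @ \oo -->
  nsq x + 2 * (nsq x - nsq x) + 0 by rewrite subrr mulr0 !addr0.
apply: cvgD; last exact: h.
apply: cvgD; first exact: cvg_cst.
by apply: cvgMl_tmp; apply: cvgB; [exact: hcvg_rip|exact: cvg_cst].
Qed.

Implicit Types a b c : nat -> H.

Definition l2 a : Prop := cvgn (series (fun n => nsq (a n))).
(** The real inner product of the space of square-summable sequences. *)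
Definition lb a b : R := limn (series (fun n => rip (a n) (b n))).

Lemma l2_of_bound a C : (forall n, series (fun n => nsq (a n)) n <= C) -> l2 a.
Proof. by apply: series_cvg_of_bound => n; exact: nsq_ge0. Qed.

Lemma l2_cvg a b : l2 a -> l2 b -> cvgn (series (fun n => rip (a n) (b n))).
Proof.
move=> ha hb; apply: (@series_cvg_dominated _ _ (fun n => nsq (a n) + nsq (b n))).
  move=> n; rewrite ler_norml; have := rip_young (a n) (b n).
  have := rip_youngN (a n) (b n); have := nsq_ge0 (a n); have := nsq_ge0 (b n).
  by move=> h1 h2 h3 h4; apply/andP; split; lra.
rewrite (_ : series _ = series (fun n => nsq (a n)) + series (fun n => nsq (b n))).
  exact: is_cvgD.
by apply/funext => n; rewrite /series /= !fctE big_split.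
Qed.

Lemma lb_ge0 a : l2 a -> 0 <= lb a a.
Proof. by move=> ha; apply: series_lim_ge0 => // n; exact: nsq_ge0. Qed.

Lemma l2_nsq_le a n : l2 a -> nsq (a n) <= lb a a.
Proof. by move=> ha; apply: (@series_term_le_lim _ (fun n => nsq (a n))) => // m; exact: nsq_ge0. Qed.

Lemma lbC a b : lb a b = lb b a.
Proof. by congr (limn (series _)); apply/funext => n; exact: ripC. Qed.

Lemma l2_comb (z : R[i]) a b : l2 a -> l2 b -> l2 (z *: a + b).
Proof.
move=> ha hb; set m := complex.Re z ^+ 2 + complex.Im z ^+ 2.
have m0 : 0 <= m by rewrite addr_ge0 ?sqr_ge0.
apply: (@l2_of_bound _ (2 * m * lb a a + 2 * lb b b)) => n.
apply: (@le_trans _ _ (2 * m * series (fun n => nsq (a n)) n + 2 * series (fun n => nsq (b n)) n)).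
  rewrite /series /= !mulr_sumr -big_split /= ler_sum// => i _.
  rewrite !fctE; apply: (le_trans (nsqD_le _ _)); rewrite nsqZ -/m mulrA //.
have h1 := @series_le_lim _ (fun n => nsq (a n)) n (fun=> nsq_ge0 _) ha.
have h2 := @series_le_lim _ (fun n => nsq (b n)) n (fun=> nsq_ge0 _) hb.
by rewrite lerD// ler_wpM2l// mulr_ge0.
Qed.

Lemma l2D a b : l2 a -> l2 b -> l2 (a + b).
Proof. by move=> ha hb; rewrite -(scale1r a); exact: l2_comb. Qed.
Lemma l2_0 : l2 0.
Proof.
apply: (@l2_of_bound _ 0) => n; rewrite /series /= big1// => i _; exact: nsq0.
Qed.
Lemma l2Z z a : l2 a -> l2 (z *: a).
Proof. by move=> ha; rewrite -[z *: a]addr0; apply: l2_comb => //; exact: l2_0. Qed.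
Lemma l2B a b : l2 a -> l2 b -> l2 (a - b).
Proof. by move=> ha hb; rewrite addrC -scaleN1r; exact: l2_comb. Qed.

Lemma lbDl a b c : l2 a -> l2 b -> l2 c -> lb (a + b) c = lb a c + lb b c.
Proof.
move=> ha hb hc; rewrite /lb -limD; [|exact: l2_cvg..]; congr (limn _).
by apply/funext => n; rewrite /series /= !fctE -big_split /=; apply: eq_bigr => i _; exact: ripDl.
Qed.

Lemma lbZl (t : R) a b : l2 a -> l2 b -> lb (t%:C *: a) b = t * lb a b.
Proof.
move=> ha hb; apply: cvg_lim => //.
rewrite (_ : series _ = (fun n => t * series (fun n => rip (a n) (b n)) n)).
  by apply: cvgMl_tmp; exact: l2_cvg.
by apply/funext => n; rewrite /series /= mulr_sumr; apply: eq_bigr => i _; exact: ripZl.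
Qed.

Lemma lbDr a b c : l2 a -> l2 b -> l2 c -> lb c (a + b) = lb c a + lb c b.
Proof. by move=> *; rewrite lbC lbDl// (lbC a) (lbC b). Qed.
Lemma lbZr (t : R) a b : l2 a -> l2 b -> lb a (t%:C *: b) = t * lb a b.
Proof. by move=> *; rewrite lbC lbZl// lbC. Qed.
Lemma lbNl a b : l2 a -> l2 b -> lb (- a) b = - lb a b.
Proof. by move=> *; rewrite -realZ lbZl// mulN1r. Qed.
Lemma lbBl a b c : l2 a -> l2 b -> l2 c -> lb (a - b) c = lb a c - lb b c.
Proof. by move=> *; rewrite lbDl ?lbNl// -realZ; exact: l2Z. Qed.
Lemma lbBr a b c : l2 a -> l2 b -> l2 c -> lb c (a - b) = lb c a - lb c b.
Proof. by move=> *; rewrite lbC lbBl// (lbC a) (lbC b). Qed.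

Lemma lb_cs a b : l2 a -> l2 b -> lb a b ^+ 2 <= lb a a * lb b b.
Proof.
move=> ha hb; apply: discriminant_le; first exact: lb_ge0.
move=> t; have htb : l2 (t%:C *: b) by exact: l2Z.
have := lb_ge0 (l2D ha htb); rewrite lbDl ?lbDr ?lbZl ?lbZr//; last exact: l2D.
by rewrite (lbC b a); lra.
Qed.

Lemma l2_op (T : H -> H) a : bounded_op T -> l2 a -> l2 (T \o a).
Proof.
move=> /bounded_nsq[C C0 hC] ha; apply: (@l2_of_bound _ (C * lb a a)) => n.
apply: (@le_trans _ _ (C * series (fun n => nsq (a n)) n)).
  by rewrite /series /= mulr_sumr ler_sum.
by rewrite ler_pM2l//; apply: (@series_le_lim _ (fun n => nsq (a n))) => // m; exact: nsq_ge0.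
Qed.

Lemma lb_op_le (T : H -> H) C a : bounded_op T -> l2 a -> (forall v, nsq (T v) <= C * nsq v) ->
  lb (T \o a) (T \o a) <= C * lb a a.
Proof.
move=> bT ha hC; have c : (fun n => C * series (fun n => nsq (a n)) n) @ \oo --> C * lb a a.
  by apply: cvgMl_tmp.
rewrite -(cvg_lim _ c)//; apply: ler_lim; [exact: l2_op|exact: cvgP c|].
by apply: nearW => n; rewrite /series /= mulr_sumr ler_sum// => i _; exact: hC.
Qed.

Lemma lb_adj (T : H -> H) a b : bounded_op T -> lb (T \o a) b = lb a (adjoint T \o b).
Proof.
by move=> bT; congr (limn (series _)); apply/funext => n /=; rewrite adjoint_rip.
Qed.

Lemma l2_complete (y : nat -> nat -> H) : (forall j, l2 (y j)) ->
  (forall i j, lb (y i - y j) (y i - y j) <= 2 * i.+1%:R^-1 + 2 * j.+1%:R^-1) ->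
  exists2 th, l2 th & forall j, lb (y j - th) (y j - th) <= 2 * j.+1%:R^-1.
Proof.
move=> hy cy.
have /choice[th hth] k : exists l, hcvg (fun j => y j k) l.
  apply: hilbert_complete => e e0; have e4 : 0 < e / 4 by rewrite divr_gt0.
  have [N hN] := inv_lt_eps e4; exists N => i j /hN hi /hN hj.
  apply: (le_lt_trans (l2_nsq_le k (l2B (hy i) (hy j)))).
  apply: (le_lt_trans (cy i j)); move: hi hj.
  by move: (i.+1%:R^-1) (j.+1%:R^-1) => ? ?; lra.
have bd j n : series (fun k => nsq ((y j - th) k)) n <= 2 * j.+1%:R^-1.
  have c1 : (fun i => series (fun k => nsq ((y j - y i) k)) n) @ \oo -->
      series (fun k => nsq ((y j - th) k)) n.
    apply: cvg_finsum => k; rewrite !fctE.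
    have h : hcvg (fun i => y j k - y i k) (y j k - th k).
      apply: hcvgD; first exact: hcvg_const.
      by rewrite -scaleN1r; under eq_fun do rewrite -scaleN1r; apply: hcvgZ.
    exact: hcvg_nsq h.
  have c2 : (fun i => 2 * j.+1%:R^-1 + 2 * i.+1%:R^-1) @ \oo --> (2 * j.+1%:R^-1 + 2 * 0 : R).
    by apply: cvgD; [exact: cvg_cst|apply: cvgMl_tmp; exact: (@cvg_harmonic R)].
  rewrite mulr0 addr0 in c2.
  rewrite -(cvg_lim _ c1)// -(cvg_lim _ c2)//; apply: ler_lim; [exact: cvgP c1|exact: cvgP c2|].
  apply: nearW => i; apply: le_trans (cy j i).
  by apply: (@series_le_lim _ (fun k => nsq ((y j - y i) k))) => [m|]; [exact: nsq_ge0|exact: l2B].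
have ld j : l2 (y j - th) by apply: l2_of_bound; exact: bd.
exists th => [|j]; first by rewrite -[th](subKr (y 0%N)); exact: l2B.
by apply: limr_le; [exact: ld|apply: nearW; exact: bd].
Qed.

(** Bounded strong convergence implies sigma-weak convergence: apply [tannery] to the squared norms
    of the vectors [d n (a k)]. *)
Lemma lb_vanish (d : nat -> H -> H) a b C : (forall n, bounded_op (d n)) -> l2 a -> l2 b ->
  (forall n v, nsq (d n v) <= C * nsq v) -> (forall v, hcvg (fun n => d n v) 0) ->
  (fun n => lb (d n \o a) b) @ \oo --> (0 : R).
Proof.
move=> bd ha hb hC d0.
have c : (fun n => lb (d n \o a) (d n \o a)) @ \oo --> (0 : R).
  apply: (@tannery _ _ (fun k => C * nsq (a k))) => [n k||k].
  - by rewrite -/(nsq _) nsq_ge0 hC.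
  - rewrite (_ : series _ = (fun n => C * series (fun k => nsq (a k)) n)).
      by apply: is_cvgMl_tmp.
    by apply/funext => n; rewrite /series /= mulr_sumr.
  - have := d0 (a k); rewrite /hcvg; under eq_fun do rewrite subr0.
    by [].
apply/cvgrPdist_lt => e e0.
have B0 : 0 < lb b b + 1 by have := lb_ge0 hb; lra.
have [N hN] := (cvg0P (fun n => lb_ge0 (l2_op (bd n) ha))).1 c _ (divr_gt0 (exprn_gt0 2 e0) B0).
exists N => // n /= /hN; rewrite ltr_pdivlMr// => h; rewrite sub0r normrN.
rewrite -(@ltr_pXn2r _ 2)// ?nnegrE ?(ltW e0)// real_normK ?num_real//.
apply: le_lt_trans h; apply: (le_trans (lb_cs (l2_op (bd n) ha) hb)).
by rewrite ler_wpM2l ?lb_ge0//; [exact: l2_op|lra].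
Qed.

End l2_sequences.

(** * Positive normal functionals *)

Section von_neumann_algebra.
Context {R : realType} {H : hilbertType R} (N : set (H -> H)).
Hypothesis vnN : von_neumann N.

Lemma vn_bounded x : N x -> bounded_op x.
Proof. by case: vnN => h _ _; exact: h. Qed.
Lemma vn_adj x : N x -> N (adjoint x).
Proof. by case: vnN => _ h _; exact: h. Qed.
Lemma vn_intro x : bounded_op x ->
  (forall y, commutant N y -> forall v, x (y v) = y (x v)) -> N x.
Proof.
move=> bx h; case: vnN => _ _ <-; split=> // y cy.
by apply/funext => v /=; exact: h.
Qed.
Lemma vn_comm x y v : N x -> commutant N y -> y (x v) = x (y v).
Proof. by move=> Nx [_ h]; have := h x Nx => /(congr1 (fun f => f v)). Qed.
Lemma vn_id : N idfun.
Proof. by apply: vn_intro => //; exact: bounded_id. Qed.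
Lemma vn_comb a x y : N x -> N y -> N (a *: x + y).
Proof.
move=> Nx Ny; apply: vn_intro; first exact: bounded_comb (vn_bounded Nx) (vn_bounded Ny).
move=> z cz v; have [lz _] : bounded_op z by case: cz.
by rewrite !fctE lz (@vn_comm x z v Nx cz) (@vn_comm y z v Ny cz).
Qed.
Lemma vnD x y : N x -> N y -> N (x + y).
Proof. by move=> Nx Ny; rewrite -(scale1r x); exact: vn_comb. Qed.
Lemma vn0 : N 0.
Proof. by have := vn_comb (-1) vn_id vn_id; rewrite scaleN1r addNr. Qed.
Lemma vnZ a x : N x -> N (a *: x).
Proof. by move=> Nx; rewrite -[a *: x]addr0; apply: vn_comb => //; exact: vn0. Qed.
Lemma vnB x y : N x -> N y -> N (x - y).
Proof. by move=> Nx Ny; rewrite addrC -scaleN1r; exact: vn_comb. Qed.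
Lemma vn_comp x y : N x -> N y -> N (x \o y).
Proof.
move=> Nx Ny; apply: vn_intro; first exact: bounded_comp (vn_bounded Nx) (vn_bounded Ny).
by move=> z cz v /=; rewrite (@vn_comm x z (y v) Nx cz) (@vn_comm y z v Ny cz).
Qed.

Lemma commutant_adj y : commutant N y -> commutant N (adjoint y).
Proof.
move=> cy; have [bY _] := cy; split; first exact: bounded_adjoint.
move=> x Nx; apply/funext => v /=; apply: rip_eq => w.
rewrite ripC -adjoint_rip// [RHS]ripC -[x]adjointK; last exact: vn_bounded.
have bxa := vn_bounded (vn_adj Nx).
rewrite -!adjoint_rip//.
by rewrite (@vn_comm _ y w (vn_adj Nx) cy).
Qed.

End von_neumann_algebra.

Section positive_normal.
Context {R : realType} {H : hilbertType R} (N : set (H -> H)).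
Hypothesis vnN : von_neumann N.
Let bN x : N x -> bounded_op x. Proof. exact: vn_bounded. Qed.

Lemma comp_addl (x y : H -> H) (a : nat -> H) :
  (x + y : H -> H) \o a = (x \o a : nat -> H) + (y \o a : nat -> H).
Proof. by []. Qed.
Lemma comp_scalel z (x : H -> H) (a : nat -> H) : 
  (z *: x : H -> H) \o a = z *: (x \o a : nat -> H).
Proof. by []. Qed.

Lemma comp_addr (x : H -> H) (a b : nat -> H) : linear x ->
  x \o (a + b : nat -> H) = (x \o a : nat -> H) + (x \o b : nat -> H).
Proof. by move=> lx; apply/funext => n; rewrite /= !fctE opD. Qed.
Lemma comp_scaler z (x : H -> H) (a : nat -> H) : linear x ->
  x \o (z *: a : nat -> H) = z *: (x \o a : nat -> H).
Proof. by move=> lx; apply/funext => n; rewrite /= !fctE opZ. Qed.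
Lemma comp_subr (x : H -> H) (a b : nat -> H) : linear x ->
  x \o (a - b : nat -> H) = (x \o a : nat -> H) - (x \o b : nat -> H).
Proof. by move=> lx; apply/funext => n; rewrite /= !fctE opB. Qed.

(** [F] plays the part of the real part of a positive functional on N that is at most the vector
    functional of [ze]. *)
Definition dominated (ze : nat -> H) (F : (H -> H) -> R) : Prop :=
  [/\ forall x y, N x -> N y -> F (x + y) = F x + F y,
      forall (t : R) x, N x -> F (t%:C *: x) = t * F x,
      forall x y, N x -> N y -> F (adjoint y \o x) = F (adjoint x \o y) &
      forall x, N x -> 0 <= F (adjoint x \o x) <= lb (x \o ze) (x \o ze)].

Lemma dominated_cs ze F x y : dominated ze F -> N x -> N y ->
  F (adjoint y \o x) ^+ 2 <= F (adjoint y \o y) * F (adjoint x \o x).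
Proof.
move=> [FD FZ FC F0] Nx Ny; apply: discriminant_le; first by case/andP: (F0 x Nx).
move=> t; have Nt : N (t%:C *: x) by exact: vnZ.
have Nxa := vn_adj vnN Nx; have Nya := vn_adj vnN Ny.
have /andP[] := F0 _ (vnD vnN Nt Ny).
rewrite adjoint_combr; [|exact: bN..].
rewrite (_ : _ \o _ = adjoint y \o y + (t%:C *: (adjoint y \o x) +
   (t%:C *: (adjoint x \o y) + (t * t)%:C *: (adjoint x \o x)))); last first.
  have [la _] := bN Nxa; have [lb' _] := bN Nya.
  apply/funext => v /=; rewrite !fctE (opD lb') (opZ lb') (opD la) (opZ la).
  rewrite scalerDr scalerA -mulrC_C addrC -!addrA addrCA; congr (_ + (_ + _)).
  exact: addrC.
have c1 : N (adjoint y \o y) by exact: vn_comp.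
have c2 : N (adjoint y \o x) by exact: vn_comp.
have c3 : N (adjoint x \o y) by exact: vn_comp.
have c4 : N (adjoint x \o x) by exact: vn_comp.
rewrite !FD ?FZ//; try (by repeat (apply: vnD => //); try exact: vnZ); try exact: vnZ.
by rewrite (FC y x)//; lra.
Qed.

(** By Riesz for the form [lb (x \o ze) (y \o ze)] on N, [th] is a limit of sequences [y j \o ze]
    with [y j] in N. Passing to the limit in the Cauchy-Schwarz inequality of [F] bounds the vector
    functional of [th] by [F], so that it can be subtracted from [F]. *)
Lemma dominated_step ze F : l2 ze -> dominated ze F ->
  exists th, [/\ l2 th, forall x, N x -> F x = lb (x \o ze) th &
    forall x, N x -> lb (x \o th) (x \o th) <= F (adjoint x \o x)].
Proof.
move=> hz dF; have [FD FZ FC F0] := dF.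
have lz x : N x -> l2 (x \o ze) by move=> Nx; apply: l2_op => //; exact: bN.
have N1 := vn_id vnN.
have F1 : 0 <= F idfun.
  by have /andP[] := F0 idfun N1; rewrite adjoint_id.
have Fcs x : N x -> F x ^+ 2 <= F idfun * lb (x \o ze) (x \o ze).
  move=> Nx; have := dominated_cs dF Nx N1; rewrite adjoint_id => h.
  by apply: (le_trans h); rewrite ler_wpM2l//; case/andP: (F0 x Nx).
have [y [Ny cy ly]] : exists y : nat -> H -> H, [/\ forall n, N (y n),
  forall m n, lb ((y m - y n : H -> H) \o ze) ((y m - y n : H -> H) \o ze) <= 2 * m.+1%:R^-1 + 2 * n.+1%:R^-1 &
  forall x n, N x -> (lb (x \o ze) (y n \o ze) - F x) ^+ 2 <= lb (x \o ze) (x \o ze) * n.+1%:R^-1].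
  apply: (@pre_riesz R (H -> H) N (fun x y => lb (x \o ze) (y \o ze)) F (F idfun)) => //.
  - by exists idfun.
  - by move=> x y; exact: vnD.
  - by move=> t x; exact: vnZ.
  - by move=> x y _ _; exact: lbC.
  - by move=> x y z Nx Ny Nz; rewrite comp_addl lbDl//; exact: lz.
  - by move=> t x z Nx Nz; rewrite comp_scalel lbZl//; exact: lz.
  - by move=> x Nx; exact/lb_ge0/lz.
have ly2 j : l2 (y j \o ze) by exact: lz.
have [th lth hth] := l2_complete ly2 cy.
have close u j : l2 u -> `|lb u (y j \o ze) - lb u th| ^+ 2 <= lb u u * (2 * j.+1%:R^-1).
  move=> lu; rewrite -lbBr// real_normK ?num_real//; apply: (le_trans (lb_cs lu (l2B (ly2 j) lth))).
  by rewrite ler_wpM2l ?lb_ge0.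
have cvu u : l2 u -> (fun j => lb u (y j \o ze)) @ \oo --> lb u th.
  move=> lu; apply/cvgrPdist_lt => e e0.
  have B0 : 0 < 2 * lb u u + 1 by have := lb_ge0 lu; lra.
  have [M hM] := inv_lt_eps (divr_gt0 (exprn_gt0 2 e0) B0).
  exists M => // j /= /hM; rewrite ltr_pdivlMr// => h; rewrite distrC.
  rewrite -(@ltr_pXn2r _ 2)// ?nnegrE ?(ltW e0)//.
  apply: le_lt_trans h; apply: (le_trans (close u j lu)).
  have : 0 <= j.+1%:R^-1 :> R by rewrite invr_ge0.
  by move: (j.+1%:R^-1) (lb u u) => p q; lra.
have FE x : N x -> F x = lb (x \o ze) th.
  move=> Nx; apply: (@cvg_unique _ _ ((fun j => lb (x \o ze) (y j \o ze)) @ \oo)) => //.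
    apply/cvgrPdist_lt => e e0.
    have B0 : 0 < lb (x \o ze) (x \o ze) + 1 by have := lb_ge0 (lz x Nx); lra.
    have [M hM] := inv_lt_eps (divr_gt0 (exprn_gt0 2 e0) B0).
    exists M => // j /= /hM; rewrite ltr_pdivlMr// => h; rewrite distrC.
    rewrite -(@ltr_pXn2r _ 2)// ?nnegrE ?(ltW e0)// real_normK ?num_real//.
    apply: le_lt_trans h; apply: (le_trans (ly x j Nx)).
    by rewrite mulrC ler_wpM2l ?invr_ge0//; lra.
  exact: cvu (lz x Nx).
exists th; split=> // x Nx.
have Nxa := vn_adj vnN Nx; have bx := bN Nx; have bxa := bN Nxa.
have lw : l2 (x \o th) by exact: l2_op.
have Nxy j : N (x \o y j) by exact: vn_comp.
set w := x \o th; pose wj j := x \o (y j \o ze).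
have lwj j : l2 (wj j) by apply: l2_op.
have FxE j : F (adjoint x \o (x \o y j)) = lb (wj j) w.
  rewrite FE; last exact: vn_comp.
  by rewrite -[(_ \o _) \o ze]/(adjoint x \o (wj j)) lb_adj// adjointK.
have Fle j : lb (wj j) w ^+ 2 <= F (adjoint x \o x) * lb (wj j) (wj j).
  rewrite -FxE; apply: (le_trans (dominated_cs dF (Nxy j) Nx)).
  rewrite ler_wpM2l//; first by case/andP: (F0 x Nx).
  by have /andP[_] := F0 _ (Nxy j).
(* [Fle] passes to the limit, because [wj j] tends to [w] *)
have c0 : (fun j => lb (wj j - w) (wj j - w)) @ \oo --> (0 : R).
  have [C C0 hC] := bounded_nsq bx.
  have ld j : l2 (y j \o ze - th) by exact: l2B.
  apply/(cvg0P (fun j => lb_ge0 (l2B (lwj j) lw))) => e e0.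
  have [M hM] := inv_lt_eps (divr_gt0 e0 (ltac:(by rewrite mulr_gt0) : 0 < C * 2)).
  exists M => j /hM; rewrite ltr_pdivlMr ?mulr_gt0// => h; apply: le_lt_trans h.
  rewrite /wj /w -comp_subr; last by case: bx.
  apply: (le_trans (lb_op_le bx (ld j) hC)).
  have := ler_wpM2l (ltW C0) (hth j); move: (j.+1%:R^-1) => p; lra.
have c1 : (fun j => lb (wj j) w) @ \oo --> lb w w.
  have -> : (fun j => lb (wj j) w) = (fun j => lb (x \o (y j \o ze)) w) by [].
  have -> : (fun j => lb (x \o (y j \o ze)) w) = (fun j => lb (adjoint x \o w) (y j \o ze)).
    by apply/funext => j; rewrite lb_adj// lbC.
  rewrite (_ : lb w w = lb (adjoint x \o w) th); last by rewrite [LHS]lb_adj// lbC.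
  by apply: cvu; exact: l2_op.
have c2 : (fun j => lb (wj j) (wj j)) @ \oo --> lb w w.
  have e j : lb (wj j) (wj j) = lb (wj j - w) (wj j - w) + (2 * lb (wj j) w - lb w w).
    rewrite !(lbBl, lbBr) ?(lbC w)//; first (by ring); exact: l2B.
  under eq_fun do rewrite e.
  suff : (fun j => lb (wj j - w) (wj j - w) + (2 * lb (wj j) w - lb w w)) @ \oo -->
    0 + (2 * lb w w - lb w w).
    by rewrite (_ : 0 + _ = lb w w)//; ring.
  apply: cvgD => //; apply: cvgB; last exact: cvg_cst.
  by apply: cvgMl_tmp.
have : lb w w ^+ 2 <= F (adjoint x \o x) * lb w w.
  have d1 : (fun j => lb (wj j) w ^+ 2) @ \oo --> lb w w ^+ 2.
    by rewrite expr2; under eq_fun do rewrite expr2; apply: cvgM.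
  have d2 : (fun j => F (adjoint x \o x) * lb (wj j) (wj j)) @ \oo --> F (adjoint x \o x) * lb w w.
    by apply: cvgMl_tmp.
  rewrite -(cvg_lim _ d1)// -(cvg_lim _ d2)//; apply: ler_lim; [exact: cvgP d1|exact: cvgP d2|].
  exact: nearW.
have := lb_ge0 lw; rewrite -/w le_eqVlt => /predU1P[<- _|p].
  by case/andP: (F0 x Nx).
by rewrite expr2 ler_pM2r.
Qed.

End positive_normal.

Section double_series.
Context {R : realType}.

Lemma nneseries_cvgP (u : nat -> R) l : (forall n, 0 <= u n) ->
  (series u @ \oo --> l) <-> (\sum_(0 <= n <oo) (u n)%:E = l%:E)%E.
Proof.
move=> u0.
have e : (fun n => \sum_(0 <= i < n) (u i)%:E)%E = EFin \o series u.
  by apply/funext => n /=; rewrite sumEFin.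
split=> h.
  apply: cvg_lim => //; rewrite e; apply/fine_cvgP; split; first exact: nearW.
  exact: h.
have c : cvgn (series u).
  apply: (@series_cvg_of_bound _ _ l) => // n; rewrite -lee_fin -h.
  have := @nneseries_lim_ge R (EFin \o u) xpredT 0 n (fun k _ _ => u0 k).
  by rewrite /= sumEFin.
suff <- : limn (series u) = l by [].
apply: EFin_inj; rewrite -h; symmetry; apply: cvg_lim => //; rewrite e.
by apply/fine_cvgP; split; [exact: nearW|exact: c].
Qed.

Lemma nneseries_pair : exists tau : nat -> nat * nat, forall a : nat * nat -> \bar R,
  (forall p, (0 <= a p)%E) ->
  (\sum_(0 <= m <oo) a (tau m) = \sum_(0 <= k <oo) \sum_(0 <= n <oo) a (k, n))%E.
Proof.
have /card_set_bijP[tau btau] : ([set: nat] #= [set: nat * nat])%card.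
  by rewrite card_eq_sym; exact: card_nat2.
exists tau => a a0; rewrite nneseries_esumT// -(@reindex_esum _ _ _ _ _ _ a btau).
rewrite nneseries_esumT => [|k]; last by apply: nneseries_ge0.
rewrite (_ : [set: nat * nat] = [set: nat] `*`` (fun=> [set: nat])); last first.
  by apply/seteqP; split=> // -[].
transitivity (\esum_(k in [set: nat]) \esum_(n in [set: nat]) a (k, n))%E.
  by rewrite esum_esum//; apply: eq_esum => -[].
by apply: eq_esum => k _; rewrite nneseries_esumT.
Qed.

End double_series.

Section normal_functionals.
Context {R : realType} {H : hilbertType R} (N : set (H -> H)).
Hypothesis vnN : von_neumann N.
Let bN x : N x -> bounded_op x. Proof. exact: vn_bounded. Qed.
Let lN x : N x -> linear x. Proof. by move=> /bN[]. Qed.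

Lemma lb_esum (a : nat -> H) : l2 a -> (\sum_(0 <= n <oo) (nsq (a n))%:E = (lb a a)%:E)%E.
Proof. by move=> ha; apply/nneseries_cvgP => // n; exact: nsq_ge0. Qed.

Lemma l2_of_esum (a : nat -> H) (l : R) :
  (\sum_(0 <= n <oo) (nsq (a n))%:E = l%:E)%E -> l2 a /\ lb a a = l.
Proof.
move=> h; have c := (nneseries_cvgP l (fun n => nsq_ge0 (a n))).2 h.
by split; [exact: cvgP c|exact: cvg_lim c].
Qed.

Lemma dominated_sub ze F th : l2 ze -> l2 th -> dominated N ze F ->
  (forall x, N x -> lb (x \o th) (x \o th) <= F (adjoint x \o x)) ->
  dominated N ze (fun x => F x - lb (x \o th) th).
Proof.
move=> hz ht [FD FZ FC F0] le.
have lt x : N x -> l2 (x \o th) by move=> /bN bx; exact: l2_op.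
have E x y : N x -> N y -> lb ((adjoint y \o x) \o th) th = lb (x \o th) (y \o th).
  move=> Nx Ny; rewrite -[_ \o th]/(adjoint y \o (x \o th)) lb_adj ?adjointK//; try exact: bN.
  exact: (bN (vn_adj vnN Ny)).
split=> [x y Nx Ny|t x Nx|x y Nx Ny|x Nx].
- rewrite FD// comp_addl lbDl; [ring|exact: lt|exact: lt|exact: ht].
- rewrite FZ// comp_scalel lbZl; [ring|exact: lt|exact: ht].
- by rewrite FC// !E// lbC.
- have /andP[h1 h2] := F0 x Nx; rewrite E//; have := le x Nx.
  by have := lb_ge0 (lt x Nx); move=> h3 h4; apply/andP; split; lra.
Qed.

(** Vector functionals are subtracted greedily. The remainders [G n] are the functionals
    [lb (x \o ze) (t n)], and the squared norms of the [t n] are summable, so [G n] tends to 0 and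
    [F] is the sum of the vector functionals of the [t n], which are enumerated as one sequence.
    Polarisation passes from the products [adjoint x \o x] to all [x]. *)
Lemma dominated_sum ze F : l2 ze -> dominated N ze F ->
  exists th, l2 th /\ forall x, N x -> F x = lb (x \o th) th.
Proof.
move=> hz dF.
have /choice[T hT] G : exists th, dominated N ze G -> [/\ l2 th,
    forall x, N x -> G x = lb (x \o ze) th &
    forall x, N x -> lb (x \o th) (x \o th) <= G (adjoint x \o x)].
  have [d|nd] := pselect (dominated N ze G); last by exists 0.
  by have [th h] := dominated_step vnN hz d; exists th.
pose nxt G := fun x => G x - lb (x \o T G) (T G).
pose G n := iter n nxt F.
have dG n : dominated N ze (G n).
  elim: n => //= n IH; have [h1 h2 h3] := hT _ IH; exact: dominated_sub.
pose t n := T (G n).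
have l2t n : l2 (t n) by have [] := hT _ (dG n).
have lt x n : N x -> l2 (x \o t n) by move=> Nx; apply: l2_op => //; exact: bN.
have Nx'x x : N x -> N (adjoint x \o x) by move=> Nx; apply: vn_comp => //; exact: (vn_adj vnN).
have tele x n : N x -> series (fun k => lb (x \o t k) (x \o t k)) n =
    F (adjoint x \o x) - G n (adjoint x \o x).
  move=> Nx; rewrite /series /=; elim: n => [|n IH]; first by rewrite big_nil subrr.
  rewrite big_nat_recr//= IH /nxt -/(G n) -/(t n).
  rewrite (_ : lb ((adjoint x \o x) \o t n) (t n) = lb (x \o t n) (x \o t n)); first by ring.
  rewrite -[(_ \o x) \o t n]/(adjoint x \o (x \o t n)) lb_adj ?adjointK//; try exact: bN.
  exact: (bN (vn_adj vnN Nx)).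
have Gpos x n : N x -> 0 <= G n (adjoint x \o x).
  by move=> Nx; have [_ _ _ /(_ x Nx)/andP[]] := dG n.
have N1 := vn_id vnN.
have tsum : cvgn (series (fun k => lb (t k) (t k))).
  apply: (@series_cvg_of_bound _ _ (F (adjoint idfun \o idfun))) => n; first exact: lb_ge0.
  have := tele idfun n N1; rewrite (_ : (fun k => _) = (fun k => lb (t k) (t k)))// => ->.
  by rewrite gerBl Gpos.
have t0 := cvg_series_cvg_0 tsum.
have G0 x : N x -> (fun n => G n x) @ \oo --> (0 : R).
  move=> Nx; have lz : l2 (x \o ze) by apply: l2_op => //; exact: bN.
  have B0 : 0 < lb (x \o ze) (x \o ze) + 1 by have := lb_ge0 lz; lra.
  apply/cvgrPdist_lt => e e0.
  have [M hM] := (cvg0P (fun n => lb_ge0 (l2t n))).1 t0 _ (divr_gt0 (exprn_gt0 2 e0) B0).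
  exists M => // n /= /hM; rewrite ltr_pdivlMr// => h; rewrite sub0r normrN.
  have [_ GE _] := hT _ (dG n); rewrite GE// -/(t n).
  rewrite -(@ltr_pXn2r _ 2)// ?nnegrE ?(ltW e0)// real_normK ?num_real//.
  apply: le_lt_trans h; apply: (le_trans (lb_cs lz (l2t n))).
  by rewrite mulrC ler_wpM2l ?lb_ge0//; lra.
have Fser x : N x -> series (fun k => lb (x \o t k) (x \o t k)) @ \oo --> F (adjoint x \o x).
  move=> Nx; rewrite (_ : series _ = (fun n => F (adjoint x \o x) - G n (adjoint x \o x))).
    suff : (fun n => F (adjoint x \o x) - G n (adjoint x \o x)) @ \oo -->
      F (adjoint x \o x) - 0 by rewrite subr0.
    by apply: cvgB; [exact: cvg_cst|exact: G0 (Nx'x _ Nx)].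
  by apply/funext => n; exact: tele.
have [tau htau] := @nneseries_pair R.
pose th m := t (tau m).1 (tau m).2.
have key x : N x -> l2 (x \o th) /\ lb (x \o th) (x \o th) = F (adjoint x \o x).
  move=> Nx; apply: l2_of_esum.
  have := htau (fun p => (nsq (x (t p.1 p.2)))%:E) (fun p => nsq_ge0 _).
  rewrite /= => ->.
  rewrite -(nneseries_cvgP _ (fun k => lb_ge0 (lt x k Nx))).1; last exact: Fser.
  by apply: eq_eseriesr => k _; rewrite -lb_esum//; exact: lt.
have lth : l2 th by have [] := key _ N1.
exists th; split=> // x Nx.
have [FD FZ FC _] := dF.
have h1 := (key _ (vnD vnN Nx N1)).2; have h2 := (key _ (vnB vnN Nx N1)).2.
have lx : l2 (x \o th) by apply: l2_op => //; exact: bN.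
have Nxa := vn_adj vnN Nx; have Nxx := Nx'x _ Nx.
have Fadj : F (adjoint x) = F x by have := FC x idfun Nx N1; rewrite adjoint_id => ->.
have e1 : (x + idfun : H -> H) \o th = (x \o th : nat -> H) + th by [].
have e2 : (x - idfun : H -> H) \o th = (x \o th : nat -> H) - th by [].
have la := lN Nxa.
have a1 : adjoint (x + idfun) = adjoint x + idfun.
  by rewrite -[x]scale1r adjoint_combr ?adjoint_id ?scale1r//; [exact: bN|exact: bounded_id].
have a2 : adjoint (x - idfun) = adjoint x - idfun.
  rewrite addrC -realZ adjoint_combr ?adjoint_id ?realZ; [|exact: bounded_id|exact: bN].
  by rewrite addrC.
have f1 : (adjoint x + idfun : H -> H) \o (x + idfun : H -> H) =
    adjoint x \o x + (adjoint x + (x + idfun)).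
  by apply/funext => v; rewrite /= !fctE (opD la) !addrA.
have f2 : (adjoint x - idfun : H -> H) \o (x - idfun : H -> H) =
    adjoint x \o x + ((-1)%:C *: adjoint x + ((-1)%:C *: x + idfun)).
  by apply/funext => v; rewrite /= !fctE (opB la) !realZ opprB -!addrA; congr (_ + (_ + _)); exact: addrC.
rewrite a1 f1 e1 in h1; rewrite a2 f2 e2 in h2.
rewrite !FD// in h1; [|by repeat apply: vnD..].
rewrite !FD ?FZ// in h2; [|by repeat (apply: vnD => //); exact: vnZ..].
rewrite lbDl ?lbDr// ?(lbC th) in h1; last exact: l2D.
rewrite lbBl ?lbBr// ?(lbC th) in h2; last exact: l2B.
by rewrite Fadj in h1 h2; lra.
Qed.

End normal_functionals.

Section predual_theory.
Context {R : realType} {H : hilbertType R}.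

Lemma lb_i (a b : nat -> H) : l2 a -> l2 b -> lb ('i *: a) b = - lb a ('i *: b).
Proof.
move=> ha hb; rewrite /lb -limN; last by apply: l2_cvg => //; exact: l2Z.
congr (limn _); apply/funext => n; rewrite /series /= !fctE -sumrN.
by apply: eq_bigr => i _; exact: inner_iZl.
Qed.

Variable N : set (H -> H).
Hypothesis bN : forall x, N x -> bounded_op x.

Lemma ereal_sum_l2 (a : nat -> H) :
  (\sum_(0 <= n <oo) (complex.Re (inner H (a n) (a n)))%:E < +oo)%E -> l2 a.
Proof.
move=> h.
have h0 : (0 <= \sum_(0 <= n <oo) (nsq (a n))%:E)%E by apply: nneseries_ge0 => n _ _; rewrite lee_fin nsq_ge0.
have : (\sum_(0 <= n <oo) (nsq (a n))%:E)%E \is a fin_num by rewrite ge0_fin_numE.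
by move=> /fineK/esym/l2_of_esum[].
Qed.

Lemma l2_ereal_sum (a : nat -> H) : l2 a ->
  (\sum_(0 <= n <oo) (complex.Re (inner H (a n) (a n)))%:E < +oo)%E.
Proof. by move=> ha; rewrite (lb_esum ha) ltry. Qed.

Lemma predual_lb phi : predual N phi -> exists xi eta, [/\ l2 xi, l2 eta &
  forall x, N x -> phi x = lb (x \o xi) eta +i* lb (x \o xi) ('i *: eta)].
Proof.
move=> [xi [eta [/ereal_sum_l2 lxi /ereal_sum_l2 leta h]]]; exists xi, eta; split=> // x Nx.
have /cvgC[h1 h2] := h x Nx; apply: complex_eq => /=.
  rewrite -(cvg_lim _ h1)//; congr (limn _); apply/funext => n.
  by rewrite /series /= Re_sum.
rewrite -(cvg_lim _ h2)//; congr (limn _); apply/funext => n.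
rewrite /series /= (big_morph _ ImD (erefl : complex.Im 0 = 0 :> R)).
by apply: eq_bigr => i _; rewrite Im_inner.
Qed.

Lemma predual_intro phi xi eta : l2 xi -> l2 eta ->
  (forall x, N x -> phi x = lb (x \o xi) eta +i* lb (x \o xi) ('i *: eta)) -> predual N phi.
Proof.
move=> lxi leta h; exists xi, eta; split; [exact: l2_ereal_sum|exact: l2_ereal_sum|move=> x Nx].
have lx : l2 (x \o xi) by apply: l2_op => //; exact: bN.
apply/cvgC; rewrite h//=; split.
  rewrite (_ : (fun n => _) = series (fun n => rip (x (xi n)) (eta n))); first exact: l2_cvg.
  by apply/funext => n; rewrite /series /= Re_sum.
rewrite (_ : (fun n => _) = series (fun n => rip (x (xi n)) (('i *: eta) n))).
  by apply: l2_cvg => //; exact: l2Z.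
apply/funext => n; rewrite /series /= (big_morph _ ImD (erefl : complex.Im 0 = 0 :> R)).
by apply: eq_bigr => i _; rewrite Im_inner.
Qed.

Definition vector_functional (th : nat -> H) (x : H -> H) : R[i] :=
  lb (x \o th) th +i* lb (x \o th) ('i *: th).

Lemma vector_functional_pos th : l2 th -> predual_pos N (vector_functional th).
Proof.
move=> lth; split; first exact: (@predual_intro _ th th lth lth (fun _ _ => erefl)).
move=> x Nx px; apply: complex_ge0 => /=.
  rewrite /lb (_ : series _ = fun=> 0) ?lim_cst//.
  apply/funext => n; rewrite /series /= big1// => i _; rewrite !fctE -Im_inner.
  by apply: ger0_Im; exact: px.
apply: series_lim_ge0 => [n|]; first by apply: ge0_Re; exact: px.
by apply: l2_cvg => //; apply: l2_op => //; exact: bN.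
Qed.

(** Normality along bounded, strongly convergent sequences. *)
Lemma predual_normal phi (a : nat -> H -> H) b C : predual N phi -> (forall n, N (a n)) -> N b ->
  (forall n v, nsq (a n v - b v) <= C * nsq v) -> (forall v, hcvg (fun n => a n v) (b v)) ->
  (fun n => phi (a n)) @ \oo --> (phi b : R[i]^o).
Proof.
move=> /predual_lb[xi [eta [lxi leta h]]] Na Nb hC hc.
have bd n : bounded_op (fun v => a n v - b v).
  have := bounded_comb (-1) (bN Nb) (bN (Na n)); rewrite scaleN1r addrC.
  by [].
have main e : l2 e -> (fun n => lb (a n \o xi) e) @ \oo --> lb (b \o xi) e.
  move=> le.
  have := lb_vanish bd lxi le hC.
  have d0 v : hcvg (fun n => a n v - b v) 0.
    have := hc v; rewrite /hcvg; under [in X in _ -> X]eq_fun do rewrite subr0.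
    by [].
  move=> /(_ d0) h0.
  have e1 n : lb (a n \o xi) e = lb ((fun v => a n v - b v) \o xi) e + lb (b \o xi) e.
    rewrite -lbDl//; [|exact: l2_op|by apply: l2_op => //; exact: bN].
    by congr (lb _ _); apply/funext => k; rewrite !fctE /= subrK.
  under eq_fun do rewrite e1.
  suff : (fun n => lb ((fun v => a n v - b v) \o xi) e + lb (b \o xi) e) @ \oo --> 0 + lb (b \o xi) e.
    by rewrite add0r.
  by apply: cvgD => //; exact: cvg_cst.
apply/cvgC; rewrite (h b Nb); split.
  by under eq_fun do rewrite h//; exact: main.
by under eq_fun do rewrite h//; apply: main; exact: l2Z.
Qed.

End predual_theory.

Section positive_functionals.
Context {R : realType} {H : hilbertType R} (N : set (H -> H)).
Hypothesis vnN : von_neumann N.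
Let bN x : N x -> bounded_op x. Proof. exact: vn_bounded. Qed.

(** By polarisation, the functional [lb (x \o xi) eta] is dominated by the vector functional of
    [(xi + eta) / 2]. *)
Lemma positive_normal_vector phi : predual_pos N phi ->
  exists2 th, l2 th & forall x, N x -> phi x = vector_functional th x.
Proof.
move=> [/(predual_lb)[xi [eta [lxi leta h]]] ppos].
have lx x (a : nat -> H) : N x -> l2 a -> l2 (x \o a) by move=> /bN bx; exact: l2_op.
pose F x := complex.Re (phi x).
have FE x : N x -> F x = lb (x \o xi) eta by move=> Nx; rewrite /F h.
have FD x y : N x -> N y -> F (x + y) = F x + F y.
  move=> Nx Ny; rewrite !FE//; last exact: vnD.
  by rewrite comp_addl lbDl//; exact: lx.
have FZ (t : R) x : N x -> F (t%:C *: x) = t * F x.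
  move=> Nx; rewrite !FE//; last exact: vnZ.
  by rewrite comp_scalel lbZl//; exact: lx.
have Im_F x : N x -> complex.Im (phi x) = - F ('i *: x).
  move=> Nx; rewrite FE; last exact: vnZ.
  by rewrite comp_scalel lb_i ?opprK ?h//; exact: lx.
have Nxx x y : N x -> N y -> N (adjoint x \o y).
  by move=> Nx Ny; apply: vn_comp => //; exact: (vn_adj vnN).
have pos x : N x -> 0 <= phi (adjoint x \o x).
  move=> Nx; apply: ppos; first exact: Nxx.
  move=> v; rewrite /= innerC -adjointE ?inner_nsq; last exact: bN.
  by rewrite -inner_nsq -innerC inner_nsq (ler_C 0) nsq_ge0.
have im0 x : N x -> F ('i *: (adjoint x \o x)) = 0.
  by move=> Nx; have := ger0_Im (pos x Nx); rewrite Im_F; [lra|exact: Nxx].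
have FC x y : N x -> N y -> F (adjoint y \o x) = F (adjoint x \o y).
  move=> Nx Ny; have Niy : N ('i *: y) by exact: vnZ.
  have Nz : N ('i *: y + x) by exact: vnD.
  have := im0 _ Nz.
  have -> : adjoint ('i *: y + x) = - ('i *: adjoint y) + adjoint x.
    apply: adjoint_eq => [u v|]; last by case: (bN Nz).
    rewrite !fctE ripDl ripDr inner_iZl !(adjoint_rip _ _ (bN Nx)) ripNr.
    rewrite (_ : rip (y u) ('i *: v) = rip u ('i *: adjoint y v))//.
    have [lya _] := bN (vn_adj vnN Ny).
    by rewrite adjoint_rip ?(opZ lya)//; exact: bN.
  rewrite (_ : 'i *: _ = 'i *: (adjoint y \o y) + ('i *: (adjoint x \o x) +
     ((-1)%:C *: (adjoint x \o y) + (adjoint y \o x)))); last first.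
    have [lya _] := bN (vn_adj vnN Ny); have [lxa _] := bN (vn_adj vnN Nx).
    have ii (z : H) : 'i *: ('i *: z) = - z by rewrite scalerA -expr2 sqr_i scaleN1r.
    apply/funext => v; rewrite /= !fctE (opD lya) (opZ lya) (opD lxa) (opZ lxa) /=.
    rewrite !scalerDr !scalerN !ii !realZ scalerDr scalerN ii opprD !opprK -addrA.
    congr (_ + _); rewrite addrC [RHS]addrA; congr (_ + _); exact: addrC.
  have n1 := Nxx _ _ Nx Ny; have n2 := Nxx _ _ Ny Nx.
  have n3 : N ('i *: (adjoint x \o x)) by apply: vnZ => //; exact: Nxx.
  have n4 : N ('i *: (adjoint y \o y)) by apply: vnZ => //; exact: Nxx.
  have n5 : N ((-1)%:C *: (adjoint x \o y)) by exact: vnZ.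
  have n6 : N ((-1)%:C *: (adjoint x \o y) + (adjoint y \o x)) by exact: vnD.
  rewrite FD//; last exact: vnD.
  rewrite FD// FD// FZ// !im0//; lra.
pose ze : nat -> H := (2^-1)%:C *: (xi + eta).
have lze : l2 ze by apply: l2Z; exact: l2D.
have dF : dominated N ze F.
  split=> // x Nx; have bx := bN Nx; have [lin _] := bx.
  have n1 := Nxx _ _ Nx Nx.
  apply/andP; split; first exact/ge0_Re/pos.
  rewrite FE// -[(_ \o x) \o xi]/(adjoint x \o (x \o xi)) lb_adj; last exact: (bN (vn_adj vnN Nx)).
  rewrite adjointK// comp_scaler// comp_addr//.
  have la := lx _ _ Nx lxi; have lb' := lx _ _ Nx leta.
  have lab := l2D la lb'.
  rewrite lbZl ?lbZr//; last exact: l2Z.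
  rewrite lbDl// !lbDr//.
  have := lb_ge0 (l2B la lb'); rewrite lbBl ?lbBr//; last exact: l2B.
  rewrite (lbC (x \o eta) (x \o xi)); move: (lb _ _) (lb _ _) (lb _ _) => p q r.
  by rewrite mulrA (_ : 2^-1 * 2^-1 = 4^-1 :> R); [lra|field].
have [th [lth hth]] := dominated_sum vnN lze dF.
exists th => // x Nx; apply: complex_eq; rewrite /vector_functional /=.
  exact: hth.
rewrite Im_F// hth; last exact: vnZ.
by rewrite comp_scalel lb_i ?opprK//; exact: lx.
Qed.

(** The vector functional that represents [phi] on N makes sense on all bounded operators. *)
Lemma normal_extensionP phi : predual_pos N phi ->
  predual_pos (@bounded_op R H H) (normal_extension N phi) /\
  forall x, N x -> normal_extension N phi x = phi x.
Proof.
move=> pp; have [th lth hth] := positive_normal_vector pp.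
have ex : exists omega : (H -> H) -> R[i], predual_pos (@bounded_op R H H) omega /\
    forall x, N x -> omega x = phi x.
  exists (vector_functional th); split; first exact: vector_functional_pos.
  by move=> x Nx; rewrite hth.
exact: (xgetPex (fun=> 0) ex).
Qed.

End positive_functionals.

(** * Complete positivity tested on lists of vectors *)

Section limits.
Context {R : realType}.

Lemma hcvg_rip2 (H : hilbertType R) (u v : nat -> H) a b : hcvg u a -> hcvg v b ->
  (fun n => rip (u n) (v n)) @ \oo --> rip a b.
Proof.
move=> hu hv.
have e (x y : H) : rip x y = 4^-1 * (nsq (x + y) - nsq (x - y)) by rewrite nsqD nsqB; field.
rewrite e; under eq_fun do rewrite e.
apply: cvgMl_tmp; apply: cvgB; apply: hcvg_nsq; first exact: hcvgD.
apply: hcvgD => //; rewrite -scaleN1r; under eq_fun do rewrite -scaleN1r.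
exact: hcvgZ.
Qed.

Definition ccvg (z : nat -> R[i]) (l : R[i]) : Prop :=
  (fun n => complex.Re (z n)) @ \oo --> complex.Re l /\
  (fun n => complex.Im (z n)) @ \oo --> complex.Im l.

Lemma ccvg_inner (H : hilbertType R) (u v : nat -> H) a b : hcvg u a -> hcvg v b ->
  ccvg (fun n => inner H (u n) (v n)) (inner H a b).
Proof.
move=> hu hv; split; first exact: hcvg_rip2.
rewrite Im_inner; under eq_fun do rewrite Im_inner.
by apply: hcvg_rip2 => //; exact: hcvgZ.
Qed.

Lemma ccvg_sum (I : Type) (r : seq I) (F : I -> nat -> R[i]) (l : I -> R[i]) :
  (forall i, ccvg (F i) (l i)) -> ccvg (fun n => \sum_(i <- r) F i n) (\sum_(i <- r) l i).
Proof.
move=> h; split.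
  rewrite Re_sum; under eq_fun do rewrite Re_sum.
  by apply: cvg_finsum => i; case: (h i).
rewrite (big_morph _ ImD (erefl : complex.Im 0 = 0 :> R)).
under eq_fun do rewrite (big_morph _ ImD (erefl : complex.Im 0 = 0 :> R)).
by apply: cvg_finsum => i; case: (h i).
Qed.

Lemma ccvg_ge0 (z : nat -> R[i]) l : ccvg z l -> (forall n, 0 <= z n) -> 0 <= l.
Proof.
move=> [h1 h2] z0; apply: complex_ge0.
  rewrite -(cvg_lim _ h2)// (_ : (fun n => _) = fun=> 0) ?lim_cst//.
  by apply/funext => n; exact/ger0_Im/z0.
rewrite -(cvg_lim _ h1)//; apply: limr_ge; first exact: cvgP h1.
by apply: nearW => n; exact/ge0_Re/z0.
Qed.

(** If [a 0] exceeded [r * s], then iterating the first inequality would make [a k] grow like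
    [(r * x) ^ (2 ^ k)] with [x > 1], against the second one. *)
Lemma growth_bound (a : nat -> R) s C r : 0 < r -> 0 <= s ->
  (forall k, a k ^+ 2 <= s * a k.+1) -> (forall k, a k.+1 <= C * r ^+ (2 ^ k.+1)) ->
  a 0%N <= r * s.
Proof.
move=> r0 s0 h1 h2; rewrite leNgt; apply/negP => lt.
move: s0; rewrite le_eqVlt => /predU1P[e|s0].
  have := h1 0%N; rewrite -e mul0r => h.
  have e0 : a 0%N = 0 by apply/eqP; rewrite -sqrf_eq0 eq_le h sqr_ge0.
  by move: lt; rewrite -e e0 mulr0 ltxx.
have rs : 0 < r * s by rewrite mulr_gt0.
pose x := a 0%N / (r * s).
have x1 : 1 < x by rewrite /x ltr_pdivlMr// mul1r.
have x0 : 0 < x by rewrite (lt_trans _ x1).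
have low k : s * (r * x) ^+ (2 ^ k) <= a k.
  elim: k => [|k IH].
    rewrite expn0 expr1 (_ : s * (r * x) = a 0%N)// /x; field.
    by rewrite !gt_eqF.
  rewrite -(ler_pM2l s0); apply: le_trans (h1 k).
  have -> : s * (s * (r * x) ^+ (2 ^ k.+1)) = (s * (r * x) ^+ (2 ^ k)) ^+ 2.
    by rewrite expnS mulnC exprM !exprMn -!exprM; ring.
  have p : 0 <= s * (r * x) ^+ (2 ^ k) by rewrite mulr_ge0 ?(ltW s0)// exprn_ge0// mulr_ge0 ?(ltW r0) ?(ltW x0).
  by rewrite ler_sqr ?nnegrE//; exact: le_trans p IH.
have : s * x = 0.
  apply: (@geometric_zero R _ C 1 x) => // [|n].
    by rewrite mulr_ge0 ?ltW.
  rewrite expr1n mulr1 -mulrA -exprS.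
  apply: (@le_trans _ _ (s * x ^+ (2 ^ n.+1))).
    by rewrite ler_pM2l// ler_weXn2l ?(ltW x1)// ltnW// ltn_expl.
  have := le_trans (low n.+1) (h2 n); rewrite exprMn mulrCA mulrC.
  by rewrite ler_pM2r// exprn_gt0.
by move/eqP; rewrite mulf_eq0 !gt_eqF.
Qed.

End limits.

Section cp_maps.
Context {R : realType} {H0 H : hilbertType R} (M : set (H0 -> H0)) (N : set (H -> H)).
Hypothesis vnM : von_neumann M.
Hypothesis vnN : von_neumann N.

Lemma inner_sumlP (G : hilbertType R) I (r : seq I) (P : pred I) (F : I -> G) y :
  inner G (\sum_(i <- r | P i) F i) y = \sum_(i <- r | P i) inner G (F i) y.
Proof. by apply: (big_morph (fun x => inner G x y)) => [u v|]; rewrite ?inner0l ?innerDl. Qed.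
Lemma inner_sumrP (G : hilbertType R) I (r : seq I) (P : pred I) (F : I -> G) y :
  inner G y (\sum_(i <- r | P i) F i) = \sum_(i <- r | P i) inner G y (F i).
Proof. by apply: (big_morph (fun x => inner G y x)) => [u v|]; rewrite ?inner0r ?innerDr. Qed.
Lemma op_sumP (G G' : hilbertType R) (T : G -> G') I (r : seq I) (P : pred I) (F : I -> G) :
  linear T -> T (\sum_(i <- r | P i) F i) = \sum_(i <- r | P i) T (F i).
Proof. by move=> lT; apply: (big_morph T (opD lT) (op0 lT)). Qed.

(** A list of triples (i, x, xi) stands for the sum of the vectors [pi x (V xi)]; the index i is
    the row of a matrix in a test of complete positivity. *)
Fixpoint okl I (s : seq (I * (H0 -> H0) * H)) : Prop :=
  if s is p :: s' then M p.1.2 /\ okl s' else True.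

Lemma okl_cat I (s t : seq (I * (H0 -> H0) * H)) : okl s -> okl t -> okl (s ++ t).
Proof. by elim: s => //= p s IH [Mp /IH h] /h. Qed.
Lemma okl_map I (f : H -> H) (s : seq (I * (H0 -> H0) * H)) :
  okl s -> okl [seq (p.1, f p.2) | p <- s].
Proof. by elim: s => //= p s IH [Mp /IH]. Qed.
Lemma okl_nth I (s : seq (I * (H0 -> H0) * H)) p i : okl s -> (i < size s)%N -> M (nth p s i).1.2.
Proof. by elim: s i => //= q s IH [|i] [Mq h] //= hi; exact: IH. Qed.

(** Apply the definition to the matrix, indexed by the list, of the operators
    [adjoint p.1.2 \o X p.1.1 q.1.1 \o q.1.2]. *)
Lemma cp_list (Phi : (H0 -> H0) -> H -> H) n (X : 'I_n -> 'I_n -> H0 -> H0)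
    (s : seq ('I_n * (H0 -> H0) * H)) : CP M N Phi -> (forall i j, M (X i j)) ->
  positive_opmx X -> okl s ->
  0 <= \sum_(p <- s) \sum_(q <- s)
    inner H (Phi (adjoint p.1.2 \o X p.1.1 q.1.1 \o q.1.2) q.2) p.2.
Proof.
move=> [_ _ cpPhi] MX pX oks; pose m := size s.
pose t (a : 'I_m) := tnth (in_tuple s) a.
have Mt a : M (t a).1.2.
  have [p] : exists p, p = t a by exists (t a).
  by move=> _; rewrite /t (tnth_nth (t a)) /=; apply: okl_nth.
pose Y (a b : 'I_m) := adjoint (t a).1.2 \o X (t a).1.1 (t b).1.1 \o (t b).1.2.
have MY a b : M (Y a b).
  by apply: vn_comp => //; apply: vn_comp => //; exact: (vn_adj vnM).
have pY : positive_opmx Y.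
  move=> v; pose u j := \sum_(b < m | (t b).1.1 == j) (t b).1.2 (v b).
  suff -> : \sum_(a < m) \sum_(b < m) inner H0 (Y a b (v b)) (v a) =
    \sum_(i < n) \sum_(j < n) inner H0 (X i j (u j)) (u i) by exact: pX.
  rewrite (partition_big (fun a => (t a).1.1) xpredT)//=; apply: eq_bigr => i _.
  under [RHS]eq_bigr do rewrite inner_sumrP.
  rewrite [RHS]exchange_big /=; apply: eq_bigr => a /eqP ai.
  rewrite (partition_big (fun b => (t b).1.1) xpredT)//=; apply: eq_bigr => j _.
  have [lX _] := vn_bounded vnM (MX i j).
  rewrite /u (op_sumP _ _ _ lX) inner_sumlP; apply: eq_bigr => b /eqP bj.
  have ba := vn_bounded vnM (Mt a).
  by rewrite /Y /= ai bj adjointE ?adjointK//; exact: bounded_adjoint.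
have h := cpPhi _ Y MY pY (fun a => (t a).2).
rewrite big_tnth (eq_bigr _ (fun a _ => big_tnth _ _ _ _ _)); exact: h.
Qed.

Lemma cpD Phi Psi : CP M N Phi -> CP M N Psi -> CP M N (fun x => Phi x + Psi x).
Proof.
move=> [h1 h2 h3] [g1 g2 g3]; split.
- by move=> x Mx; apply: (vnD vnN); [exact: h1|exact: g1].
- by move=> a x y Mx My; rewrite h2// g2// scalerDr addrACA.
- move=> n X MX pX v; have := addr_ge0 (h3 n X MX pX v) (g3 n X MX pX v).
  rewrite -big_split /=; under eq_bigr do rewrite -big_split /=.
  by under eq_bigr do under eq_bigr do rewrite -innerDl.
Qed.

End cp_maps.

(** * The Stinespring space *)

Lemma inner_adj (R : realType) (H K : hilbertType R) (T : H -> K) u w : bounded_op T ->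
  inner H (adjoint T u) w = inner K u (T w).
Proof. by move=> bT; rewrite adjointE ?adjointK//; exact: bounded_adjoint. Qed.

Section stinespring.
Context {R : realType} {H0 H K : hilbertType R} (M : set (H0 -> H0)) (N : set (H -> H)).
Variables (Phi Psi : (H0 -> H0) -> H -> H) (pi : (H0 -> H0) -> K -> K) (V : H -> K).
Variables (A B : K -> K).
Hypothesis vnM : von_neumann M.
Hypothesis vnN : von_neumann N.
Hypothesis cpPhi : CP M N Phi.
Hypothesis cpPsi : CP M N Psi.
Hypothesis srn : minimal_SRN M Phi Psi pi V A B.

Let rep : star_rep M pi. Proof. by case: srn => -[]. Qed.
Let bV : bounded_op V. Proof. by case: srn => -[]. Qed.
Let lV : linear V. Proof. by case: bV. Qed.
Let bA : bounded_op A. Proof. by case: srn => _ [[]]. Qed.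
Let bB : bounded_op B. Proof. by case: srn => _ [_ []]. Qed.
Let lA : linear A. Proof. by case: bA. Qed.
Let posA : positive_op A. Proof. by case: srn => _ [[]]. Qed.

Lemma pi_bounded x : M x -> bounded_op (pi x).
Proof. by case: rep => h *; exact: h. Qed.
Lemma pi_linear x : M x -> linear (pi x).
Proof. by move=> /pi_bounded[]. Qed.
Lemma pi_comp x y v : M x -> M y -> pi (x \o y) v = pi x (pi y v).
Proof. by case: rep => _ _ _ h _ Mx My; rewrite h. Qed.
Lemma pi_comb a x y v : M x -> M y -> pi (a *: x + y) v = a *: pi x v + pi y v.
Proof. by case: rep => _ _ h _ _ Mx My; rewrite h. Qed.
Lemma pi_adj x : M x -> pi (adjoint x) = adjoint (pi x).
Proof. by case: rep => _ _ _ _ h; exact: h. Qed.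
Lemma pi_id : pi idfun = idfun.
Proof. by case: rep. Qed.

Definition pi_comm (T : K -> K) : Prop := bounded_op T /\ forall x v, M x -> T (pi x v) = pi x (T v).

Lemma commutant_pi T : commutant (pi @` M) T -> pi_comm T.
Proof.
move=> [bT h]; split=> // x v Mx; have := h (pi x) (ex_intro2 _ _ x Mx erefl).
by move=> /(congr1 (fun f => f v)).
Qed.

Lemma pi_commA : pi_comm A.
Proof. by apply: commutant_pi; case: srn => _ _ []. Qed.
Lemma pi_commB : pi_comm B.
Proof. by apply: commutant_pi; case: srn => _ _ []. Qed.
Lemma pi_comm_id : pi_comm idfun.
Proof. by split=> //; exact: bounded_id. Qed.

(** The Radon-Nikodym correspondence: [A], [B] and the identity give Phi, Psi and their sum. *)
Definition Theta (T : K -> K) (x : H0 -> H0) : H -> H := adjoint V \o T \o pi x \o V.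

Lemma PhiE x : M x -> Phi x = Theta A x.
Proof. by move=> Mx; case: srn => _ _ _ /(_ x Mx) -> _. Qed.
Lemma PsiE x : M x -> Psi x = Theta B x.
Proof. by move=> Mx; case: srn => _ _ _ _ /(_ x Mx) ->. Qed.
Lemma GammaE x : M x -> Phi x + Psi x = Theta idfun x.
Proof. by move=> Mx; case: srn => -[_ _ /(_ x Mx) -> _]. Qed.

Lemma inner_Theta T x y xi eta : pi_comm T -> M x -> M y ->
  inner K (T (pi x (V xi))) (pi y (V eta)) = inner H (Theta T (adjoint y \o x) xi) eta.
Proof.
move=> [bT cT] Mx My; have May := vn_adj vnM My.
have bpy := pi_bounded My.
by rewrite /Theta /= (@inner_adj _ _ _ V _ _ bV) pi_comp// (cT _ _ May) (pi_adj My) (@inner_adj _ _ _ _ _ _ bpy).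
Qed.

Definition vec I (s : seq (I * (H0 -> H0) * H)) : K := \sum_(p <- s) pi p.1.2 (V p.2).

Lemma span_vec v : Defs.span [set v : K | exists x xi, M x /\ v = pi x (V xi)] v ->
  exists s : seq (unit * (H0 -> H0) * H), okl M s /\ v = vec s.
Proof.
move=> [n [a [s [hs ->]]]].
elim: n a s hs => [|n IH] a s hs; first by exists [::]; rewrite /vec big_nil big_ord0.
have [t [ot et]] := IH (a \o lift ord0) (s \o lift ord0) (fun i => hs _).
have [x [xi [Mx sx]]] := hs ord0.
exists ((tt, x, a ord0 *: xi) :: t); split=> //.
rewrite big_ord_recl /vec big_cons /= et; congr (_ + _).
by rewrite sx (opZ lV) (opZ (pi_linear Mx)).
Qed.

Lemma vec_dense v e : 0 < e ->
  exists s : seq (unit * (H0 -> H0) * H), okl M s /\ nsq (v - vec s) < e.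
Proof.
move=> e0; have d : dense (Defs.span [set v : K | exists x xi, M x /\ v = pi x (V xi)]).
  by case: srn => -[].
have [w /span_vec[s [os ->]] h] := (dense_nsq _).1 d v e e0.
by exists s.
Qed.

Lemma vec_cvg v : exists s : nat -> seq (unit * (H0 -> H0) * H),
  (forall n, okl M (s n)) /\ hcvg (fun n => vec (s n)) v.
Proof.
have /choice[s hs] (n : nat) : exists s : seq (unit * (H0 -> H0) * H),
    okl M s /\ nsq (v - vec s) < n.+1%:R^-1 by exact: vec_dense.
exists s; split=> [n|]; first by case: (hs n).
apply/hcvgP => e e0; have [m hm] := inv_lt_eps e0; exists m => n /hm.
by apply: lt_trans; rewrite nsqBC; case: (hs n).
Qed.

Lemma vec_rip0 u : (forall s : seq (unit * (H0 -> H0) * H), okl M s -> rip u (vec s) = 0) -> u = 0.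
Proof.
move=> h; apply: nsq_eq0; have [s [os cs]] := vec_cvg u.
rewrite /nsq -(cvg_lim _ (hcvg_rip (x := u) cs))//.
rewrite (_ : (fun n => _) = fun=> 0) ?lim_cst//.
by apply/funext => n; rewrite ripC h.
Qed.

Lemma vec_op_eq (G : hilbertType R) (S T : K -> G) : bounded_op S -> bounded_op T ->
  (forall s : seq (unit * (H0 -> H0) * H), okl M s -> S (vec s) = T (vec s)) -> forall v, S v = T v.
Proof.
move=> bS bT h v; have [s [os cs]] := vec_cvg v.
apply: hcvg_uniq (hcvg_op bS cs) _.
by rewrite (_ : (fun n => S _) = (fun n => T (vec (s n)))); [exact: hcvg_op|apply/funext => n; exact: h].
Qed.

Lemma vec_inner T I (s t : seq (I * (H0 -> H0) * H)) : pi_comm T -> okl M s -> okl M t ->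
  inner K (T (vec s)) (vec t) =
  \sum_(q <- s) \sum_(p <- t) inner H (Theta T (adjoint p.1.2 \o q.1.2) q.2) p.2.
Proof.
move=> cT; have [[lT _] _] := cT.
elim: s => [|q s IH] /= os ot; first by rewrite /vec !big_nil (op0 lT) inner0l.
have [Mq os'] := os.
rewrite /vec !big_cons (opD lT) innerDl -/(vec s) IH//; congr (_ + _).
elim: t ot {IH} => [|p t IHt] /= ot; first by rewrite !big_nil inner0r.
have [Mp ot'] := ot.
by rewrite !big_cons innerDr IHt// inner_Theta.
Qed.

Definition smap I (f : H -> H) (s : seq (I * (H0 -> H0) * H)) := [seq (p.1, f p.2) | p <- s].

Lemma okl_smap I f (s : seq (I * (H0 -> H0) * H)) : okl M s -> okl M (smap f s).
Proof. exact: okl_map. Qed.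

Lemma ThetaN T : (T = A \/ T = B \/ T = idfun) -> forall x, M x -> N (Theta T x).
Proof.
move=> [->|[->|->]] x Mx; first by rewrite -PhiE//; case: cpPhi => h _ _; exact: h.
  by rewrite -PsiE//; case: cpPsi => h _ _; exact: h.
rewrite -GammaE//; case: cpPhi cpPsi => h _ _ [h' _ _].
by apply: (vnD vnN); [exact: h|exact: h'].
Qed.

(** The values of [Theta T] are in N, so they commute with [y]. *)
Lemma vec_adj T y I (s t : seq (I * (H0 -> H0) * H)) : pi_comm T ->
  (forall x, M x -> N (Theta T x)) -> commutant N y -> okl M s -> okl M t ->
  inner K (T (vec (smap y s))) (vec t) = inner K (T (vec s)) (vec (smap (adjoint y) t)).
Proof.
move=> cT NT cy os ot; have [by' _] := cy.
rewrite !vec_inner//; try exact: okl_smap.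
rewrite big_map; elim: s os => [|q s IH] os; first by rewrite !big_nil.
have [Mq os'] := os; rewrite !big_cons IH//; congr (_ + _).
rewrite big_map; elim: t ot {IH} => [|p t IHt] ot; first by rewrite !big_nil.
have [Mp ot'] := ot; rewrite !big_cons IHt//; congr (_ + _) => /=.
rewrite -adjointE//; congr (inner H _ _); symmetry.
apply: (@vn_comm _ _ _ _ y q.2 (NT _ _) cy).
by apply: vn_comp => //; exact: (vn_adj vnM).
Qed.

Lemma vec_smap_le I (s : seq (I * (H0 -> H0) * H)) : okl M s -> exists2 C, 0 <= C &
  forall f b, 0 <= b -> (forall xi, nsq (f xi) <= b * nsq xi) -> nsq (vec (smap f s)) <= C * b.
Proof.
elim: s => [|p s IH] os; first by exists 0 => // f b b0 _; rewrite /vec big_nil nsq0 mul0r.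
have [Mp os'] := os; have [C C0 hC] := IH os'.
have [c c0 hc] := bounded_nsq (bounded_comp (pi_bounded Mp) bV).
exists (2 * (c * nsq p.2) + 2 * C) => [|f b b0 hf].
  by rewrite addr_ge0 ?mulr_ge0 ?nsq_ge0 ?(ltW c0).
rewrite /vec /= big_cons /=; apply: (le_trans (nsqD_le _ _)).
have h1 := hC f b b0 hf; have h2 := hc (f p.2); have h3 := ler_wpM2l (ltW c0) (hf p.2).
by rewrite -/(vec (smap f s)); rewrite /= in h2; lra.
Qed.

Lemma smap_comp I f g (s : seq (I * (H0 -> H0) * H)) : smap f (smap g s) = smap (f \o g) s.
Proof. by rewrite /smap -map_comp. Qed.

(** With [c = adjoint y \o y], which is symmetric on the vectors [vec s], Cauchy-Schwarz bounds the
    square of the term with [c ^ (2 ^ k)] by a multiple of the next one. The crude bound of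
    [vec_smap_le] on the growth of the terms then gives the sharp one, by [growth_bound]. *)
Lemma vec_bound I y (s : seq (I * (H0 -> H0) * H)) r : commutant N y -> 0 < r ->
  (forall xi, nsq (y xi) <= r * nsq xi) -> okl M s ->
  nsq (vec (smap y s)) <= r * nsq (vec s).
Proof.
move=> cy r0 hr os; have [by' _] := cy.
have cya := commutant_adj vnN cy.
have hra := bounded_adjoint_nsq by' (ltW r0) hr.
pose c := adjoint y \o y.
have NI x : M x -> N (Theta idfun x) by apply: ThetaN; right; right.
have mv z (u w : seq (I * (H0 -> H0) * H)) : commutant N z -> okl M u -> okl M w ->
    rip (vec (smap z u)) (vec w) = rip (vec u) (vec (smap (adjoint z) w)) :> R.
  by move=> cz ou ow; rewrite /rip (@vec_adj idfun z I u w pi_comm_id NI cz ou ow).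
have cc (u w : seq (I * (H0 -> H0) * H)) : okl M u -> okl M w ->
    rip (vec (smap c u)) (vec w) = rip (vec u) (vec (smap c w)) :> R.
  move=> ou ow; rewrite /c -(smap_comp (adjoint y) y u) (mv _ _ _ cya)//; last exact: okl_smap.
  by rewrite adjointK// (mv _ _ _ cy) ?smap_comp//; exact: okl_smap.
have self m (u w : seq (I * (H0 -> H0) * H)) : okl M u -> okl M w ->
    rip (vec (smap (iter m c) u)) (vec w) = rip (vec u) (vec (smap (iter m c) w)) :> R.
  elim: m u w => [|m IH] u w ou ow.
    have i0 (l : seq (I * (H0 -> H0) * H)) : smap (iter 0 c) l = l.
      by rewrite /smap -[RHS]map_id; apply: eq_map => -[].
    by rewrite !i0.
  rewrite -(smap_comp c (iter m c)) cc ?IH//; try exact: okl_smap.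
  by rewrite smap_comp; congr (rip _ (vec (smap _ w))); apply/funext => v /=; rewrite -iterSr.
have s1 : rip (vec (smap (iter 1 c) s)) (vec s) = nsq (vec (smap y s)) :> R.
  rewrite (_ : iter 1 c = c)// /c -(smap_comp (adjoint y) y s) (mv _ _ _ cya)//; last exact: okl_smap.
  by rewrite adjointK.
have [C C0 hC] := vec_smap_le os.
have citer m xi : nsq (iter m c xi) <= (r ^+ 2) ^+ m * nsq xi.
  elim: m => [|m IH] /=; first by rewrite mul1r.
  apply: (le_trans (hra _)); have h1 := hr (iter m c xi).
  apply: (le_trans (ler_wpM2l (ltW r0) h1)).
  by rewrite mulrA -expr2 (exprS (r ^+ 2) m) -mulrA ler_wpM2l ?sqr_ge0.
rewrite -s1; apply: (@growth_bound R (fun k => rip (vec (smap (iter (2 ^ k) c) s)) (vec s)) _ C r) => //.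
- exact: nsq_ge0.
- move=> k; rewrite mulrC; apply: (le_trans (cauchy_schwarz _ _)).
  rewrite ler_wpM2r ?nsq_ge0// /nsq -self ?smap_comp//; last exact: okl_smap.
  rewrite (_ : iter (2 ^ k.+1) c = iter (2 ^ k) c \o iter (2 ^ k) c)//.
  by apply/funext => v /=; rewrite expnS mul2n -addnn iterD.
- move=> k; rewrite expnS mul2n -addnn.
  rewrite (_ : smap _ s = smap (iter (2 ^ k) c) (smap (iter (2 ^ k) c) s)); last first.
    by rewrite smap_comp; congr (smap _ s); apply/funext => v /=; rewrite iterD.
  rewrite self//; last exact: okl_smap.
  by rewrite addnn -mul2n exprM; apply: hC; [rewrite exprn_ge0 ?sqr_ge0|exact: citer].
Qed.

(** The representation of N' on the Stinespring space: [y] acts on the H-component of the spanning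
    vectors. It is well defined because of [vec_bound]. *)
Lemma rho_exists y : commutant N y -> exists2 rho : K -> K, bounded_op rho &
  forall I (s : seq (I * (H0 -> H0) * H)), okl M s -> rho (vec s) = vec (smap y s).
Proof.
move=> cy; have [by' _] := cy; have [ly _] := by'.
have [r r0 hr] := bounded_nsq by'.
pose P v w := exists s : seq (unit * (H0 -> H0) * H), [/\ okl M s, v = vec s & w = vec (smap y s)].
have vec_scale a (s : seq (unit * (H0 -> H0) * H)) : okl M s -> vec (smap ( *:%R a) s) = a *: vec s.
  elim: s => [|p s IH] os; first by rewrite /vec !big_nil scaler0.
  have [Mp os'] := os; rewrite /vec /= !big_cons /= scalerDr; congr (_ + _); last exact: IH.
  by rewrite (opZ lV) (opZ (pi_linear Mp)).
have smap_scale a (s : seq (unit * (H0 -> H0) * H)) : smap y (smap ( *:%R a) s) = smap ( *:%R a) (smap y s).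
  by rewrite !smap_comp; congr (smap _ s); apply/funext => v /=; rewrite (opZ ly).
have vec_cat (s t : seq (unit * (H0 -> H0) * H)) : vec (s ++ t) = vec s + vec t.
  by rewrite /vec big_cat.
have [||||rho brho hrho] := @extension R K K P r.
- move=> a v w v' w' [s [os -> ->]] [t [ot -> ->]].
  exists (smap ( *:%R a) s ++ t); split.
  + by apply: okl_cat => //; exact: okl_smap.
  + by rewrite vec_cat vec_scale.
  + by rewrite /smap map_cat -!/(smap _ _) vec_cat smap_scale vec_scale//; exact: okl_smap.
- exact: ltW.
- by move=> v w [s [os -> ->]]; exact: vec_bound.
- apply/dense_nsq => v e e0; have [s [os hs]] := vec_dense v e0.
  by exists (vec s) => //; exists (vec (smap y s)), s.
exists rho => // I s os.
have e : vec s = vec [seq (tt, p.1.2, p.2) | p <- s] by rewrite /vec big_map.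
have e' : vec (smap y s) = vec (smap y [seq (tt, p.1.2, p.2) | p <- s]).
  by rewrite /vec /smap -map_comp !big_map.
rewrite e e'; apply: hrho; exists [seq (tt, p.1.2, p.2) | p <- s]; split=> //.
by elim: s os {e e'} => //= p s IH [Mp /IH].
Qed.

(** Membership in the von Neumann algebra generated by the symmetric operator [A], in the form in
    which it is used: commutation with [rho] and with the range of [pi]. *)
Definition bicomm (T : K -> K) : Prop := bounded_op T /\
  forall x, bounded_op x -> (forall v, x (A v) = A (x v)) ->
    (forall v, adjoint x (A v) = A (adjoint x v)) -> forall v, x (T v) = T (x v).

Lemma bicomm_pi T : bicomm T -> pi_comm T.
Proof.
move=> [bT h]; split=> // x v Mx; have [_ cA] := pi_commA.
symmetry; apply: h => [|w|w]; first exact: pi_bounded.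
  by rewrite cA.
by rewrite -pi_adj// cA//; exact: (vn_adj vnM).
Qed.

Lemma rho_commA y rho : commutant N y -> bounded_op rho ->
  (forall I (s : seq (I * (H0 -> H0) * H)), okl M s -> rho (vec s) = vec (smap y s)) ->
  (forall I (s : seq (I * (H0 -> H0) * H)), okl M s -> adjoint rho (vec s) = vec (smap (adjoint y) s)) /\
  forall v, rho (A v) = A (rho v).
Proof.
move=> cy br hr; have [by' _] := cy; have cya := commutant_adj vnN cy.
have NA x : M x -> N (Theta A x) by apply: ThetaN; left.
have NI x : M x -> N (Theta idfun x) by apply: ThetaN; right; right.
have adj I (s : seq (I * (H0 -> H0) * H)) : okl M s -> adjoint rho (vec s) = vec (smap (adjoint y) s).
  move=> os.
  have e : vec s = vec [seq (tt, p.1.2, p.2) | p <- s] by rewrite /vec big_map.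
  have e' : vec (smap (adjoint y) s) = vec (smap (adjoint y) [seq (tt, p.1.2, p.2) | p <- s]).
    by rewrite /vec /smap -map_comp !big_map.
  have os' : okl M [seq (tt, p.1.2, p.2) | p <- s] by elim: s os {e e'} => //= p s IH [Mp /IH].
  rewrite e e'; apply/subr0_eq/vec_rip0 => t ot; rewrite ripBl.
  have h := @vec_adj idfun y unit t _ pi_comm_id NI cy ot os'.
  by rewrite ![rip _ (vec t)]ripC -adjoint_rip// hr// /rip h subrr.
split=> // v.
apply: (vec_op_eq (bounded_comp br bA) (bounded_comp bA br)) => s os /=.
apply/subr0_eq/vec_rip0 => t ot; rewrite ripBl hr// (adjoint_rip _ _ br) adj//.
by rewrite /rip (@vec_adj A y unit s t pi_commA NA cy os ot) subrr.
Qed.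

(** The lift [rho] of [y] commutes with [pi x] and with [A], hence with [T], and it intertwines [V]
    with [y]. *)
Lemma bicomm_Theta T : bicomm T -> forall x, M x -> N (Theta T x).
Proof.
move=> [bT hT] x Mx.
have bTh : bounded_op (Theta T x).
  apply: bounded_comp => //; apply: bounded_comp; last exact: pi_bounded.
  by apply: bounded_comp => //; exact: bounded_adjoint.
apply: (vn_intro vnN) => // y cy v; have [by' _] := cy.
have [rho br hr] := rho_exists cy; have [hra rA] := rho_commA cy br hr.
have cya := commutant_adj vnN cy.
have rV w : rho (V w) = V (y w).
  have := hr unit [:: (tt, idfun, w)] (conj (vn_id vnM) I).
  by rewrite /vec !big_cons !big_nil !addr0 /= pi_id.
have raV w : adjoint rho (V w) = V (adjoint y w).
  have := hra unit [:: (tt, idfun, w)] (conj (vn_id vnM) I).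
  by rewrite /vec !big_cons !big_nil !addr0 /= pi_id.
have rpi w : rho (pi x w) = pi x (rho w).
  apply: (vec_op_eq (bounded_comp br (pi_bounded Mx)) (bounded_comp (pi_bounded Mx) br)) => s os /=.
  rewrite hr// /vec !(op_sumP _ _ _ (pi_linear Mx)) -/(vec _).
  have e (f : H -> H) : \sum_(p <- s) pi x (pi p.1.2 (V (f p.2))) =
      vec [seq (p.1.1, x \o p.1.2, f p.2) | p <- s].
    rewrite /vec big_map; elim: s os => [|p s IH] os; first by rewrite !big_nil.
    by have [Mp os'] := os; rewrite !big_cons IH//= pi_comp.
  rewrite (e id) big_map (e y) hr; last first.
    by elim: s os {e} => //= p s IH [Mp /IH]; split=> //; exact: vn_comp.
  by rewrite /smap -map_comp.
have raA w : adjoint rho (A w) = A (adjoint rho w).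
  have symA u v' := positive_op_sym lA posA u v'.
  apply: rip_eq => z; rewrite ripC -adjoint_rip// -symA -rA ripC.
  by rewrite [RHS]symA [RHS]ripC -adjoint_rip// ripC.
rewrite /Theta /= -rV -rpi -hT//.
apply: rip_eq => z; rewrite ripC -adjoint_rip// [RHS]ripC -[in RHS](adjointK by').
rewrite -(adjoint_rip z _ (bounded_adjoint by')) -(adjoint_rip _ _ bV) -raV.
by rewrite ripC adjoint_rip// ripC.
Qed.

Lemma bicommA : bicomm A.
Proof. by split. Qed.
Lemma bicomm_id : bicomm idfun.
Proof. by split=> //; exact: bounded_id. Qed.
Lemma bicomm_comp S T : bicomm S -> bicomm T -> bicomm (S \o T).
Proof.
move=> [bS hS] [bT hT]; split; first exact: bounded_comp.
by move=> x bx cx cx' v /=; rewrite hS// hT.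
Qed.
Lemma bicomm_comb a S T : bicomm S -> bicomm T -> bicomm (a *: S + T).
Proof.
move=> [bS hS] [bT hT]; split; first exact: bounded_comb.
move=> x bx cx cx' v; have [lx _] := bx.
by rewrite !fctE lx hS// hT.
Qed.

(** The densities of Phi and Psi add up to that of Phi + Psi, which is 1; on the spanning vectors
    this is the equality of the maps. *)
Lemma A_B v : B v = v - A v.
Proof.
suff h w : A w + B w = w by rewrite -[X in _ = X - _](h v) addrAC subrr add0r.
have bAB : bounded_op (1 *: A + B) by exact: bounded_comb.
have e (u : K) : (1 *: A + B : K -> K) u = A u + B u by rewrite !fctE scale1r.
rewrite -e; apply: (vec_op_eq bAB (@bounded_id R K)) => s os; rewrite e.
apply/subr0_eq/vec_rip0 => t ot; rewrite ripBl ripDl /rip.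
rewrite (@vec_inner A unit s t pi_commA os ot) (@vec_inner B unit s t pi_commB os ot).
rewrite (@vec_inner idfun unit s t pi_comm_id os ot) -ReD -big_split /=.
apply/eqP; rewrite subr_eq0; apply/eqP; congr (complex.Re _).
elim: s os => [|q s IH] os; first by rewrite !big_nil.
have [Mq os'] := os; rewrite !big_cons IH//; congr (_ + _); rewrite -big_split /=.
elim: t ot {IH} => [|p t IHt] ot; first by rewrite !big_nil.
have [Mp ot'] := ot; rewrite !big_cons IHt//; congr (_ + _).
have Mpq : M (adjoint p.1.2 \o q.1.2) by apply: vn_comp => //; exact: (vn_adj vnM).
by rewrite -innerDl -(PhiE Mpq) -(PsiE Mpq) -GammaE.
Qed.

Lemma bicommB : bicomm B.
Proof.
have -> : B = (-1) *: A + idfun; last exact: bicomm_comb bicommA bicomm_id.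
by apply/funext => v; rewrite A_B !fctE scaleN1r addrC.
Qed.

(** By density it can be tested on the vectors [vec s], where it is the complete positivity of
    Phi + Psi. *)
Lemma pi_positive n (X : 'I_n -> 'I_n -> H0 -> H0) (w : 'I_n -> K) :
  (forall i j, M (X i j)) -> positive_opmx X ->
  0 <= \sum_(i < n) \sum_(j < n) inner K (pi (X i j) (w j)) (w i).
Proof.
move=> MX pX.
have /choice[s hs] j := vec_cvg (w j).
pose S k : seq ('I_n * (H0 -> H0) * H) :=
  flatten [seq [seq (j, p.1.2, p.2) | p <- s j k] | j <- index_enum 'I_n].
have oS k : okl M (S k).
  rewrite /S; elim: (index_enum _) => //= j l IH; apply: okl_cat => //.
  by have [/(_ k) oj _] := hs j; elim: (s j k) oj => //= p t IHt [Mp /IHt].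
have sumS (G : zmodType) (F : 'I_n * (H0 -> H0) * H -> G) k :
    \sum_(p <- S k) F p = \sum_(j < n) \sum_(p <- s j k) F (j, p.1.2, p.2).
  by rewrite /S big_flatten big_map; apply: eq_bigr => j _; rewrite big_map.
have pos k : 0 <= \sum_(i < n) \sum_(j < n)
    inner K (pi (X i j) (vec (s j k))) (vec (s i k)).
  have := cp_list vnM (cpD vnN cpPhi cpPsi) MX pX (oS k).
  rewrite sumS (eq_bigr _ (fun i _ => eq_bigr _ (fun p _ => sumS _ _ k))).
  congr (0 <= _); apply: eq_bigr => i _; rewrite exchange_big /=; apply: eq_bigr => j _.
  have [/(_ k) oi _] := hs i; have [/(_ k) oj _] := hs j.
  rewrite /vec inner_sumr; elim: (s i k) oi => [|p t IH] oi; first by rewrite !big_nil.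
  have [Mp oi'] := oi; rewrite !big_cons IH//; congr (_ + _).
  have lX := pi_linear (MX i j); rewrite (op_sum lX) inner_suml.
  elim: (s j k) oj {IH} => [|q t' IHt] oj; first by rewrite !big_nil.
  have [Mq oj'] := oj; rewrite !big_cons IHt//; congr (_ + _).
  have MXq : M (X i j \o q.1.2) by exact: vn_comp.
  rewrite -(pi_comp _ (MX i j) Mq) (@inner_Theta idfun _ _ _ _ pi_comm_id MXq Mp) -GammaE //.
  by apply: vn_comp => //; exact: (vn_adj vnM).
apply: ccvg_ge0 pos; apply: ccvg_sum => i; apply: ccvg_sum => j.
apply: ccvg_inner; last by case: (hs i).
by apply: hcvg_op; [exact/pi_bounded/MX|case: (hs j)].
Qed.

End stinespring.

(** * Convex functions and their perspectives *)

Section operator_convex_scalar.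
Context {R : realType}.

Lemma funmx_scalar (f : R -> R) (a : R) : funmx f (a%:C%:M : 'M[R[i]]_1) = (f a)%:C%:M.
Proof.
set A := (a%:C%:M : 'M[R[i]]_1).
have nA : A \is normalmx by apply/normalmxP; rewrite scalar_mxC.
have := (orthomx_spectralP nA); set P := spectralmx A; set d := spectral_diag A => hA.
have uP : P \in unitmx by exact/unitarymx_unit/spectral_unitarymx.
have conjP (z : R[i]) : invmx P *m z%:M *m P = z%:M.
  by rewrite -mulmxA -scalar_mxC mulmxA mulVmx// mul1mx.
have dE (e : 'rV[R[i]]_1) : diag_mx e = (e 0 0)%:M.
  by apply/matrixP => i j; rewrite !ord1 !mxE eqxx mulr1n.
have da : d 0 0 = a%:C.
  have := hA; rewrite dE conjP => /matrixP /(_ 0 0); rewrite !mxE eqxx !mulr1n.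
  by move=> <-.
by rewrite /funmx -/P -/d dE conjP mxE da.
Qed.

(** The case of 1 by 1 matrices. *)
Lemma operator_convex_convex (f : R -> R) : operator_convex f ->
  forall x y l, 0 < x -> 0 < y -> 0 <= l <= 1 -> f (l * x + (1 - l) * y) <= l * f x + (1 - l) * f y.
Proof.
move=> oc x y l x0 y0 l01.
have pd (a : R) : 0 < a -> posdefmx (a%:C%:M : 'M[R[i]]_1).
  move=> a0 v v0; rewrite mul_mx_scalar mxE big_ord1 !mxE.
  have v00 : v 0 0 != 0.
    by apply: contra_neq v0 => e; apply/matrixP => i j; rewrite !ord1 mxE.
  rewrite -mulrA mulr_gt0 ?ltr_C// -normCK exprn_gt0// normr_gt0//.
have := oc 1%N _ _ l l01 (pd x x0) (pd y y0) (const_mx 1).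
rewrite -!mul_scalar_mx -!scalar_mxM -raddfD /= !funmx_scalar.
rewrite -!scalar_mxM -!mulrC_C.
have -> : (l * x)%:C + ((1 - l) * y)%:C = (l * x + (1 - l) * y)%:C :> R[i].
  by apply: complex_eq => //=; rewrite addr0.
rewrite funmx_scalar -raddfD -raddfB /= mul_mx_scalar mxE big_ord1 !mxE.
rewrite mulr1 (_ : Num.conj 1 = 1) ?rmorph1// mulr1 => /ge0_Re /=.
by rewrite subr_ge0.
Qed.

End operator_convex_scalar.

Section convex_function.
Context {R : realType} (f : R -> R).
Hypothesis cf : forall x y l, 0 < x -> 0 < y -> 0 <= l <= 1 ->
  f (l * x + (1 - l) * y) <= l * f x + (1 - l) * f y.

Lemma convex3 x y z : 0 < x -> x < y -> y < z ->
  (z - x) * f y <= (z - y) * f x + (y - x) * f z.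
Proof.
move=> x0 xy yz; have zx : 0 < z - x by lra.
have z0 : 0 < z by lra.
have := @cf x z ((z - y) / (z - x)) x0 z0.
have -> : (z - y) / (z - x) * x + (1 - (z - y) / (z - x)) * z = y by field; rewrite gt_eqF.
move=> h; have {}h : f y <= (z - y) / (z - x) * f x + (1 - (z - y) / (z - x)) * f z.
  by apply: h; rewrite divr_ge0 ?ler_pdivrMr ?mul1r//=; lra.
have := ler_wpM2l (ltW zx) h.
suff -> : (z - x) * ((z - y) / (z - x) * f x + (1 - (z - y) / (z - x)) * f z) =
  (z - y) * f x + (y - x) * f z by [].
by field; rewrite gt_eqF.
Qed.

Lemma convex_le_max x z y : 0 < x -> x <= y -> y <= z -> f y <= Num.max (f x) (f z).
Proof.
move=> x0; rewrite le_eqVlt => /predU1P[->|xy]; first by rewrite le_max lexx.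
rewrite le_eqVlt => /predU1P[->|yz]; first by rewrite le_max lexx orbT.
have h := convex3 x0 xy yz; have zx : 0 < z - x by lra.
have a : f x <= Num.max (f x) (f z) by rewrite le_max lexx.
have b : f z <= Num.max (f x) (f z) by rewrite le_max lexx orbT.
rewrite -(ler_pM2l zx); apply: (le_trans h).
have h1 := ler_wpM2l (ltW (ltac:(lra) : 0 < z - y)) a.
have h2 := ler_wpM2l (ltW (ltac:(lra) : 0 < y - x)) b.
by lra.
Qed.

(** The secant of [f] through 1 and 2 is subtracted. The difference [g] is nonnegative and
    decreasing before 1, and nonnegative with [g t / t] increasing after 2: so the limits at 0 and
    at infinity exist, and [f] has an affine minorant. *)
Let c := f 2 - f 1.
Let g t := f t - (f 1 + c * (t - 1)).

Let g3 x y z : 0 < x -> x < y -> y < z -> (z - x) * g y <= (z - y) * g x + (y - x) * g z.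
Proof. by move=> x0 xy yz; have := convex3 x0 xy yz; rewrite /g; lra. Qed.
Let g1 : g 1 = 0. Proof. by rewrite /g; ring. Qed.
Let g2 : g 2 = 0. Proof. by rewrite /g /c; ring. Qed.

Let g_ge0_left x : 0 < x -> x <= 1 -> 0 <= g x.
Proof.
move=> x0; rewrite le_eqVlt => /predU1P[->|x1]; first by rewrite g1.
by have := g3 x0 x1 (ltac:(lra) : 1 < 2); rewrite g1 g2; lra.
Qed.

Let g_ge0_right x : 2 <= x -> 0 <= g x.
Proof.
rewrite le_eqVlt => /predU1P[<-|x1]; first by rewrite g2.
by have := g3 (ltac:(lra) : 0 < 1) (ltac:(lra) : 1 < 2) x1; rewrite g1 g2; lra.
Qed.

Let g_mid x : 1 <= x -> x <= 2 -> - g 3 <= g x.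
Proof.
move=> x1; have g30 : 0 <= g 3 by apply: g_ge0_right; lra.
rewrite le_eqVlt => /predU1P[->|x2]; first by rewrite g2 lerNl oppr0.
have := g3 (ltac:(lra) : 0 < x) x2 (ltac:(lra) : 2 < 3); rewrite g2; nra.
Qed.

Let g_decr x y : 0 < x -> x <= y -> y <= 1 -> g y <= g x.
Proof.
move=> x0; rewrite le_eqVlt => /predU1P[->//|xy] y1.
have gx : 0 <= g x by apply: g_ge0_left; lra.
move: y1; rewrite le_eqVlt => /predU1P[->|y1]; first by rewrite g1.
have := g3 x0 xy y1; rewrite g1 => h.
have x1 : 0 < 1 - x by lra.
rewrite -(ler_pM2l x1); nra.
Qed.

Let g_ratio x y : 2 <= x -> x <= y -> g x / x <= g y / y.
Proof.
move=> x2; rewrite le_eqVlt => /predU1P[->//|xy].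
have x0 : 0 < x by lra. have y0 : 0 < y by lra.
have gy : 0 <= g y by apply: g_ge0_right; lra.
rewrite ler_pdivrMr// mulrAC ler_pdivlMr//.
move: x2; rewrite le_eqVlt => /predU1P[<-|x2]; first by rewrite g2 mul0r mulr_ge0.
have := g3 (ltac:(lra) : 0 < 2) x2 xy; rewrite g2 => h.
have y2 : 0 < y - 2 by lra.
rewrite -(ler_pM2l y2); nra.
Qed.

Lemma convex_affine_minorant : exists a b : R, forall t, 0 < t -> a + b * t <= f t.
Proof.
exists (f 1 - c - g 3), c => t t0.
have g30 : 0 <= g 3 by apply: g_ge0_right; lra.
suff : - g 3 <= g t by rewrite {2}/g; lra.
have [t1|t1] := leP t 1; first by have := g_ge0_left t0 t1; lra.
have [t2|t2] := leP t 2; first by apply: g_mid => //; exact: ltW.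
by have := g_ge0_right (ltW t2); lra.
Qed.

Lemma fzero_cvg : (f t)%:E @[t --> 0^'+] --> fzero f.
Proof.
have c1 : exists G : \bar R, (g t)%:E @[t --> 0^'+] --> G.
  have b01 : (BRight 0 < BLeft (1 : R))%O by rewrite bnd_simp.
  have h := @nonincreasing_at_right_cvge R (EFin \o g) 0 (BLeft 1) b01.
  exists (ereal_sup [set (EFin \o g) x | x in `]0%R, 1%R[]); apply: h.
  move=> x y; rewrite !in_itv /= => /andP[x0 x1] /andP[y0 y1] xy.
  by rewrite lee_fin; apply: g_decr => //; exact: ltW.
have {c1}[G c1] := c1.
have c2 : (f 1 + c * (t - 1))%:E @[t --> 0^'+] --> (f 1 + c * (0 - 1))%:E.
  apply/fine_cvgP; split; first exact: nearW.
  apply: cvgD; first exact: cvg_cst.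
  apply: cvgMl_tmp; apply: cvgB; last exact: cvg_cst.
  exact/cvg_at_right_filter/cvg_id.
have c3 : (f t)%:E @[t --> 0^'+] -->
    (G + (f 1 + c * (0 - 1))%:E)%E.
  rewrite (_ : (fun t => _) = (fun t => (g t)%:E + (f 1 + c * (t - 1))%:E)%E).
    apply: cvgeD => //; first by rewrite fin_num_adde_defl.
  by apply/funext => t; rewrite -EFinD /g subrK.
by rewrite /fzero (cvg_lim _ c3).
Qed.

Lemma finfty_cvg : (f t / t)%:E @[t --> +oo] --> finfty f.
Proof.
pose k t := g (Num.max t 2) / Num.max t 2.
have c1 : (k t)%:E @[t --> +oo] --> ereal_sup (range (EFin \o k)).
  apply: nondecreasing_cvge => x y xy; rewrite lee_fin; apply: g_ratio.
    by rewrite le_max lexx orbT.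
  by rewrite ge_max !le_max xy lexx !orbT.
have ci : (fun t : R => t^-1) @ +oo --> (0 : R).
  apply/(gtr0_cvgV0 (f := id)); last exact: cvg_id.
  by exists 0; split; [exact: num_real|].
have c2 : ((f 1 - c) * t^-1 + c)%:E @[t --> +oo] --> ((f 1 - c) * 0 + c)%:E.
  apply/fine_cvgP; split; first exact: nearW.
  apply: cvgD; last exact: cvg_cst.
  exact: cvgMl_tmp.
have c3 : (f t / t)%:E @[t --> +oo] --> (ereal_sup (range (EFin \o k)) + ((f 1 - c) * 0 + c)%:E)%E.
  have : ((k t)%:E + ((f 1 - c) * t^-1 + c)%:E)%E @[t --> +oo] -->
      (ereal_sup (range (EFin \o k)) + ((f 1 - c) * 0 + c)%:E)%E.
    by apply: cvgeD => //; rewrite fin_num_adde_defl.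
  apply: cvg_trans; apply: near_eq_cvg.
  exists 2; split; first exact: num_real.
  move=> t t2; rewrite -EFinD /k (max_idPl (ltW t2)); congr (_%:E).
  rewrite /g; field; lra.
by rewrite /finfty (cvg_lim _ c3).
Qed.

Lemma fzero_ge a b : (forall t, 0 < t -> a + b * t <= f t) -> ((a - `|b|)%:E <= fzero f)%E.
Proof.
move=> h; rewrite /fzero; apply: lime_ge; first by apply: cvgP fzero_cvg.
near=> t; rewrite lee_fin; have t0 : 0 < t by near: t; exact: nbhs_right_gt.
have t1 : t < 1 by near: t; exact: nbhs_right_lt.
apply: le_trans (h t t0); rewrite lerD2l; have := ler_norm (- b); rewrite normrN => hb.
have := normr_ge0 b; nra.
Unshelve. all: by end_near. Qed.

Lemma finfty_ge a b : (forall t, 0 < t -> a + b * t <= f t) -> ((b - `|a|)%:E <= finfty f)%E.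
Proof.
move=> h; rewrite /finfty; apply: lime_ge; first by apply: cvgP finfty_cvg.
exists 1; split; first exact: num_real.
move=> t t1; rewrite lee_fin; have t0 : 0 < t by lra.
rewrite ler_pdivlMr//; apply: le_trans (h t t0).
have := ler_norm (- a); rewrite normrN => ha; have := normr_ge0 a; nra.
Qed.

Lemma lt_real_above (x : \bar R) : (x < +oo)%E -> exists C : R, (x < C%:E)%E.
Proof.
case: x => [r _| //|_]; first by exists (r + 1); rewrite lte_fin ltrDl.
by exists 0; rewrite ltNyr.
Qed.

Lemma bounded_near_zero s : 0 < s -> (fzero f < +oo)%E ->
  exists C, (fzero f <= C%:E)%E /\ forall t, 0 < t <= s -> f t <= C.
Proof.
move=> s0 /lt_real_above[C1 hC1].
have : \forall t \near 0^'+, ((f t)%:E < C1%:E)%E.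
  exact: (fzero_cvg (open_ereal_lt' hC1)).
move=> [d /= d0 hd].
exists (Num.max C1 (Num.max (f (Num.min (d / 2) s)) (f s))); split.
  by apply: (le_trans (ltW hC1)); rewrite lee_fin le_max lexx.
move=> t /andP[t0 ts]; have [td|td] := ltP t d.
  have : ((f t)%:E < C1%:E)%E.
    by apply: hd => //=; rewrite sub0r normrN gtr0_norm.
  by rewrite lte_fin => h; rewrite le_max ltW.
have m0 : 0 < Num.min (d / 2) s by rewrite lt_min s0 divr_gt0.
rewrite le_max; apply/orP; right; apply: convex_le_max => //.
by rewrite ge_min; apply/orP; left; lra.
Qed.

Lemma bounded_near_infty s : 0 < s -> (finfty f < +oo)%E ->
  exists C, 0 <= C /\ (finfty f <= C%:E)%E /\ forall t, s <= t -> f t <= C * t.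
Proof.
move=> s0 /lt_real_above[C1 hC1].
have : \forall t \near +oo, ((f t / t)%:E < C1%:E)%E.
  exact: (finfty_cvg (open_ereal_lt' hC1)).
move=> [T [_ hT]].
pose T1 := Num.max (T + 1) (s + 1).
pose D := Num.max 0 (Num.max (f s) (f T1)).
pose C := Num.max C1 (D / s).
have D0 : 0 <= D by rewrite le_max lexx.
exists (Num.max C 0); split; first by rewrite le_max lexx orbT.
split; first by apply: (le_trans (ltW hC1)); rewrite lee_fin !le_max lexx.
move=> t st; have t0 : 0 < t by lra.
have CC : C <= Num.max C 0 by rewrite le_max lexx.
have [tT|tT] := ltP T t.
  have := hT t tT; rewrite /= lte_fin ltr_pdivrMr// => h.
  have h1 : C1 <= C by rewrite le_max lexx.
  have := ler_wpM2r (ltW t0) (le_trans h1 CC); lra.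
have fD : f t <= D.
  rewrite /D le_max; apply/orP; right; apply: convex_le_max => //.
  by rewrite le_max; apply/orP; left; lra.
have h2 : D / s <= C by rewrite le_max lexx orbT.
have := ler_wpM2r (ltW t0) (le_trans h2 CC).
apply: le_trans; apply: (le_trans fD); rewrite mulrAC ler_pdivlMr//.
by rewrite ler_wpM2l.
Qed.

Let hr t := (1 - t) * f (t / (1 - t)).

Lemma hfunE t : 0 < t -> t < 1 -> hfun f t = (hr t)%:E.
Proof. by move=> t0 t1; rewrite /hfun /perspective !gt_eqF// subr_gt0. Qed.
Lemma hfun0 : hfun f 0 = fzero f.
Proof. by rewrite /hfun /perspective subr0 oner_eq0 eqxx mule1. Qed.
Lemma hfun1 : hfun f 1 = finfty f.
Proof. by rewrite /hfun /perspective subrr eqxx mule1. Qed.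

Lemma hr_convex x t y : 0 < x -> x < t -> t < y -> y < 1 ->
  (y - x) * hr t <= (y - t) * hr x + (t - x) * hr y.
Proof.
move=> x0 xt ty y1.
have X1 : 0 < 1 - x by lra. have T1 : 0 < 1 - t by lra. have Y1 : 0 < 1 - y by lra.
have ix : 0 < x / (1 - x) by rewrite divr_gt0.
have l1 : x / (1 - x) < t / (1 - t) by rewrite ltr_pdivrMr// mulrAC ltr_pdivlMr//; lra.
have l2 : t / (1 - t) < y / (1 - y) by rewrite ltr_pdivrMr// mulrAC ltr_pdivlMr//; lra.
have := convex3 ix l1 l2.
have e1 : y / (1 - y) - x / (1 - x) = (y - x) / ((1 - x) * (1 - y)) by field; rewrite !gt_eqF.
have e2 : y / (1 - y) - t / (1 - t) = (y - t) / ((1 - t) * (1 - y)) by field; rewrite !gt_eqF.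
have e3 : t / (1 - t) - x / (1 - x) = (t - x) / ((1 - x) * (1 - t)) by field; rewrite !gt_eqF.
rewrite e1 e2 e3 /hr; move: (f _) (f _) (f _) => r q p.
have P : 0 < (1 - x) * (1 - t) * (1 - y) by rewrite !mulr_gt0.
move=> h; have := ler_wpM2l (ltW P) h.
have -> : (1 - x) * (1 - t) * (1 - y) * ((y - x) / ((1 - x) * (1 - y)) * p) = (y - x) * ((1 - t) * p).
  by field; rewrite !gt_eqF.
have -> : (1 - x) * (1 - t) * (1 - y) * ((y - t) / ((1 - t) * (1 - y)) * q + (t - x) / ((1 - x) * (1 - t)) * r) =
   (y - t) * ((1 - x) * q) + (t - x) * ((1 - y) * r) by field; rewrite !gt_eqF.
by [].
Qed.

(** On ]0, 1[ the sublevel sets of a convex function are intervals. *)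
Lemma hfun_measurable : emeas `[0%R, 1%R]%classic (hfun f).
Proof.
have m01 : emeas `]0%R, 1%R[%classic (hfun f).
  apply: (@eq_measurable_fun _ _ (measurableTypeR R) (\bar R) _ (EFin \o hr)).
    by move=> t; rewrite inE /= in_itv /= => /andP[t0 t1]; rewrite hfunE.
  apply/measurable_EFinP.
  apply: (measurability (@RGenInftyO.G R) (RGenInftyO.measurableE R)).
  move=> _ [_ [a ->] <-]; apply: is_interval_measurable => x y /=.
  rewrite !in_itv /= => -[/andP[x0 x1] hx] [/andP[y0 y1] hy] t /andP[]; rewrite !in_itv /=.
  rewrite le_eqVlt => /predU1P[<- _|xt]; first by rewrite x0 x1 hx.
  rewrite le_eqVlt => /predU1P[->|ty]; first by rewrite y0 y1 hy.
  split; first by apply/andP; split; lra.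
  have := hr_convex x0 xt ty y1 => h.
  have yx : 0 < y - x by lra.
  rewrite -(ltr_pM2l yx); apply: (le_lt_trans h).
  have := ltr_pM2l (ltac:(lra) : 0 < y - t) (hr x) a; rewrite hx => h1.
  have := ltr_pM2l (ltac:(lra) : 0 < t - x) (hr y) a; rewrite hy => h2.
  by lra.
have -> : `[0%R, 1%R]%classic = ([set 0%R] `|` [set 1%R]) `|` `]0%R, 1%R[%classic :> set R.
  apply/seteqP; split=> t /=; rewrite !in_itv /=.
    move=> /andP[]; rewrite le_eqVlt => /predU1P[<- _|t0]; first by left; left.
    by rewrite le_eqVlt => /predU1P[->|t1]; [left; right|right; rewrite t0].
  by move=> [[->|->]|/andP[t0 t1]]; rewrite ?lexx ?ler01// !ltW.
apply/measurable_funU; [exact: measurableU|exact: measurable_itv|split=> //].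
by apply/measurable_funU => //; split; exact: measurable_fun_set1.
Qed.

Lemma hfun_lower : exists2 L : R, 0 <= L & forall t, 0 <= t <= 1 -> ((- L)%:E <= hfun f t)%E.
Proof.
have [a [b hab]] := convex_affine_minorant.
have na := normr_ge0 a; have nb := normr_ge0 b.
have a1 := ler_norm (- a); have b1 := ler_norm (- b); rewrite !normrN in a1 b1.
exists (`|a| + `|b|) => [|t /andP[]]; first by rewrite addr_ge0.
rewrite le_eqVlt => /predU1P[<- _|t0].
  by rewrite hfun0; apply: le_trans (fzero_ge hab); rewrite lee_fin; lra.
rewrite le_eqVlt => /predU1P[->|t1].
  by rewrite hfun1; apply: le_trans (finfty_ge hab); rewrite lee_fin; lra.
rewrite hfunE// lee_fin /hr; have T1 : 0 < 1 - t by lra.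
have := ler_wpM2l (ltW T1) (hab _ (divr_gt0 t0 T1)).
have -> : (1 - t) * (a + b * (t / (1 - t))) = (1 - t) * a + b * t by field; rewrite gt_eqF.
by nra.
Qed.

Lemma hfun_bounded_left r : r < 1 -> (fzero f < +oo)%E ->
  exists C : R, forall t, 0 <= t <= r -> (hfun f t <= C%:E)%E.
Proof.
move=> r1 fin; have [r0|r0] := ltP 0 r; last first.
  have [C hC] := lt_real_above fin; exists C => t /andP[t0 tr].
  by rewrite (_ : t = 0) ?hfun0 ?ltW//; lra.
have R1 : 0 < 1 - r by lra.
have [C [hC0 hC]] := bounded_near_zero (divr_gt0 r0 R1) fin.
exists (Num.max C 0) => t /andP[]; rewrite le_eqVlt => /predU1P[<- _|t0 tr].
  by rewrite hfun0; apply: (le_trans hC0); rewrite lee_fin le_max lexx.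
have t1 : t < 1 by lra.
rewrite hfunE// lee_fin /hr; have T1 : 0 < 1 - t by lra.
have : f (t / (1 - t)) <= Num.max C 0.
  rewrite le_max hC// divr_gt0//= ler_pdivrMr// mulrAC ler_pdivlMr//; lra.
have : 0 <= Num.max C 0 by rewrite le_max lexx orbT.
by nra.
Qed.

Lemma hfun_bounded_right r : 0 < r -> (finfty f < +oo)%E ->
  exists C : R, forall t, r <= t <= 1 -> (hfun f t <= C%:E)%E.
Proof.
move=> r0 fin; have [r1|r1] := ltP r 1; last first.
  have [C hC] := lt_real_above fin; exists C => t /andP[t0 tr].
  by rewrite (_ : t = 1) ?hfun1 ?ltW//; lra.
have R1 : 0 < 1 - r by lra.
have [C [C0 [hC0 hC]]] := bounded_near_infty (divr_gt0 r0 R1) fin.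
exists C => t /andP[tr]; rewrite le_eqVlt => /predU1P[->|t1]; first by rewrite hfun1.
have t0 : 0 < t by lra.
rewrite hfunE// lee_fin /hr; have T1 : 0 < 1 - t by lra.
have h : f (t / (1 - t)) <= C * (t / (1 - t)).
  by apply: hC; rewrite ler_pdivrMr// mulrAC ler_pdivlMr//; lra.
have := ler_wpM2l (ltW T1) h.
have -> : (1 - t) * (C * (t / (1 - t))) = C * t by field; rewrite gt_eqF.
by nra.
Qed.

Lemma hfun_bounded_inside r1 r2 : 0 < r1 -> r2 < 1 ->
  exists C : R, forall t, r1 <= t <= r2 -> (hfun f t <= C%:E)%E.
Proof.
move=> r10 r21; set C := Num.max (f (r1 / (1 - r1))) (f (r2 / (1 - r2))).
exists (Num.max C 0) => t /andP[t1 t2]; have T1 : 0 < 1 - t by lra.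
rewrite hfunE ?lee_fin /hr; [|lra..].
have mono (x y : R) : x <= y -> y < 1 -> x / (1 - x) <= y / (1 - y).
  move=> xy y1; have Y1 : 0 < 1 - y by lra. have X1 : 0 < 1 - x by lra.
  by rewrite ler_pdivrMr// mulrAC ler_pdivlMr//; lra.
have h : f (t / (1 - t)) <= C.
  apply: convex_le_max; [rewrite divr_gt0//; lra|apply: mono; lra|apply: mono; lra].
have c0 : 0 <= Num.max C 0 by rewrite le_max lexx orbT.
have {}h : f (t / (1 - t)) <= Num.max C 0 by rewrite le_max h.
by nra.
Qed.

End convex_function.

(** * Existence of bounded spectral integrals *)

Section spectral_more.
Context {R : realType} {K : hilbertType R} (E : set R -> K -> K).
Hypothesis hE : spectral_measure E.

Lemma nu_level (nu : set R -> R) g (L : R) m n : countably_additive nu -> rmeas g ->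
  (forall t, 0 <= g t <= L) -> L * m.+1%:R < n%:R ->
  \sum_(i < n) nu (level g m i) = nu setT.
Proof.
move=> hn mg hg hL; have [mu hm] := measure_of hn.
have bl i : borel_set (level g m i) by exact: borel_level.
have cov : \big[setU/set0]_(i < n) level g m i = setT.
  by rewrite -(level_cover hg hL) bigcup_mkord.
apply: EFin_inj; rewrite -sumEFin -hm; last exact: measurableT.
rewrite -cov measure_bigsetU//; last exact: level_trivIset.
by apply: eq_bigr => i _; symmetry; apply: hm; exact: bl.
Qed.

Lemma E_level g (L : R) m n v : rmeas g -> (forall t, 0 <= g t <= L) -> L * m.+1%:R < n%:R ->
  \sum_(i < n) E (level g m i) v = v.
Proof.
move=> mg hg hL; apply/subr0_eq.
have bl i : borel_set (level g m i) by exact: borel_level.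
apply: (@symmetric_zero R K (fun v => \sum_(i < n) E (level g m i) v - v)).
- move=> a x y; rewrite scalerBr scaler_sumr opprD addrACA; congr (_ + _).
  rewrite -big_split; apply: eq_bigr => i _.
  by have [lE _] := E_bounded hE (bl i); rewrite lE.
- move=> x y; rewrite ripBl ripBr rip_suml rip_sumr; congr (_ - _).
  by apply: eq_bigr => i _; rewrite (E_sym hE).
- move=> w; rewrite ripBl rip_suml (nu_level (ev_ctbl hE w) mg hg hL).
  by rewrite (ev_setT hE) /nsq subrr.
Qed.

Lemma E_diff S T v : borel_set S -> borel_set T -> S `<=` T ->
  E (T `\` S) v = E T v - E S v.
Proof.
move=> bS bT ST; rewrite setDE (E_setI hE)//; last exact: measurableC.
have [lT _] := E_bounded hE bT; rewrite (E_setC hE)// (opB lT) -(E_setI hE)//.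
by rewrite (setIidr ST).
Qed.

Lemma E_increasing (S : nat -> set R) v : (forall n, borel_set (S n)) ->
  (forall n, S n `<=` S n.+1) -> E (\bigcup_n S n) v = v -> hcvg (fun n => E (S n) v) v.
Proof.
move=> bS incr Uv.
have bU : borel_set (\bigcup_n S n) by exact: bigcupT_measurable.
have [mu hm] := measure_of (ev_ctbl hE v).
have c : mu (S n) @[n --> \oo] --> mu (\bigcup_n S n).
  have hS : {homo S : n m / (n <= m)%N >-> (n <= m)%O}.
    by apply/nondecreasing_seqP => n; apply/subsetPset; exact: incr.
  exact: nondecreasing_cvg_mu bS bU hS.
have {}c : (fun n => ev E v (S n)) @ \oo --> nsq v.
  have : (ev E v (S n))%:E @[n --> \oo] --> (nsq v)%:E.
    rewrite (_ : (nsq v)%:E = mu (\bigcup_n S n)); last first.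
      by rewrite hm// (evE hE)// Uv.
    by rewrite (_ : (fun n => _) = (fun n => mu (S n)))//; apply/funext => n; rewrite hm.
  by move=> /fine_cvgP[].
rewrite /hcvg; have e n : nsq (E (S n) v - v) = nsq v - ev E v (S n).
  rewrite nsqBC nsqB -(evE hE)// -/(ev E v _) ripC -/(ev E v (S n)); ring.
under eq_fun do rewrite e.
suff : (fun n => nsq v - ev E v (S n)) @ \oo --> nsq v - nsq v by rewrite subrr.
by apply: cvgB => //; exact: cvg_cst.
Qed.

Variables (g : R -> R) (L : R).
Hypothesis mg : rmeas g.
Hypothesis gL : forall t, 0 <= g t <= L.

Let L0 : 0 <= L. Proof. by have /andP[/le_trans] := gL 0; apply. Qed.

Definition lcount (m : nat) : nat := Num.bound (L * m.+1%:R).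
Lemma lcountP m : L * m.+1%:R < (lcount m)%:R.
Proof. by rewrite /lcount archi_boundP ?mulr_ge0. Qed.

Definition stepn m := step_op E g m (lcount m).

Let sumsq_le m k v : nsq (stepn m v - stepn k v) <= (m.+1%:R^-1 + k.+1%:R^-1) ^+ 2 * nsq v.
Proof.
apply: (@symmetric_norm_le0 R K (fun v => stepn m v - stepn k v)).
- move=> a x y; rewrite /stepn !(step_op_linear hE mg) scalerBr opprD.
  by rewrite addrACA.
- by move=> x y; rewrite ripBl ripBr !(step_op_sym hE mg).
- by rewrite addr_ge0 ?invr_ge0.
- move=> w; have [I hI /andP[h1 h2]] := level_sum (ev_ctbl hE w) mg gL (lcountP m).
  have [I' hI' /andP[h3 h4]] := level_sum (ev_ctbl hE w) mg gL (lcountP k).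
  have II : I = I' by apply: EFin_inj; rewrite -hI -hI'.
  rewrite ripBl !step_op_rip -II in h3 h4 *; rewrite (ev_setT hE) in h2 h4.
  rewrite mulrDl ler_norml; move: h1 h2 h3 h4.
  rewrite ![nsq w / _]mulrC.
  have n0 : 0 <= m.+1%:R^-1 * nsq w by rewrite mulr_ge0 ?invr_ge0 ?nsq_ge0.
  have k0 : 0 <= k.+1%:R^-1 * nsq w by rewrite mulr_ge0 ?invr_ge0 ?nsq_ge0.
  move: (m.+1%:R^-1 * _) (k.+1%:R^-1 * _) n0 k0 => p q p0 q0 h1 h2 h3 h4.
  by apply/andP; split; lra.
Qed.

(** By [level_sum], the quadratic forms of two step operators are close to each other; so the step
    operators form a Cauchy sequence. *)
Lemma spectral_op_exists : exists2 T, spectral_op E g T & forall v, hcvg (fun m => stepn m v) (T v).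
Proof.
have /choice[T hT] v : exists l, hcvg (fun m => stepn m v) l.
  apply: hilbert_complete => e e0.
  have n1 : 0 < nsq v + 1 by have := nsq_ge0 v; lra.
  have e4 : 0 < e / (4 * (nsq v + 1)) by rewrite divr_gt0// mulr_gt0.
  have [N hN] := inv_lt_eps e4.
  exists N => m k /hN hm /hN hk; apply: (le_lt_trans (sumsq_le m k v)).
  have u1 j : j.+1%:R^-1 <= 1 :> R by rewrite invf_le1// ler1n.
  have p0 j : 0 <= j.+1%:R^-1 :> R by rewrite invr_ge0.
  have um := u1 m; have uk := u1 k; have pm := p0 m; have pk := p0 k.
  rewrite ltr_pdivlMr ?mulr_gt0// in hm; rewrite ltr_pdivlMr ?mulr_gt0// in hk.
  move: (m.+1%:R^-1) (k.+1%:R^-1) hm hk um uk pm pk => p q hm hk um uk pm pk.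
  have nv := nsq_ge0 v.
  have sq : (p + q) ^+ 2 <= 2 * p + 2 * q by nra.
  have := ler_wpM2r nv sq; nra.
have bT0 : bounded_op (stepn 0).
  have bl i : borel_set (level g 0 i) by exact: borel_level.
  rewrite /stepn /step_op; elim: (lcount 0) => [|n IH].
    apply: (@bounded_intro _ _ _ _ 0) => [a x y|x]; rewrite !big_ord0 ?scaler0 ?addr0//.
    by rewrite nsq0 mul0r.
  rewrite (_ : (fun v => _) = (n%:R / 1%:R)%:C *: E (level g 0 n) +
    (fun v => \sum_(i < n) (i%:R / 1%:R)%:C *: E (level g 0 i) v)).
    by apply: bounded_comb => //; exact: (E_bounded hE).
  by apply/funext => v; rewrite big_ord_recr /= addrC.
exists T => //; split.
- have [C C0 hC] := bounded_nsq bT0.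
  have close v : nsq (T v - stepn 0 v) <= 4 * nsq v.
    have c1 : hcvg (fun m => stepn m v - stepn 0 v) (T v - stepn 0 v).
      by apply: hcvgD => //; exact: hcvg_const.
    rewrite -(cvg_lim _ (hcvg_nsq c1))//; apply: limr_le; first exact: cvgP (hcvg_nsq c1).
    apply: nearW => m; apply: (le_trans (sumsq_le m 0 v)).
    rewrite ler_wpM2r ?nsq_ge0//.
    have u1 : m.+1%:R^-1 <= 1 :> R by rewrite invf_le1// ler1n.
    have p0 : 0 <= m.+1%:R^-1 :> R by rewrite invr_ge0.
    rewrite invr1; move: (m.+1%:R^-1) u1 p0 => p; nra.
  apply: (@bounded_intro _ _ _ _ (8 + 2 * C)) => [a x y|x].
    apply: hcvg_uniq (hT _) _.
    rewrite (_ : (fun m => _) = (fun m => a *: stepn m x + stepn m y)).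
      by apply: hcvgD => //; exact: hcvgZ.
    by apply/funext => m; rewrite /stepn (step_op_linear hE mg).
  have := nsqD_le (T x - stepn 0 x) (stepn 0 x); rewrite subrK.
  by have := close x; have := hC x; lra.
- move=> x y; apply: (@cvg_unique _ _ ((fun m => rip (stepn m x) y) @ \oo)) => //.
    exact: hcvg_rip.
  rewrite (_ : (fun m => _) = (fun m => rip (stepn m y) x)); last first.
    by apply/funext => m; rewrite /stepn (step_op_sym hE mg) ripC.
  by rewrite (ripC x); exact: hcvg_rip.
- move=> v; have [I hI _] := level_sum (ev_ctbl hE v) mg gL (lcountP 0).
  rewrite hI; congr (_%:E).
  have c1 := @hcvg_rip _ _ _ _ v (hT v).
  have c2 : (fun m => rip (stepn m v) v) @ \oo --> I.
    apply/cvgrPdist_lt => e e0; have n1 : 0 < nsq v + 1 by have := nsq_ge0 v; lra.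
    have [N hN] := inv_lt_eps (divr_gt0 e0 n1); exists N => // m /= /hN.
    rewrite ltr_pdivlMr// => hm.
    have [I' hI' /andP[h1 h2]] := level_sum (ev_ctbl hE v) mg gL (lcountP m).
    have II : I = I' by apply: EFin_inj; rewrite -hI -hI'.
    rewrite -II in h1 h2; rewrite (ev_setT hE) in h2.
    rewrite step_op_rip ger0_norm ?subr_ge0//; apply: le_lt_trans hm.
    rewrite lerBlDl (le_trans h2)// lerD2l mulrC ler_wpM2l ?invr_ge0//; lra.
  exact: (cvg_unique _ c2 c1).
Qed.

End spectral_more.

(** * Completely positive maps with affine densities *)

Section affine_maps.
Context {R : realType} {H0 H K : hilbertType R} (M : set (H0 -> H0)) (N : set (H -> H)).
Variables (Phi Psi : (H0 -> H0) -> H -> H) (pi : (H0 -> H0) -> K -> K) (V : H -> K).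
Variables (A B : K -> K) (E : set R -> K -> K).
Hypothesis vnM : von_neumann M.
Hypothesis vnN : von_neumann N.
Hypothesis cpPhi : CP M N Phi.
Hypothesis cpPsi : CP M N Psi.
Hypothesis srn : minimal_SRN M Phi Psi pi V A B.
Hypothesis sA : spectral_decomposition01 A E.

Let hE : spectral_measure E. Proof. by case: sA. Qed.
Let hA : positive_contraction A. Proof. by case: srn => _ []. Qed.
Let bA : bounded_op A. Proof. by case: hA. Qed.
Let bV : bounded_op V. Proof. by case: srn => -[]. Qed.
Let baV : bounded_op (adjoint V). Proof. exact: bounded_adjoint. Qed.
Let laV : linear (adjoint V). Proof. by case: baV. Qed.

Lemma bicommE S : borel_set S -> bicomm A (E S).
Proof.
move=> bS; split; first exact: (E_bounded hE).
by move=> x bx cx cx' v; apply: (spectral_commute hA sA).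
Qed.

Lemma bicommZ a T : bicomm A T -> bicomm A (a *: T).
Proof.
move=> bT; have -> : a *: T = (a - 1) *: T + T; last exact: bicomm_comb.
by rewrite scalerBl scale1r subrK.
Qed.

(** Complete positivity of [Theta pi V T], tested on all vectors of K. *)
Definition cpos (T : K -> K) : Prop :=
  forall n (X : 'I_n -> 'I_n -> H0 -> H0) (w : 'I_n -> K), (forall i j, M (X i j)) ->
    positive_opmx X -> 0 <= \sum_(i < n) \sum_(j < n) inner K (T (pi (X i j) (w j))) (w i).

Lemma CP_ext F G : (forall x, M x -> F x = G x) -> CP M N F -> CP M N G.
Proof.
move=> e [h1 h2 h3]; split.
- by move=> x Mx; rewrite -e//; exact: h1.
- move=> a x y Mx My; rewrite -!e//; first exact: h2.
  exact: (vn_comb vnM).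
- move=> n X MX pX v; have := h3 n X MX pX v; congr (0 <= _).
  by apply: eq_bigr => i _; apply: eq_bigr => j _; rewrite e.
Qed.

Lemma Theta_CP T : bicomm A T -> cpos T -> CP M N (Theta pi V T).
Proof.
move=> bT pT; have [[lT _] _] := bT; split.
- exact: (bicomm_Theta vnM vnN cpPhi cpPsi srn).
- move=> a x y Mx My; apply/funext => v.
  by rewrite /Theta !fctE /= (pi_comb srn)// lT laV.
- move=> n X MX pX v; have := pT n X (V \o v) MX pX; congr (0 <= _).
  apply: eq_bigr => i _; apply: eq_bigr => j _.
  by rewrite /Theta /= (@inner_adj _ _ _ _ _ _ bV).
Qed.

(** [E S] is a projection that commutes with [pi], so it can be moved onto the vectors. *)
Lemma cpos_E S : borel_set S -> cpos (E S).
Proof.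
move=> bS n X w MX pX; have [_ cS] := bicomm_pi vnM srn (bicommE bS).
have := pi_positive vnM vnN cpPhi cpPsi srn (E S \o w) MX pX; congr (0 <= _).
apply: eq_bigr => i _; apply: eq_bigr => j _ /=.
by rewrite -(cS _ _ (MX i j)) -(@inner_adj _ _ _ _ _ _ (E_bounded hE bS)) (E_adj hE bS)
  (E_idem hE _ bS).
Qed.

Lemma cpos_sum n (c : 'I_n -> R) (T : 'I_n -> K -> K) : (forall k, cpos (T k)) ->
  (forall k, 0 <= c k) -> cpos (fun v => \sum_(k < n) (c k)%:C *: T k v).
Proof.
move=> pT c0 m X w MX pX.
rewrite (_ : \sum_(i < m) _ = \sum_(k < n) (c k)%:C *
    \sum_(i < m) \sum_(j < m) inner K (T k (pi (X i j) (w j))) (w i)).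
  by apply: sumr_ge0 => k _; rewrite mulr_ge0 ?ler0c// pT.
under eq_bigr => i _ do (under eq_bigr => j _ do rewrite inner_suml; rewrite exchange_big /=).
rewrite exchange_big /=; apply: eq_bigr => k _; rewrite mulr_sumr; apply: eq_bigr => i _.
by rewrite mulr_sumr; apply: eq_bigr => j _; rewrite innerZl.
Qed.

Lemma cpos_lim (Tn : nat -> K -> K) T : (forall n, cpos (Tn n)) ->
  (forall v, hcvg (fun n => Tn n v) (T v)) -> cpos T.
Proof.
move=> pT c n X w MX pX.
apply: (@ccvg_ge0 _ (fun k => \sum_(i < n) \sum_(j < n) inner K (Tn k (pi (X i j) (w j))) (w i))).
  apply: ccvg_sum => i; apply: ccvg_sum => j; apply: ccvg_inner => //; exact: hcvg_const.
by move=> k; apply: pT.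
Qed.

(** The spectral integral of [al + be * t] over [S]. *)
Definition affS (al be : R) S v : K := al%:C *: E S v + be%:C *: A (E S v).

Lemma bicomm_aff al be S : borel_set S -> bicomm A (affS al be S).
Proof.
move=> bS; rewrite (_ : affS al be S = al%:C *: E S + be%:C *: (A \o E S)); last first.
  by apply/funext => v.
apply: bicomm_comb; first exact: bicommE.
by apply: bicommZ; apply: bicomm_comp; [exact: (bicommA srn)|exact: bicommE].
Qed.

(** [A] is approximated by the step operators of the levels of [clamp]; the shift of the
    coefficients by [`|be| / m.+1] makes them nonnegative on the levels that meet [S]. *)
Lemma cpos_aff al be S : borel_set S -> (forall t, S t -> 0 <= t <= 1 -> 0 <= al + be * t) ->
  cpos (affS al be S).
Proof.
move=> bS pos.
pose c m (k : 'I_m.+2) : R := al + be * (k%:R / m.+1%:R) + `|be| / m.+1%:R.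
pose lv m (k : nat) := level (@clamp R) m k.
have blv m k : borel_set (lv m k) by exact: (borel_level m k (@clamp_meas R)).
have bSk m k : borel_set (lv m k `&` S) by apply: measurableI; [exact: blv|exact: bS].
have l2 m : 1 * m.+1%:R < m.+2%:R :> R by rewrite mul1r ltr_nat.
pose e m v := \sum_(k < m.+2) (c m k)%:C *: E (lv m k `&` S) v.
apply: (@cpos_lim e) => [m|v].
- rewrite (_ : e m = fun v => \sum_(k < m.+2) (Num.max (c m k) 0)%:C *: E (lv m k `&` S) v).
    apply: (@cpos_sum _ _ (fun k : 'I_m.+2 => E (lv m k `&` S))) => k.
      exact: (cpos_E (bSk m k)).
    by rewrite le_max lexx orbT.
  apply/funext => v; apply: eq_bigr => k _.
  have [c0|c0] := leP 0 (c m k); first by [].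
  (* the level does not meet S inside [0, 1] *)
  suff -> : E (lv m k `&` S) v = 0 by rewrite !scaler0.
  rewrite -(E_restrict01 sA)// (_ : _ `&` _ = set0) ?(E_set0 hE)//.
  apply/seteqP; split=> // t [[lt St]]; rewrite /= in_itv /= => t01.
  suff : 0 <= c m k by rewrite leNgt c0.
  have := pos t St t01; move: lt; rewrite /lv /level /= in_itv /= clamp_id// => /andP[h1 h2].
  rewrite /c => p; apply: le_trans p _; rewrite -addrA lerD2l.
  have {}h2 : t - k%:R / m.+1%:R <= m.+1%:R^-1.
    by rewrite lerBlDl (le_trans (ltW h2))// -[k.+1]addn1 natrD mulrDl mul1r.
  have h3 := ler_norm be; have h4 : 0 <= m.+1%:R^-1 :> R by rewrite invr_ge0.
  have h5 := normr_ge0 be.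
  have {}h1 : 0 <= t - k%:R / m.+1%:R by rewrite subr_ge0.
  have := ler_wpM2r h1 h3; have := ler_wpM2l h5 h2.
  move: (k%:R / m.+1%:R : R) (m.+1%:R^-1 : R) => x q; lra.
- pose u := E S v.
  have -> : (fun m => e m v) = (fun m => (al%:C *: u + be%:C *: step_op E (@clamp R) m m.+2 u)
      + (`|be| / m.+1%:R)%:C *: u).
    apply/funext => m.
    rewrite -{1 3}(E_level hE u (@clamp_meas R) (@clamp_bounds R) (l2 m)).
    rewrite !scaler_sumr -!big_split /=; apply: eq_bigr => k _.
    by rewrite scalerA -!scalerDl (E_setI hE)// !rmorphD /= rmorphM.
  rewrite -[affS _ _ _ _]addr0; apply: hcvgD; first apply: hcvgD; first exact: hcvg_const.
    apply: hcvgZ; have so := spectral_op_clamp hA sA.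
    rewrite /hcvg; apply/cvg0P => [m|ep ep0]; first exact: nsq_ge0.
    have n1 : 0 < nsq u + 1 by have := nsq_ge0 u; lra.
    have [n0 hn0] := inv_lt_eps (divr_gt0 ep0 n1); exists n0 => m /hn0 hm.
    rewrite nsqBC.
    have := spectral_op_approx hE (@clamp_meas R) (@clamp_bounds R) so (l2 m) u.
    move=> h; apply: le_lt_trans h _; rewrite ltr_pdivlMr// in hm.
    have i1 : m.+1%:R^-1 <= 1 :> R by rewrite invf_le1// ler1n.
    have i0 : 0 <= m.+1%:R^-1 :> R by rewrite invr_ge0.
    move: (m.+1%:R^-1 : R) i0 i1 hm (nsq_ge0 u) => p i0 i1 hm nu.
    have := ler_wpM2r nu (ltac:(nra) : p ^+ 2 <= p); lra.
  rewrite /hcvg; apply/cvg0P => [m|ep ep0]; first exact: nsq_ge0.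
  have C0 : 0 <= be ^+ 2 * nsq u by rewrite mulr_ge0 ?sqr_ge0 ?nsq_ge0.
  have n1 : 0 < be ^+ 2 * nsq u + 1 by lra.
  have [n0 hn0] := inv_lt_eps (divr_gt0 ep0 n1); exists n0 => m /hn0 hm.
  rewrite subr0 nsqZr exprMn real_normK ?num_real//.
  rewrite ltr_pdivlMr// in hm.
  have i1 : m.+1%:R^-1 <= 1 :> R by rewrite invf_le1// ler1n.
  have i0 : 0 <= m.+1%:R^-1 :> R by rewrite invr_ge0.
  rewrite mulrAC; move: (m.+1%:R^-1 : R) i0 i1 hm => p i0 i1 hm.
  have := ler_wpM2l C0 (ltac:(nra) : p ^+ 2 <= p); lra.
Qed.

End affine_maps.

(** * Absolute continuity *)

Section absolute_continuity.
Context {R : realType} {H0 H K : hilbertType R} (M : set (H0 -> H0)) (N : set (H -> H)).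
Variables (Phi Psi : (H0 -> H0) -> H -> H) (pi : (H0 -> H0) -> K -> K) (V : H -> K).
Variables (A B : K -> K) (E : set R -> K -> K).
Hypothesis vnM : von_neumann M.
Hypothesis vnN : von_neumann N.
Hypothesis cpPhi : CP M N Phi.
Hypothesis cpPsi : CP M N Psi.
Hypothesis srn : minimal_SRN M Phi Psi pi V A B.
Hypothesis sA : spectral_decomposition01 A E.

Let hE : spectral_measure E. Proof. by case: sA. Qed.
Let hA : positive_contraction A. Proof. by case: srn => _ []. Qed.
Let bA : bounded_op A. Proof. by case: hA. Qed.
Let lA : linear A. Proof. by case: bA. Qed.
Let bV : bounded_op V. Proof. by case: srn => -[]. Qed.
Let lV : linear V. Proof. by case: bV. Qed.
Let baV : bounded_op (adjoint V). Proof. exact: bounded_adjoint. Qed.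
Let laV : linear (adjoint V). Proof. by case: baV. Qed.

Let aff al be S : K -> K := affS A E al be S.

Lemma Theta_aff_CP al be S : borel_set S ->
  (forall t, S t -> 0 <= t <= 1 -> 0 <= al + be * t) -> CP M N (Theta pi V (affS A E al be S)).
Proof.
move=> bS pos; apply: (Theta_CP vnM vnN cpPhi cpPsi srn).
  exact: (bicomm_aff srn sA).
exact: (cpos_aff vnM vnN cpPhi cpPsi srn sA).
Qed.

(** The difference of the densities is the sum of a nonnegative affine function on [S] and another
    one on the rest of [S']. *)
Lemma le_cp_aff F G al be al' be' S S' : borel_set S -> borel_set S' -> S `<=` S' ->
  (forall x, M x -> F x = Theta pi V (affS A E al be S) x) ->
  (forall x, M x -> G x = Theta pi V (affS A E al' be' S') x) ->
  (forall t, S t -> 0 <= t <= 1 -> al + be * t <= al' + be' * t) ->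
  (forall t, S' t -> ~ S t -> 0 <= t <= 1 -> 0 <= al' + be' * t) ->
  le_cp M N F G.
Proof.
move=> bS bS' SS hF hG h1 h2; have bD : borel_set (S' `\` S) by exact: measurableD.
have c1 : CP M N (Theta pi V (aff (al' - al) (be' - be) S)).
  by apply: Theta_aff_CP => // t St t01; have := h1 t St t01; lra.
have c2 : CP M N (Theta pi V (aff al' be' (S' `\` S))).
  by apply: Theta_aff_CP => // t [St nSt] t01; exact: h2.
apply: CP_ext (cpD vnN c1 c2) => // x Mx; apply/funext => v.
rewrite hF// hG// /Theta /= -[LHS]/(_ + _) -[RHS]/(_ - _).
rewrite -[RHS](opB laV) -[LHS](opD laV) /=; congr (adjoint V _).
set w := pi x (V v); rewrite /aff /affS !(E_diff hE)// !(opB lA).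
rewrite !rmorphB /= !scalerBl !scalerBr.
move: (al%:C *: E S w) (al'%:C *: E S w) (al'%:C *: E S' w) (be%:C *: A (E S w))
  (be'%:C *: A (E S w)) (be'%:C *: A (E S' w)) => a b c d e g.
by rewrite addrACA (addrC (b - a)) (addrC (e - d)) !subrKA opprD addrACA.
Qed.

Lemma affT al be v : affS A E al be setT v = al%:C *: v + be%:C *: A v.
Proof. by rewrite /affS !(E_setT hE). Qed.

Lemma aff_E al be S v : affS A E al be S v = affS A E al be setT (E S v).
Proof. by rewrite affT. Qed.

(** The truncations of the density of [F] to the sets [S n]. *)
Lemma abs_cont_aff F G al be al' be' (S : nat -> set R) (c : nat -> R) :
  (forall n, borel_set (S n)) -> (forall n, S n `<=` S n.+1) ->
  (forall v, E (\bigcup_n S n) v = v) ->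
  (forall x, M x -> F x = Theta pi V (affS A E al be setT) x) ->
  (forall x, M x -> G x = Theta pi V (affS A E al' be' setT) x) ->
  (forall t, 0 <= t <= 1 -> 0 <= al + be * t) -> (forall t, 0 <= t <= 1 -> 0 <= al' + be' * t) ->
  (forall n, 0 < c n) ->
  (forall n t, S n t -> 0 <= t <= 1 -> al + be * t <= c n * (al' + be' * t)) ->
  abs_cont M N F G.
Proof.
move=> bS incr full hF hG p p' c0 hc; pose P n := Theta pi V (aff al be (S n)).
have bT : borel_set (setT : set R) by exact: measurableT.
exists P, c; split.
- by move=> n; split=> //; apply: Theta_aff_CP => // t _; exact: p.
- move=> n; apply: (@le_cp_aff _ _ al be al be (S n) (S n.+1)) => // t _ _.
  exact: p.
- move=> x phi Mx pphi; have bTT := bicomm_aff srn sA al be bT.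
  have [bU _] := bTT.
  pose W := adjoint V \o aff al be setT.
  have bW : bounded_op W by exact: bounded_comp.
  have [C C0 hC] := bounded_nsq bW; have [D D0 hD] := bounded_nsq (bounded_comp (pi_bounded srn Mx) bV).
  have e n v : P n x v = W (E (S n) (pi x (V v))) by rewrite /P /Theta /= /aff aff_E.
  have e' v : F x v = W (pi x (V v)) by rewrite hF.
  have [lW _] := bW.
  apply: (@predual_normal _ _ N (vn_bounded vnN) phi (fun n => P n x) (F x) (C * D)) => //.
  + move=> n; apply: (bicomm_Theta vnM vnN cpPhi cpPsi srn) => //.
    exact: (bicomm_aff srn sA).
  + by rewrite hF//; exact: (bicomm_Theta vnM vnN cpPhi cpPsi srn).
  + move=> n v; rewrite e e' -(opB lW); apply: le_trans (hC _) _.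
    rewrite -mulrA ler_pM2l// nsqBC -(E_setC hE)//.
    apply: le_trans (E_le hE _ _) (hD v); apply: measurableC; exact: bS.
  + move=> v; under eq_fun do rewrite e; rewrite e'.
    apply: hcvg_op => //; apply: (E_increasing hE) => //.
- move=> n; apply: (@le_cp_aff _ _ al be (c n * al') (c n * be') (S n) setT) => //.
  + move=> x Mx; rewrite /scale_map hG//; apply/funext => v; rewrite fctE /Theta /=.
    rewrite -(opZ laV) !affT scalerDr !scalerA -!rmorphM //.
  + by move=> t St t01; rewrite -mulrA -mulrDr; exact: hc.
  + by move=> t _ _ t01; rewrite -mulrA -mulrDr mulr_ge0 ?p' // ltW.
Qed.

Lemma inner_predual u w : predual N (fun x => inner H (x u) w).
Proof.
pose d (z : H) n : H := if n == 0%N then z else 0.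
have sd z n : series (fun n => nsq (d z n)) n <= nsq z.
  case: n => [|n]; first by rewrite /series /= big_geq// nsq_ge0.
  rewrite /series /= big_nat_recl//= big1 ?addr0// => i _; exact: nsq0.
have ld z : l2 (d z) by exact: (l2_of_bound (sd z)).
exists (d u), (d w); split; [exact: l2_ereal_sum|exact: l2_ereal_sum|] => x Nx.
have e n : series (fun n => inner H (x (d u n)) (d w n)) n.+1 = inner H (x u) w.
  rewrite /series /= big_nat_recl//= big1 ?addr0// => i _; exact: inner0r.
by apply/cvgC; split; apply: cvg_near_cst; exists 1%N => // -[//|n] _; rewrite e.
Qed.

Section quadratic_form.
Variable F : (H0 -> H0) -> H -> H.
Hypothesis cpF : CP M N F.
Notation ls := (seq (unit * (H0 -> H0) * H)).
Implicit Types s t : ls.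

(** The sesquilinear form of [F] on the algebraic tensor product of M and H. *)
Definition gform s t : R :=
  complex.Re (\sum_(q <- s) \sum_(p <- t) inner H (F (adjoint p.1.2 \o q.1.2) q.2) p.2).

Lemma gform_catl s s' t : gform (s ++ s') t = gform s t + gform s' t.
Proof. by rewrite /gform big_cat ReD. Qed.

Lemma gform_catr s t t' : gform s (t ++ t') = gform s t + gform s t'.
Proof.
by rewrite /gform -ReD -big_split /=; congr (complex.Re _); apply: eq_bigr => q _; rewrite big_cat.
Qed.

Lemma gform_scalel (c : R) s t : okl M s -> okl M t ->
  gform (smap (fun v => c%:C *: v) s) t = c * gform s t.
Proof.
move=> os ot; rewrite /gform -ReZ mulr_sumr big_map; congr (complex.Re _).
elim: s os => [|q s IH] os; first by rewrite !big_nil.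
have [Mq os'] := os; rewrite !big_cons IH//; congr (_ + _); rewrite mulr_sumr.
elim: t ot {IH} => [|p t IH] ot; first by rewrite !big_nil.
have [Mp ot'] := ot; rewrite !big_cons IH//; congr (_ + _) => /=.
have Mx : M (adjoint p.1.2 \o q.1.2) by apply: (vn_comp vnM) => //; exact: (vn_adj vnM).
have [NF _ _] := cpF; have [lF _] := vn_bounded vnN (NF _ Mx).
by rewrite (opZ lF) innerZl.
Qed.

Lemma gform_scaler (c : R) s t : gform s (smap (fun v => c%:C *: v) t) = c * gform s t.
Proof.
have cc : (c%:C)^* = c%:C :> R[i] by apply/eqP; rewrite eq_complex /= oppr0 !eqxx.
rewrite /gform -ReZ mulr_sumr; congr (complex.Re _); apply: eq_bigr => q _.
by rewrite big_map mulr_sumr; apply: eq_bigr => p _; rewrite /= innerZr cc.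
Qed.

Lemma gform_ge0 s : okl M s -> 0 <= gform s s.
Proof.
move=> os; pose X (_ _ : 'I_1) : H0 -> H0 := idfun.
have pX : positive_opmx X.
  by move=> v; rewrite !big_ord1 inner_nsq ler0c nsq_ge0.
pose s' := [seq (ord0 : 'I_1, p.1.2, p.2) | p <- s].
have os' : okl M s' by elim: s os @s' => //= p s IH [Mp /IH].
have := cp_list vnM cpF (X := X) (fun _ _ => vn_id vnM) pX os'.
rewrite big_map => /ge0_Re; congr (0 <= complex.Re _); rewrite exchange_big /=.
by rewrite big_map; apply: eq_bigr => q _; rewrite ?big_map.
Qed.

(** The form is nonnegative at [s - 2 t]. *)
Lemma gform_parallelogram s t : okl M s -> okl M t ->
  gform s s <= 2 * gform t t +
    2 * gform (s ++ smap (fun v => (-1)%:C *: v) t) (s ++ smap (fun v => (-1)%:C *: v) t).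
Proof.
move=> os ot; have ot' c : okl M (smap (fun v => c%:C *: v) t) by exact: okl_smap.
have := gform_ge0 (okl_cat os (ot' (-2))).
rewrite !gform_catl !gform_catr !gform_scalel// !gform_scaler; lra.
Qed.

End quadratic_form.

Lemma gform_le F G (s : seq (unit * (H0 -> H0) * H)) : le_cp M N F G -> okl M s ->
  gform F s s <= gform G s s.
Proof.
move=> FG os; have := gform_ge0 FG os; rewrite -[gform F s s <= _]subr_ge0 /gform -ReN -ReD -sumrB.
congr (0 <= complex.Re _); apply: eq_bigr => q _; rewrite -sumrB; apply: eq_bigr => p _.
by rewrite !fctE innerBl.
Qed.

Lemma gform_scale_map c G (s t : seq (unit * (H0 -> H0) * H)) :
  gform (scale_map c G) s t = c * gform G s t.
Proof.
rewrite /gform -ReZ mulr_sumr; congr (complex.Re _); apply: eq_bigr => q _.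
by rewrite mulr_sumr; apply: eq_bigr => p _; rewrite -innerZl.
Qed.

Lemma gform_Theta F T (s t : seq (unit * (H0 -> H0) * H)) : pi_comm M pi T ->
  (forall x, M x -> F x = Theta pi V T x) -> okl M s -> okl M t ->
  gform F s t = rip (T (vec pi V s)) (vec pi V t).
Proof.
move=> cT hF os ot; rewrite /rip (vec_inner vnM srn cT os ot); congr (complex.Re _).
elim: s os => [|q s IH] os; first by rewrite !big_nil.
have [Mq os'] := os; rewrite !big_cons IH//; congr (_ + _).
elim: t ot {IH} => [|p t IH] ot; first by rewrite !big_nil.
have [Mp ot'] := ot; rewrite !big_cons IH//; congr (_ + _).
by rewrite hF//; apply: (vn_comp vnM) => //; exact: (vn_adj vnM).
Qed.

Lemma gform_cvg (F : nat -> (H0 -> H0) -> H -> H) G (s : seq (unit * (H0 -> H0) * H)) :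
  (forall x phi, M x -> predual N phi -> (fun n => phi (F n x)) @ \oo --> (phi (G x) : R[i]^o)) ->
  okl M s -> (fun n => gform (F n) s s) @ \oo --> gform G s s.
Proof.
move=> hc os.
suff h (s' t : seq (unit * (H0 -> H0) * H)) : okl M s' -> okl M t ->
    (fun n => gform (F n) s' t) @ \oo --> gform G s' t by exact: h.
move=> {os} os ot; rewrite /gform.
elim: s' os => [|q s' IH] os.
  by rewrite big_nil; under eq_fun do rewrite big_nil; exact: cvg_cst.
have [Mq os'] := os; rewrite big_cons ReD; under eq_fun do rewrite big_cons ReD.
apply: cvgD; last exact: IH.
elim: t ot {IH} => [|p t IH] ot.
  by rewrite big_nil; under eq_fun do rewrite big_nil; exact: cvg_cst.
have [Mp ot'] := ot; rewrite big_cons ReD; under eq_fun do rewrite big_cons ReD.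
apply: cvgD; last exact: IH.
have Mx : M (adjoint p.1.2 \o q.1.2) by apply: (vn_comp vnM) => //; exact: (vn_adj vnM).
by have /cvgC[] := hc _ _ Mx (inner_predual q.2 p.2).
Qed.

Lemma vecB (s t : seq (unit * (H0 -> H0) * H)) : okl M t ->
  vec pi V (s ++ smap (fun v => (-1)%:C *: v) t) = vec pi V s - vec pi V t.
Proof.
move=> ot; rewrite /vec big_cat; congr (_ + _); rewrite big_map -sumrN.
elim: t ot => [|p t IH] ot; first by rewrite !big_nil.
have [Mp ot'] := ot; rewrite !big_cons IH//; congr (_ + _) => /=.
by rewrite (opZ lV) (opZ (pi_linear srn Mp)) realZ.
Qed.

(** Approximate [w] by [v k] in the span. The value of the form of [P n] at [v k] is at most twice
    its value at [v l], plus twice the value of the form of [F] at [v k - v l]. As l grows, the first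
    term tends to 0, being dominated by the form of [T2] at [v l]. What remains does not depend on
    n, so it bounds the form of [F] at [v k], and it tends to 0 with k. *)
Lemma abs_cont_kernel F G T1 T2 w : abs_cont M N F G ->
  pi_comm M pi T1 -> pi_comm M pi T2 ->
  (forall x, M x -> F x = Theta pi V T1 x) -> (forall x, M x -> G x = Theta pi V T2 x) ->
  T2 w = 0 -> rip (T1 w) w <= 0.
Proof.
move=> [P [c [cpP incr lim dom]]] c1 c2 hF hG w0.
have [[l1 _] _] := c1; have [b1 _] := c1; have [b2 _] := c2.
have [s [os cs]] := vec_cvg srn w; pose v n := vec pi V (s n).
have cpPn n : CP M N (P n) by case: (cpP n).
(* the increasing approximants stay below their limit *)
have up n t : okl M t -> gform (P n) t t <= gform F t t.
  move=> ot; have cF := gform_cvg lim ot.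
  rewrite -(cvg_lim _ cF)//; apply: nondecreasing_cvgn_le; last exact: cvgP cF.
  by apply/nondecreasing_seqP => m; exact: gform_le.
have step1 k n : gform (P n) (s k) (s k) <= 2 * rip (T1 (v k - w)) (v k - w).
  pose d l := s k ++ smap (fun x => (-1)%:C *: x) (s l).
  have od l : okl M (d l) by apply: okl_cat => //; exact: okl_smap.
  have cv : (fun l => 2 * (c n * rip (T2 (v l)) (v l)) + 2 * rip (T1 (v k - v l)) (v k - v l))
      @ \oo --> 2 * (c n * rip (T2 w) w) + 2 * rip (T1 (v k - w)) (v k - w).
    have ckw : hcvg (fun l => v k - v l) (v k - w).
      rewrite (_ : (fun l => _) = (fun l => v k + (-1) *: v l)); last first.
        by apply/funext => l; rewrite scaleN1r.
      by rewrite -[- w]scaleN1r; apply: hcvgD; [exact: hcvg_const|exact: hcvgZ].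
    apply: cvgD; apply: cvgMl_tmp; last by apply: hcvg_rip2 => //; exact: hcvg_op.
    by apply: cvgMl_tmp; apply: hcvg_rip2 => //; exact: hcvg_op.
  rewrite w0 rip0l !mulr0 add0r in cv; rewrite -(cvg_lim _ cv)//.
  apply: limr_ge; first exact: cvgP cv.
  apply: nearW => l; apply: le_trans (gform_parallelogram (cpPn n) (os k) (os l)) _.
  rewrite lerD// ler_pM2l//; last by rewrite -/(d l) (le_trans (up n _ (od l)))// 
    (gform_Theta c1 hF (od l) (od l)) vecB.
  apply: le_trans (gform_le (dom n) (os l)) _.
  by rewrite gform_scale_map (gform_Theta c2 hG (os l) (os l)).
have step2 k : rip (T1 (v k)) (v k) <= 2 * rip (T1 (v k - w)) (v k - w).
  have cF := gform_cvg lim (os k).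
  rewrite -(gform_Theta c1 hF (os k) (os k)) -(cvg_lim _ cF)//.
  by apply: limr_le; [exact: cvgP cF|apply: nearW => n; exact: step1].
have h1 : (fun k => rip (T1 (v k)) (v k)) @ \oo --> rip (T1 w) w.
  by apply: hcvg_rip2 => //; exact: hcvg_op.
have h2 : (fun k => 2 * rip (T1 (v k - w)) (v k - w)) @ \oo --> (0 : R).
  have z : hcvg (fun k => v k - w) 0.
    by rewrite /hcvg; under eq_fun do rewrite subr0.
  suff : (fun k => 2 * rip (T1 (v k - w)) (v k - w)) @ \oo --> 2 * rip (T1 0) 0.
    by rewrite rip0r mulr0.
  by apply: cvgMl_tmp; apply: hcvg_rip2 => //; exact: hcvg_op.
rewrite -(cvg_lim _ h1)// -[leRHS](cvg_lim _ h2)//.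
by apply: ler_lim; [exact: cvgP h1|exact: cvgP h2|apply: nearW => k; exact: step2].
Qed.

End absolute_continuity.

Section absolute_continuity_atoms.
Context {R : realType} {H0 H K : hilbertType R} (M : set (H0 -> H0)) (N : set (H -> H)).
Variables (Phi Psi : (H0 -> H0) -> H -> H) (pi : (H0 -> H0) -> K -> K) (V : H -> K).
Variables (A B : K -> K) (E : set R -> K -> K).
Hypothesis vnM : von_neumann M.
Hypothesis vnN : von_neumann N.
Hypothesis cpPhi : CP M N Phi.
Hypothesis cpPsi : CP M N Psi.
Hypothesis srn : minimal_SRN M Phi Psi pi V A B.
Hypothesis sA : spectral_decomposition01 A E.

Let hE : spectral_measure E. Proof. by case: sA. Qed.
Let hA : positive_contraction A. Proof. by case: srn => _ []. Qed.
Let bA : bounded_op A. Proof. by case: hA. Qed.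
Let lA : linear A. Proof. by case: bA. Qed.
Let BA v : B v = v - A v. Proof. exact: (A_B vnM srn). Qed.

Lemma E_A S v : borel_set S -> E S (A v) = A (E S v).
Proof.
move=> bS.
exact: (spectral_op_comm hE (@clamp_meas R) (@clamp_bounds R) v (spectral_op_clamp hA sA) bS).
Qed.

Lemma A_atom (a : R) v : 0 <= a <= 1 -> A (E [set a] v) = a%:C *: E [set a] v.
Proof.
move=> /andP[a0 a1]; have bS : borel_set [set a] by exact: measurable_set1.
have [lS _] := E_bounded hE bS; have [_ symA _] := spectral_op_clamp hA sA.
apply/subr0_eq.
apply: (@symmetric_zero _ _ (fun u => A (E [set a] u) - a%:C *: E [set a] u)).
- move=> c x y; rewrite lS lA scalerDr scalerBr opprD addrACA; congr (_ + (_ - _)).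
  by rewrite !scalerA mulrC.
- by move=> x y; rewrite ripBl ripBr ripZl ripZr !symA !(E_sym hE)// E_A.
- move=> u; set w := E [set a] u.
  have Ew : E [set a] w = w by exact: (E_idem hE u bS).
  have e1 : rip (A w) u = rip (A w) w by rewrite -{1}Ew -E_A// (E_sym hE).
  have e2 : rip w u = nsq w by rewrite -{1}Ew (E_sym hE).
  rewrite ripBl ripZl e1 e2; apply/eqP; rewrite subr_eq0 eq_sym eq_le.
  by apply: (A_bounds hA sA bS a0 _ Ew) => t -> _; rewrite lexx.
Qed.

Lemma E_conull U Z v : borel_set U -> borel_set Z -> (forall w, E Z w = 0) ->
  (forall t, 0 <= t <= 1 -> ~ U t -> Z t) -> E U v = v.
Proof.
move=> bU bZ Z0 h; have bC : borel_set (~` U) by exact: measurableC.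
rewrite -[U]setCK (E_setC hE)// -(E_restrict01 sA)//.
have -> : ~` U `&` `[0, 1]%classic = (~` U `&` `[0, 1]%classic) `&` Z.
  apply/seteqP; split=> t; last by case.
  by move=> [nU t01]; split=> //; apply: h => //; move: t01; rewrite /= in_itv.
have b01 : borel_set `[(0 : R), 1]%classic by exact: measurable_itv.
rewrite (E_setI hE)//; last by apply: measurableI; [exact: bC|exact: b01].
have bI : borel_set (~` U `&` `[0, 1]%classic) by apply: measurableI; [exact: bC|exact: b01].
by have [lI _] := E_bounded hE bI; rewrite Z0 (op0 lI) subr0.
Qed.

(** [B] vanishes on the eigenvectors of [A] at 1; away from 1, [A] is at most a multiple of [B]. *)
Lemma abs_cont_PhiPsi : abs_cont M N Phi Psi <-> forall v, E [set 1] v = 0.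
Proof.
have bS : borel_set [set (1 : R)] by exact: measurable_set1.
have cA := bicomm_pi vnM srn (bicommA srn); have cB := bicomm_pi vnM srn (bicommB vnM srn).
split=> [ac v|E1].
  set w := E [set 1] v.
  have Aw : A w = w by rewrite A_atom ?ler01 ?lexx// scale1r.
  apply: nsq_eq0; apply/le_anti; rewrite nsq_ge0 andbT -[X in X <= _]/(rip w w) -{1}Aw.
  apply: (abs_cont_kernel vnM vnN srn ac cA cB (PhiE srn) (PsiE srn)).
  by rewrite BA Aw subrr.
apply: (@abs_cont_aff _ _ _ _ M N Phi Psi pi V A B E vnM vnN cpPhi cpPsi srn sA Phi Psi 0 1 1 (-1)
  (fun n => `]-oo, (1 - n.+1%:R^-1)]%classic) (fun n => n.+1%:R)) => //.
- by move=> n; exact: measurable_itv.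
- move=> n t /=; rewrite !in_itv /= => /le_trans; apply; rewrite lerD2l lerN2.
  by rewrite lef_pV2 ?posrE// ler_nat.
- move=> v; apply: (@E_conull _ [set 1]) => //.
    by apply: bigcupT_measurable => n; exact: measurable_itv.
  move=> t /andP[t0 t1] nt /=; apply: contra_notP nt => /eqP t_ne1.
  have [n hn] := inv_lt_eps (ltac:(by rewrite subr_gt0 lt_neqAle t_ne1 t1) : 0 < 1 - t).
  by exists n => //=; rewrite in_itv /= lerBrDr -lerBrDl ltW// hn.
- by move=> x Mx; rewrite (PhiE srn)//; congr (Theta _ _ _ _); apply/funext => v;
    rewrite (affT sA) scale0r add0r scale1r.
- move=> x Mx; rewrite (PsiE srn)//; congr (Theta _ _ _ _); apply/funext => v.
  by rewrite (affT sA) BA scale1r realZ.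
- by move=> t; lra.
- by move=> t; lra.
- move=> n t /=; rewrite in_itv /= => h t01.
  have {}h : n.+1%:R^-1 <= 1 + -1 * t by rewrite mulN1r lerBrDl -lerBrDr.
  rewrite add0r mul1r; apply: (@le_trans _ _ (n.+1%:R * n.+1%:R^-1)); last by rewrite ler_pM2l.
  by rewrite divff//; case/andP: t01.
Qed.

(** The same with the roles of [A] and [B] exchanged, so that the atom at 0 matters. *)
Lemma abs_cont_PsiPhi : abs_cont M N Psi Phi <-> forall v, E [set 0] v = 0.
Proof.
have bS : borel_set [set (0 : R)] by exact: measurable_set1.
have cA := bicomm_pi vnM srn (bicommA srn); have cB := bicomm_pi vnM srn (bicommB vnM srn).
split=> [ac v|E0].
  set w := E [set 0] v.
  have Aw : A w = 0 by rewrite A_atom ?ler01 ?lexx// scale0r.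
  have Bw : B w = w by rewrite BA Aw subr0.
  apply: nsq_eq0; apply/le_anti; rewrite nsq_ge0 andbT -[X in X <= _]/(rip w w) -{1}Bw.
  exact: (abs_cont_kernel vnM vnN srn ac cB cA (PsiE srn) (PhiE srn)).
apply: (@abs_cont_aff _ _ _ _ M N Phi Psi pi V A B E vnM vnN cpPhi cpPsi srn sA Psi Phi 1 (-1) 0 1
  (fun n => `[n.+1%:R^-1, +oo[%classic) (fun n => n.+1%:R)) => //.
- by move=> n; exact: measurable_itv.
- move=> n t /=; rewrite !in_itv /= !andbT; apply: le_trans.
  by rewrite lef_pV2 ?posrE// ler_nat.
- move=> v; apply: (@E_conull _ [set 0]) => //.
    by apply: bigcupT_measurable => n; exact: measurable_itv.
  move=> t /andP[t0 t1] nt /=; apply: contra_notP nt => /eqP t_ne0.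
  have [n hn] := inv_lt_eps (ltac:(by rewrite lt_neqAle eq_sym t_ne0 t0) : 0 < t).
  by exists n => //=; rewrite in_itv /= andbT; exact: (ltW (hn n (leqnn n))).
- move=> x Mx; rewrite (PsiE srn)//; congr (Theta _ _ _ _); apply/funext => v.
  by rewrite (affT sA) BA scale1r realZ.
- by move=> x Mx; rewrite (PhiE srn)//; congr (Theta _ _ _ _); apply/funext => v;
    rewrite (affT sA) scale0r add0r scale1r.
- by move=> t; lra.
- by move=> t; lra.
- move=> n t /=; rewrite in_itv /= andbT => h /andP[t0 _]; rewrite mul1r add0r.
  have : n.+1%:R * n.+1%:R^-1 <= n.+1%:R * t by rewrite ler_pM2l.
  by rewrite divff//; lra.
Qed.

End absolute_continuity_atoms.

(** * Density of the domain of the divergence *)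

Section divergence_density.
Context {R : realType} {H0 H K : hilbertType R} (M : set (H0 -> H0)) (N : set (H -> H)).
Variables (Phi Psi : (H0 -> H0) -> H -> H) (pi : (H0 -> H0) -> K -> K) (V : H -> K).
Variables (A B : K -> K) (E : set R -> K -> K).
Hypothesis vnM : von_neumann M.
Hypothesis vnN : von_neumann N.
Hypothesis cpPhi : CP M N Phi.
Hypothesis cpPsi : CP M N Psi.
Hypothesis srn : minimal_SRN M Phi Psi pi V A B.
Hypothesis sA : spectral_decomposition01 A E.

Let hE : spectral_measure E. Proof. by case: sA. Qed.
Let hA : positive_contraction A. Proof. by case: srn => _ []. Qed.
Let bV : bounded_op V. Proof. by case: srn => -[]. Qed.
Let lV : linear V. Proof. by case: bV. Qed.

Lemma measure_countably_additive (mu : {measure set (measurableTypeR R) -> \bar R})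
  (nu : set R -> R) : (forall S, borel_set S -> mu S = (nu S)%:E) -> countably_additive nu.
Proof.
move=> hm; split=> [S bS|F bF tF].
  by rewrite -lee_fin -hm// measure_ge0.
have bU : borel_set (\bigcup_n F n) by exact: bigcupT_measurable.
have := @measure_semi_sigma_additive _ _ _ mu F bF tF bU.
rewrite hm// (_ : (fun n => _) = (fun n => (series (fun k => nu (F k)) n)%:E)).
  by move=> /fine_cvgP[].
by apply/funext => n; rewrite /series /= -sumEFin; apply: eq_bigr => k _; rewrite hm.
Qed.

Definition compression (T : K -> K) : H -> H := adjoint V \o T \o V.
(** The measure against which the divergence at [phi] integrates [hfun f]. *)
Definition compressed_measure (phi : (H -> H) -> R[i]) (S : set R) : R :=
  complex.Re (phi (compression (E S))).

Lemma compression_N T : bicomm A T -> N (compression T).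
Proof.
move=> bT; have := bicomm_Theta vnM vnN cpPhi cpPsi srn bT (vn_id vnM).
by congr (N _); apply/funext => v; rewrite /Theta /compression /= (pi_id srn).
Qed.

Lemma rip_compression T u w : rip (compression T u) w = rip (T (V u)) (V w).
Proof. by rewrite ripC -adjoint_rip// ripC. Qed.

Lemma vector_functional_compression th T :
  complex.Re (vector_functional th (compression T)) =
  limn (series (fun n => rip (T (V (th n))) (V (th n)))).
Proof.
by congr (limn (series _)); apply/funext => n /=; rewrite rip_compression.
Qed.

Lemma l2_V th : l2 th -> l2 (V \o th).
Proof.
move=> lth; have [C C0 hC] := bounded_nsq bV; apply: (@l2_of_bound _ _ _ (C * lb th th)) => n.
apply: (@le_trans _ _ (C * series (fun n => nsq (th n)) n)).
  by rewrite /series /= mulr_sumr ler_sum.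
by rewrite ler_pM2l//; apply: (@series_le_lim _ (fun n => nsq (th n))) => // m; exact: nsq_ge0.
Qed.

(** The sum of the scalar spectral measures of the vectors [V (th n)]. *)
Lemma compressed_measure_series phi th : l2 th ->
  (forall x, N x -> phi x = vector_functional th x) ->
  exists2 m : {measure set (measurableTypeR R) -> \bar R}^nat,
    forall n S, borel_set S -> m n S = (ev E (V (th n)) S)%:E &
    forall S, borel_set S -> mseries m 0 S = (compressed_measure phi S)%:E.
Proof.
move=> lth hth; have ex n : {mu : {measure set (measurableTypeR R) -> \bar R} |
    forall S, borel_set S -> mu S = (ev E (V (th n)) S)%:E} := measure_of (ev_ctbl hE (V (th n))).
pose m n := projT1 (ex n).
exists m => [n S bS|S bS]; first exact: (projT2 (ex n)).
have lS : l2 (E S \o (V \o th)) by apply: l2_op; [exact: (E_bounded hE)|exact: l2_V].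
rewrite /compressed_measure hth; last exact/compression_N/(bicommE srn sA).
rewrite vector_functional_compression -[X in _ = (limn (series X))%:E](_ : (fun n => nsq (E S (V (th n)))) = _).
  rewrite -[RHS](lb_esum lS); apply: eq_eseriesr => n _.
  by rewrite (projT2 (ex n))// (evE hE).
by apply/funext => n; rewrite -(evE hE).
Qed.

Lemma compressed_measure_ctbl phi : predual_pos N phi -> countably_additive (compressed_measure phi).
Proof.
move=> pphi; have [th lth hth] := positive_normal_vector vnN pphi.
have [m _ hm] := compressed_measure_series lth hth; exact: (measure_countably_additive hm).
Qed.

Lemma compressed_measure_ge phi th n S : l2 th -> (forall x, N x -> phi x = vector_functional th x) ->
  borel_set S -> ev E (V (th n)) S <= compressed_measure phi S.
Proof.
move=> lth hth bS; rewrite /compressed_measure hth; last exact/compression_N/(bicommE srn sA).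
rewrite vector_functional_compression.
have lS : l2 (E S \o (V \o th)) by apply: l2_op; [exact: (E_bounded hE)|exact: l2_V].
have e : (fun n => rip (E S (V (th n))) (V (th n))) = (fun n => nsq (E S (V (th n)))).
  by apply/funext => k; rewrite -(evE hE).
rewrite e (evE hE)//; apply: (@series_term_le_lim _ (fun n => nsq (E S (V (th n))))) => //.
by move=> k; exact: nsq_ge0.
Qed.

Variable f : R -> R.
Hypothesis cf : forall x y l, 0 < x -> 0 < y -> 0 <= l <= 1 ->
  f (l * x + (1 - l) * y) <= l * f x + (1 - l) * f y.

Notation I01 := (`[(0 : R), 1]%classic).

Lemma max_divergenceE phi : predual_pos N phi ->
  max_divergence N f V E phi = sint (compressed_measure phi) I01 (hfun f).
Proof.
move=> /(normal_extensionP vnN)[_ h].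
rewrite /max_divergence /restr_form /conj_form /phi_form /functional_measure.
apply: integral_raw => S bS; rewrite h//; exact/compression_N/(bicommE srn sA).
Qed.

Definition hpos t : \bar R := maxe (hfun f t) 0%E.

Lemma hpos_ge0 t : (0 <= hpos t)%E.
Proof. by rewrite /hpos le_max lexx orbT. Qed.

Lemma hpos_meas D : borel_set D -> D `<=` I01 -> emeas D hpos.
Proof.
move=> bD DI; have bI : borel_set I01 by exact: measurable_itv.
apply: (measurable_funS bI DI).
by apply: measurable_maxe => //; exact: (hfun_measurable cf).
Qed.

Variables (D Z : set R).
Hypothesis bD : borel_set D.
Hypothesis bZ : borel_set Z.
Hypothesis ZI : Z `<=` I01.
Hypothesis DE : I01 `\` Z = D.
Hypothesis hZ : forall t, Z t -> hfun f t = +oo%E.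

Let DI : D `<=` I01. Proof. by rewrite -DE => t []. Qed.
Let bI : borel_set I01. Proof. exact: measurable_itv. Qed.
Let dom := dom_sqrtQV f V E D.
Let Sf := max_divergence N f V E.

Lemma domP xi : dom_sqrtQV f V E D xi <-> (sint (ev E (V xi)) D hpos < +oo)%E.
Proof.
have e : hpos = fun t => (`|sqrte (maxe (hfun f t) 0)| ^+ 2)%E.
  by apply/funext => t; rewrite gee0_abs ?sqrte_ge0// sqr_sqrte//; exact: (hpos_ge0 t).
by rewrite e.
Qed.

Lemma dom_comb a x y : dom x -> dom y -> dom (a *: x + y).
Proof.
move=> /domP dx /domP dy; apply/domP; set c := complex.Re a ^+ 2 + complex.Im a ^+ 2.
have c0 : 0 <= 2 * c by rewrite mulr_ge0 ?addr_ge0 ?sqr_ge0.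
have ct v : countably_additive (ev E v) := ev_ctbl hE v.
have mh := hpos_meas bD DI.
have c1 := countably_additiveZ c0 (ct (V x)).
have c2 := countably_additiveZ (ler0n R 2) (ct (V y)).
apply: le_lt_trans (le_sint (ct _) (countably_additiveD c1 c2) _ bD mh (fun t _ => hpos_ge0 t)) _.
  move=> S bS; have [lS _] := E_bounded hE bS; rewrite !(evE hE)// lV lS.
  by apply: le_trans (nsqD_le _ _) _; rewrite nsqZ mulrA.
rewrite (sintD c1 c2 bD mh (fun t _ => hpos_ge0 t)).
rewrite (sintZ c0 (ct _) bD mh (fun t _ => hpos_ge0 t)).
rewrite (sintZ (ler0n R 2) (ct _) bD mh (fun t _ => hpos_ge0 t)).
by rewrite lte_add_pinfty// lte_mul_pinfty ?lee_fin.
Qed.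

Lemma dom0 : dom 0.
Proof.
apply/domP; rewrite (op0 lV).
apply: (@le_lt_trans _ _ 0%E) => //; have ct := ev_ctbl hE 0.
have e : sint (ev E 0) D hpos = sint (fun S => 0 * ev E 0 S) D hpos.
  apply: eq_sint => S bS; have [lS _] := E_bounded hE bS.
  by rewrite /ev (op0 lS) rip0l mul0r.
by rewrite e (sintZ (lexx _) ct bD (hpos_meas bD DI) (fun t _ => hpos_ge0 t)) mul0e.
Qed.

(** The lift [rho] of [y] to K commutes with the spectral projections. *)
Lemma dom_commutant y xi : commutant N y -> dom xi -> dom (y xi).
Proof.
move=> cy /domP dx; apply/domP.
have [rho br hr] := rho_exists vnM vnN cpPhi cpPsi srn cy.
have [har cA] := rho_commA vnM vnN cpPhi cpPsi srn cy br hr.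
have [_ caA] : (forall I (s : seq (I * (H0 -> H0) * H)), okl M s ->
    adjoint (adjoint rho) (vec pi V s) = vec pi V (smap (adjoint (adjoint y)) s)) /\
    forall v, adjoint rho (A v) = A (adjoint rho v).
  apply: (rho_commA vnM vnN cpPhi cpPsi srn) => //; first exact: commutant_adj.
  exact: bounded_adjoint.
have e : rho (V xi) = V (y xi).
  have := hr unit [:: (tt, idfun, xi)] (conj (vn_id vnM) I).
  by rewrite /vec /= !big_seq1 /= (pi_id srn).
have [C C0 hC] := bounded_nsq br; have ct := ev_ctbl hE (V xi); have mh := hpos_meas bD DI.
apply: le_lt_trans (le_sint (ev_ctbl hE _) (countably_additiveZ (ltW C0) ct) _ bD mh
  (fun t _ => hpos_ge0 t)) _.
  by move=> S bS; rewrite -e !(evE hE)// -(spectral_commute hA sA br cA caA).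
rewrite (sintZ (ltW C0) ct bD mh (fun t _ => hpos_ge0 t)).
by rewrite lte_mul_pinfty ?lee_fin// ltW.
Qed.

(** The integrand is infinite on [Z], and its negative part is always integrable. *)
Lemma divergence_fin phi : predual_pos N phi ->
  (Sf phi < +oo)%E <-> compressed_measure phi Z = 0 /\
                      (sint (compressed_measure phi) D hpos < +oo)%E.
Proof.
move=> pphi; have ct := compressed_measure_ctbl pphi; rewrite /Sf max_divergenceE//.
have [L L0 hL] := hfun_lower cf.
have mh := hfun_measurable cf; have mhp := hpos_meas bI (@subset_refl _ _).
have -> : (sint (compressed_measure phi) I01 (hfun f) < +oo)%E <->
    (sint (compressed_measure phi) I01 hpos < +oo)%E.
  apply: (@sint_nonneg_part _ _ _ _ L) => // t; rewrite /= in_itv /=; exact: hL.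
have null z : compressed_measure phi Z = z -> z = 0 ->
    sint (compressed_measure phi) I01 hpos = sint (compressed_measure phi) D hpos.
  by move=> <- z0; rewrite (sint_null ct bI bZ mhp (fun t _ => hpos_ge0 t) z0) DE.
split=> [fin|[z0 fin]]; last by rewrite (null 0).
have z : compressed_measure phi Z = 0.
  apply: (sint_pinfty_null ct bI bZ ZI mhp (fun t _ => hpos_ge0 t)) => // t Zt.
  by rewrite /hpos hZ// maxye.
by split=> //; rewrite -(null 0).
Qed.

Lemma norm_le_parts (z : R[i]) : `|z| <= (`|complex.Re z| + `|complex.Im z|)%:C.
Proof.
case: z => x y /=; rewrite normc_def ler_C -[leRHS]ger0_norm ?addr_ge0// -sqrtr_sqr /=.
rewrite ler_sqrt ?sqr_ge0// -[x ^+ 2]real_normK ?num_real// -[y ^+ 2]real_normK ?num_real//.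
have := normr_ge0 x; have := normr_ge0 y; nra.
Qed.

Lemma re_norm_le (z : R[i]) (e : R) : `|z| <= e%:C -> `|complex.Re z| <= e.
Proof. by move=> h; rewrite -ler_C; apply: le_trans (normc_ge_Re z) h. Qed.

(** Norm approximation passes on the vanishing at [x] to the vector functionals; [x] is rescaled to
    a contraction, at which the norm distance can be tested. *)
Lemma dense_domain_test x xi : dense_domain N Sf -> N x ->
  (forall psi, predual_pos N psi -> (Sf psi < +oo)%E -> complex.Re (psi x) = 0) ->
  rip (x xi) xi = 0.
Proof.
move=> dd Nx h; have [C C0 hC] := bounded_nsq (vn_bounded vnN Nx).
pose s := (1 + C)^-1; have C1 : 0 < 1 + C by lra.
have s0 : 0 < s by rewrite invr_gt0.
have Ny : N (s%:C *: x) by exact: (vnZ vnN).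
have cy v : `|(s%:C *: x) v| <= `|v|.
  rewrite norm_leE fctE nsqZr; apply: (@le_trans _ _ (s ^+ 2 * (C * nsq v))).
    by rewrite ler_wpM2l ?sqr_ge0.
  rewrite mulrA -[leRHS]mul1r ler_wpM2r ?nsq_ge0// expr2 -mulrA.
  have -> : s * C = 1 - s by rewrite /s; field; lra.
  have s1 : s <= 1 by rewrite /s invf_le1//; lra.
  by nra.
pose phi z := inner H (z xi) xi.
have pphi : predual_pos N phi.
  by split; [exact: inner_predual|move=> z Nz pz; exact: pz].
suff sm e : 0 < e -> s * `|rip (x xi) xi| <= e.
  apply/eqP; rewrite -normr_le0 -(pmulr_rle0 _ s0); apply/ler_addgt0Pl => e /sm.
  by rewrite addr0.
move=> e0; have [psi [ppsi fin close]] := dd phi e pphi e0.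
have := re_norm_le (close _ Ny cy).
have [th lth hth] := positive_normal_vector vnN ppsi.
have z : complex.Re (psi (s%:C *: x)) = 0.
  have := h psi ppsi fin; rewrite !hth//= comp_scalel => z.
  rewrite lbZl//; last by apply: l2_op => //; exact: (vn_bounded vnN).
  by rewrite z mulr0.
by rewrite ReD ReN z subr0 /phi fctE innerZl ReZ normrM (ger0_norm (ltW s0)).
Qed.

(** Functionals of finite divergence vanish at the compression of [E Z], hence [E Z \o V = 0], and
    [E Z] vanishes on the spanning vectors because it commutes with [pi]. *)
Lemma dense_domain_null : dense_domain N Sf -> forall v, E Z v = 0.
Proof.
move=> dd; have NW := compression_N (bicommE srn sA bZ).
have EV xi : E Z (V xi) = 0.
  apply: nsq_eq0; rewrite -(evE hE)// /ev -rip_compression.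
  apply: (dense_domain_test _ dd NW) => psi ppsi.
  by move=> /(divergence_fin ppsi)[].
have b0 : bounded_op (E set0) by apply: (E_bounded hE); exact: measurable0.
suff h : forall v, E Z v = E set0 v by move=> v; rewrite h (E_set0 hE).
apply: (vec_op_eq srn (E_bounded hE bZ) b0) => s os.
rewrite (E_set0 hE) /vec; have [lZ _] := E_bounded hE bZ.
elim: s os => [|p s IH] os; first by rewrite big_nil (op0 lZ).
have [Mp os'] := os; rewrite big_cons (opD lZ) IH// addr0.
have [_ cZ] := bicomm_pi vnM srn (bicommE srn sA bZ).
by rewrite cZ// EV (op0 (pi_linear srn Mp)).
Qed.

(** The projection onto the closure of the domain is in N because N' preserves the domain. A
    functional of finite divergence is represented by vectors of the domain, so it vanishes at the
    complementary projection. *)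
Lemma dense_domain_dom : dense_domain N Sf -> dense (dom_sqrtQV f V E D).
Proof.
move=> dd; have [P [bP hP uP]] := projection dom0 dom_comb.
have appr d : dom d -> approximable dom d.
  by move=> dd' e e0; exists d => //; rewrite subrr nsq0.
have NP : N P.
  apply: (vn_intro vnN bP) => y cy v; have [by' _] := cy; have [ly _] := by'.
  have [ap orth] := hP v; apply: uP => [e e0|d Dd].
    have [C C0 hC] := bounded_nsq by'; have [d Dd hd] := ap _ (divr_gt0 e0 C0).
    exists (y d); first exact: (dom_commutant cy Dd).
    rewrite -(opB ly); apply: le_lt_trans (hC _) _.
    by rewrite -ltr_pdivlMl// mulrC.
  rewrite -(opB ly) adjoint_rip//; apply: orth.
  by apply: (dom_commutant _ Dd); exact: commutant_adj.
have NQ : N (idfun - P) by apply: (vnB vnN) => //; exact: (vn_id vnN).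
have test xi : rip ((idfun - P : H -> H) xi) xi = 0.
  apply: (dense_domain_test _ dd NQ) => psi ppsi.
  move=> /(divergence_fin ppsi)[_ fin].
  have [th lth hth] := positive_normal_vector vnN ppsi.
  have dth n : dom (th n).
    apply/domP; apply: le_lt_trans fin.
    apply: (le_sint (ev_ctbl hE _) (compressed_measure_ctbl ppsi) _ bD
      (hpos_meas bD DI) (fun t _ => hpos_ge0 t)) => S bS.
    exact: compressed_measure_ge.
  rewrite hth//= /lb (_ : series _ = fun=> 0) ?lim_cst//.
  apply/funext => n; rewrite /series /= big1// => i _.
  have e : P (th i) = th i by apply: uP => [|d _]; [exact: appr|rewrite subrr rip0l].
  by rewrite /= !fctE e subrr rip0l.
apply/dense_nsq => v e e0; have [ap orth] := hP v.
suff -> : v = P v by exact: ap.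
apply/eqP; rewrite -subr_eq0; apply/eqP/nsq_eq0; set u := v - P v.
have Pu : P u = 0.
  by apply: uP => [|d Dd]; [exact: (appr _ dom0)|rewrite subr0; exact: orth].
by rewrite -(test u) !fctE Pu subr0.
Qed.

Lemma sint_finite_sum (xi : nat -> H) m : (forall n, dom (xi n)) ->
  countably_additive (fun S => \sum_(n < m) ev E (V (xi n)) S) /\
  (sint (fun S => \sum_(n < m) ev E (V (xi n)) S)%R D hpos < +oo)%E.
Proof.
move=> dxi; have mh := hpos_meas bD DI; have h0 (t : R) (_ : D t) := hpos_ge0 t.
elim: m => [|m [ct fin]].
  have e : (fun S => \sum_(n < 0) ev E (V (xi n)) S) = (fun S => 0 * ev E (0 : K) S).
    by apply/funext => S; rewrite big_ord0 mul0r.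
  have ct := ev_ctbl hE (0 : K); rewrite e; split; first exact: countably_additiveZ.
  by rewrite (sintZ (lexx _) ct bD mh h0) mul0e.
have e : (fun S => \sum_(n < m.+1) ev E (V (xi n)) S) =
    (fun S => \sum_(n < m) ev E (V (xi n)) S + ev E (V (xi m)) S).
  by apply/funext => S; rewrite big_ord_recr.
have cm := ev_ctbl hE (V (xi m)); rewrite e; split; first exact: countably_additiveD.
by rewrite (sintD ct cm bD mh h0) lte_add_pinfty//; exact/domP/dxi.
Qed.

Lemma lb_sub_le (a b : nat -> H) : l2 a -> l2 b -> lb b b <= 2 * lb a a + 2 * lb (a - b) (a - b).
Proof.
move=> la lb'; have lab := l2B la lb'; have lc := l2D la lab.
have := lb_ge0 lc; rewrite (lbDl la lab lc) (lbDr la lab la) (lbDr la lab lab).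
rewrite (lbBr la lb' la) (lbBl la lb' la) (lbBl la lb' lab) (lbBr la lb' la) (lbBr la lb' lb').
rewrite (lbC b a); lra.
Qed.

(** Used with [z = 1] for the real part of a functional, and with [z = 'i] for its imaginary part. *)
Lemma lb_diff_le (x : H -> H) th xi (z : R[i]) (d : R) : bounded_op x -> (forall v, nsq (x v) <= nsq v) ->
  l2 th -> l2 xi -> complex.Re z ^+ 2 + complex.Im z ^+ 2 = 1 ->
  lb (th - xi) (th - xi) <= d ^+ 2 -> 0 <= d -> 
  `|lb (x \o th) (z *: th) - lb (x \o xi) (z *: xi)| <=
     d * (2 + lb th th + lb xi xi).
Proof.
move=> bx cx lth lxi z1 hd d0; have [lx _] := bx.
have lxt a : l2 a -> l2 (x \o a) by exact: l2_op.
have lz (a : nat -> H) : l2 a -> l2 (z *: a) by exact: l2Z.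
have ld : l2 (th - xi) by exact: l2B.
have -> : lb (x \o th) (z *: th) - lb (x \o xi) (z *: xi) =
    lb (x \o (th - xi)) (z *: th) + lb (x \o xi) (z *: (th - xi)).
  have lt' := lxt _ lth; have lx' := lxt _ lxi; have zt := lz _ lth; have zx := lz _ lxi.
  rewrite (comp_subr th xi lx) (_ : z *: (th - xi) = z *: th - z *: xi); last exact: scalerBr.
  by rewrite (lbBl lt' lx' zt) (lbBr zt zx lx') addrA subrK.
have zz (a : nat -> H) : l2 a -> lb (z *: a) (z *: a) = lb a a.
  by move=> la; congr (limn (series _)); apply/funext => n; rewrite !fctE -/(nsq _) nsqZ z1 mul1r.
have xx (a : nat -> H) : l2 a -> lb (x \o a) (x \o a) <= lb a a.
  by move=> la; rewrite -[leRHS]mul1r; apply: lb_op_le => // v; rewrite mul1r.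
have key (a b : nat -> H) : l2 a -> l2 b -> lb a a <= d ^+ 2 -> `|lb a b| <= d * (1 + lb b b).
  move=> la lb' ha; rewrite -(@ler_pXn2r _ 2)// ?nnegrE ?mulr_ge0 ?addr_ge0 ?lb_ge0//.
  rewrite real_normK ?num_real//; apply: le_trans (lb_cs la lb') _; rewrite exprMn.
  apply: (@le_trans _ _ (d ^+ 2 * lb b b)); first by rewrite ler_wpM2r ?lb_ge0.
  by rewrite ler_wpM2l ?sqr_ge0//; have := lb_ge0 lb'; nra.
apply: le_trans (ler_normD _ _) _.
have k1 : `|lb (x \o (th - xi)) (z *: th)| <= d * (1 + lb th th).
  rewrite -(zz th)//; apply: key; [exact: lxt|exact: lz|exact: le_trans (xx _ ld) hd].
have k2 : `|lb (x \o xi) (z *: (th - xi))| <= d * (1 + lb xi xi).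
  rewrite lbC; apply: le_trans (key _ _ (lz _ ld) (lxt _ lxi) _) _; first by rewrite zz.
  by rewrite ler_wpM2l// lerD2l xx.
by lra.
Qed.

(** The first vectors of a representing sequence are replaced by nearby vectors of the domain, and
    all the others by 0. The relative error [nsq (th n) / m.+1] keeps the
    differences dominated, so that [tannery] applies. Finite sums of vector functionals at vectors of
    the domain have finite divergence. *)
Lemma dense_domain_intro : (forall v, E Z v = 0) -> dense (dom_sqrtQV f V E D) -> dense_domain N Sf.
Proof.
move=> Z0 /dense_nsq dn phi e pphi e0.
have [th lth hth] := positive_normal_vector vnN pphi.
have appr m n : exists xi, dom xi /\ nsq (th n - xi) <= nsq (th n) / m.+1%:R.
  have := nsq_ge0 (th n); rewrite le_eqVlt => /predU1P[z|pos].
    by exists 0; split; [exact: dom0|rewrite subr0 -z mul0r].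
  have [xi dxi h] := dn (th n) _ (divr_gt0 pos (ltr0Sn R m)).
  by exists xi; split => //; exact: ltW.
have /choice[g hg] : forall m, exists u : nat -> H, forall n, dom (u n) /\
    nsq (th n - u n) <= nsq (th n) / m.+1%:R.
  by move=> m; have /choice[u hu] := appr m; exists u.
pose xi m n : H := if (n < m)%N then g m n else 0.
have dxi m n : dom (xi m n) by rewrite /xi; case: ifP => _; [case: (hg m n)|exact: dom0].
have le1 m n : nsq (th n) / m.+1%:R <= nsq (th n).
  by rewrite -[leRHS]mulr1 ler_wpM2l ?nsq_ge0// invf_le1// ?ler1n.
have xle m n : nsq (th n - xi m n) <= nsq (th n).
  rewrite /xi; case: ifP => _; last by rewrite subr0.
  by apply: le_trans (le1 m n); case: (hg m n).
have lim0 : (fun m => limn (series (fun n => nsq (th n - xi m n)))) @ \oo --> (0 : R).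
  apply: (@tannery _ _ (fun n => nsq (th n))) => // [m n|n].
    by rewrite nsq_ge0 xle.
  apply/cvg0P => [m|ep ep0]; first exact: nsq_ge0.
  have n1 : 0 < nsq (th n) + 1 by have := nsq_ge0 (th n); lra.
  have [m0 hm0] := inv_lt_eps (divr_gt0 ep0 n1).
  exists (maxn m0 n.+1) => m; rewrite geq_max => /andP[h1 h2].
  rewrite /xi h2; have [_ h3] := hg m n; apply: le_lt_trans h3 _.
  have := hm0 m h1; rewrite ltr_pdivlMr// => h4; apply: le_lt_trans h4.
  by rewrite [leLHS]mulrC ler_wpM2l ?invr_ge0// lerDl.
have lxi m : l2 (xi m).
  apply: (@l2_of_bound _ _ _ (series (fun n => nsq (xi m n)) m)) => n.
  rewrite /series /=; have [nm|mn] := leqP n m.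
    rewrite (big_cat_nat (leq0n n) nm) /= lerDl sumr_ge0// => i _; exact: nsq_ge0.
  rewrite (big_cat_nat (leq0n m) (ltnW mn)) /= gerDl big_nat big1// => i /andP[mi _].
  by rewrite /xi ltnNge mi nsq0.
set T := lb th th; have T0 : 0 <= T by exact: lb_ge0.
(* the factor of [d] in [lb_diff_le] is at most [4 + 3 * T] once [d <= 1]; the factor 2 accounts
   for the real and the imaginary parts *)
pose d := Num.min 1 (e / (2 * (4 + 3 * T))).
have c0 : 0 < 2 * (4 + 3 * T) by lra.
have d0 : 0 < d by rewrite /d lt_min ltr01 divr_gt0.
have [m0 /(_ _ (leqnn m0)) hm] : exists m0, forall m, (m0 <= m)%N -> lb (th - xi m) (th - xi m) < d ^+ 2.
  have := (cvg0P (fun m => lb_ge0 (l2B lth (lxi m)))).1 lim0 _ (exprn_gt0 2 d0).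
  by [].
have ppsi : predual_pos N (vector_functional (xi m0)).
  exact: (vector_functional_pos (vn_bounded vnN)).
exists (vector_functional (xi m0)); split=> //.
  apply/(divergence_fin ppsi).
  have mE S : borel_set S -> compressed_measure (vector_functional (xi m0)) S =
      \sum_(n < m0) ev E (V (xi m0 n)) S.
    move=> bS; have [lS _] := E_bounded hE bS.
    rewrite /compressed_measure vector_functional_compression.
    apply: cvg_lim => //; apply: cvg_near_cst; exists m0 => // n /= mn.
    rewrite /series /= (big_cat_nat (leq0n m0) mn) /= [X in _ + X]big_nat [X in _ + X]big1 ?addr0.
      by rewrite big_mkord.
    by move=> i /andP[mi _]; rewrite /xi ltnNge mi (op0 lV) rip0r.
  split; first by rewrite mE// big1// => n _; rewrite /ev Z0 rip0l.
  by rewrite (eq_sint _ _ mE); case: (sint_finite_sum m0 (dxi m0)).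
have X1 : lb (xi m0) (xi m0) <= 2 * T + 2.
  have d1 : d <= 1 by rewrite /d ge_min lexx.
  have {}d1 : d ^+ 2 <= 1 by nra.
  by have := lb_sub_le lth (lxi m0); rewrite -/T; lra.
move=> x Nx cx; have bx := vn_bounded vnN Nx.
have cx' v : nsq (x v) <= nsq v by have := cx v; rewrite norm_leE.
have est (z : R[i]) : complex.Re z ^+ 2 + complex.Im z ^+ 2 = 1 ->
    `|lb (x \o th) (z *: th) - lb (x \o xi m0) (z *: xi m0)| <= e / 2.
  move=> z1; apply: le_trans (lb_diff_le bx cx' lth (lxi m0) z1 (ltW hm) (ltW d0)) _.
  have de : d <= e / (2 * (4 + 3 * T)) by rewrite /d ge_min lexx orbT.
  apply: (@le_trans _ _ (d * (4 + 3 * T))); first by rewrite ler_pM2l// -/T; lra.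
  rewrite ler_pdivlMr// in de; lra.
have e1 := est 1; rewrite !scale1r in e1; have {}e1 := e1 (ltac:(rewrite /=; ring)).
have e2 := est 'i (ltac:(rewrite /=; ring)).
rewrite hth//; apply: le_trans (norm_le_parts _) _; rewrite ler_C /=.
by move: e1 e2; lra.
Qed.

End divergence_density.

(** * Boundedness of the divergence *)

Section bounded_divergence.
Context {R : realType} {H0 H K : hilbertType R} (M : set (H0 -> H0)) (N : set (H -> H)).
Variables (Phi Psi : (H0 -> H0) -> H -> H) (pi : (H0 -> H0) -> K -> K) (V : H -> K).
Variables (A B : K -> K) (E : set R -> K -> K).
Hypothesis vnM : von_neumann M.
Hypothesis vnN : von_neumann N.
Hypothesis cpPhi : CP M N Phi.
Hypothesis cpPsi : CP M N Psi.
Hypothesis srn : minimal_SRN M Phi Psi pi V A B.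
Hypothesis sA : spectral_decomposition01 A E.

Let hE : spectral_measure E. Proof. by case: sA. Qed.
Let hA : positive_contraction A. Proof. by case: srn => _ []. Qed.
Let bV : bounded_op V. Proof. by case: srn => -[]. Qed.

(** For a single vector this is the definition of a spectral integral; sum over the sequence that
    represents [phi]. *)
Lemma compressed_integral phi g T : predual_pos N phi -> rmeas g -> (forall t, 0 <= g t) ->
  bicomm A T -> spectral_op E g T ->
  sint (compressed_measure V E phi) setT (EFin \o g) = (complex.Re (phi (compression V T)))%:E.
Proof.
move=> pphi mg g0 bT [bT' _ iT]; have [th lth hth] := positive_normal_vector vnN pphi.
have [m hm hms] := compressed_measure_series vnM vnN cpPhi cpPsi srn sA lth hth.
rewrite (sintE _ _ hms) ge0_integral_measure_series//; last 2 first.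
  by move=> t _; rewrite lee_fin.
  exact/measurable_EFinP.
have e n : (\int[m n]_(t in setT) (EFin \o g) t = (rip (T (V (th n))) (V (th n)))%:E)%E.
  by rewrite -iT (sintE _ _ (hm n)).
under eq_eseriesr do rewrite e.
have p n : 0 <= rip (T (V (th n))) (V (th n)).
  rewrite -lee_fin -iT; apply: sint_ge0; first exact: (ev_ctbl hE).
  by move=> t _; rewrite lee_fin.
rewrite hth; last exact: (compression_N vnM vnN cpPhi cpPsi srn).
rewrite (vector_functional_compression srn).
have lz := l2_V srn lth.
apply/(nneseries_cvgP _ p); exact: (l2_cvg (l2_op bT' lz) lz).
Qed.

Lemma spectral_op_bicomm g (L : R) : rmeas g -> (forall t, 0 <= g t <= L) ->
  exists2 T, bicomm A T & spectral_op E g T.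
Proof.
move=> mg gL; have [T sT cT] := spectral_op_exists hE mg gL; exists T => //.
have [bT _ _] := sT; split=> // x bx cx cx' v; have [lx _] := bx.
apply: hcvg_uniq (hcvg_op bx (cT v)) _.
rewrite (_ : (fun n => _) = (fun n => stepn E g L n (x v))); first exact: cT.
apply/funext => n; rewrite /stepn; apply: (step_op_comm mg) => // S w bS.
exact: (spectral_commute hA sA bx cx cx').
Qed.

Variable f : R -> R.
Hypothesis cf : forall x y l, 0 < x -> 0 < y -> 0 <= l <= 1 ->
  f (l * x + (1 - l) * y) <= l * f x + (1 - l) * f y.

Notation I01 := (`[(0 : R), 1]%classic).

Lemma sint_shift nu g (L C : R) : countably_additive nu -> rmeas g ->
  (forall t, 0 <= g t <= C) ->
  (sint nu setT (fun t => (g t - L)%:E) = sint nu setT (EFin \o g) - (L * nu setT)%:E)%E.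
Proof.
move=> ct mg gC; have [mu hm] := measure_of ct; rewrite !(sintE _ _ hm).
have ig : mu.-integrable setT (EFin \o g).
  apply: measurable_bounded_integrable => //; first by rewrite hm ?ltry//; exact: measurableT.
  exists C; split; first exact: num_real.
  move=> x Cx t _ /=; have /andP[g0 gc] := gC t; rewrite ger0_norm//.
  exact: le_trans gc (ltW Cx).
rewrite (_ : (fun t => (g t - L)%:E) = (fun t => (EFin \o g) t - (EFin \o cst L) t)%E)//.
rewrite integralB_EFin//; last first.
  apply: measurable_bounded_integrable => //; first by rewrite hm ?ltry//; exact: measurableT.
  by exists `|L|; split=> [|x Lx t _ /=]; [exact: num_real|exact: ltW].
rewrite /= integral_cst// hm//; exact: measurableT.
Qed.

(** On [S0], which carries [E], the function [g = hfun f + L] is bounded and nonnegative. The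
    divergence is evaluation at the compression of its spectral integral, shifted back by [L]. *)
Lemma bounded_form_of S0 (C : R) : borel_set S0 -> S0 `<=` I01 -> (forall v, E S0 v = v) ->
  (forall t, S0 t -> (hfun f t <= C%:E)%E) -> bounded_form N (max_divergence N f V E).
Proof.
move=> bS SI full hC; have [L L0 hL] := hfun_lower cf.
have bI : borel_set I01 by exact: measurable_itv.
have mh := hfun_measurable cf.
pose g0 : R -> \bar R := (fun t => hfun f t + L%:E)%E \_ S0.
pose g t := fine (g0 t).
have g0E t : S0 t -> g0 t = (hfun f t + L%:E)%E by move=> St; rewrite /g0 patchE mem_set.
have g0N t : ~ S0 t -> g0 t = 0%E by move=> St; rewrite /g0 patchE memNset.
have hb t : S0 t -> ((- L)%:E <= hfun f t <= C%:E)%E.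
  move=> St; rewrite hC// andbT; apply: hL; have := SI t St; by rewrite /= in_itv.
have gE t : S0 t -> hfun f t = (g t - L)%:E.
  move=> St; rewrite /g g0E//; have := hb t St; case: (hfun f t) => [r _|/andP[_]|/andP[]].
  - by rewrite /= addrK.
  - by rewrite leye_eq.
  - by rewrite leeNy_eq.
have gb t : 0 <= g t <= Num.max 0 (C + L).
  have [St|nSt] := pselect (S0 t); last by rewrite /g g0N//= lexx le_max lexx.
  have := hb t St; rewrite gE// !lee_fin => /andP[h1 h2].
  by apply/andP; split; [lra|rewrite le_max; apply/orP; right; lra].
have mg : rmeas g.
  apply: (measurableT_comp (f := fine)); first exact: fine_measurable.
  apply/(measurable_restrictT _ bS); apply: emeasurable_funD => //.
  exact: (measurable_funS bI SI).
have [T bT sT] := spectral_op_bicomm mg gb.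
have NT := compression_N vnM vnN cpPhi cpPsi srn bT.
have b1 := bicomm_id A.
have N1 := compression_N vnM vnN cpPhi cpPsi srn b1.
pose a := compression V T + (- L)%:C *: compression V idfun.
have Na : N a by apply: (vnD vnN) => //; exact: (vnZ vnN).
exists a; split=> //.
  apply: adjoint_eq; last by case: (vn_bounded vnN Na).
  have [_ symT _] := sT => x y; rewrite ripDl ripDr ripZl ripZr !(rip_compression srn) symT.
  by rewrite ripC -!(rip_compression srn) (ripC x) (ripC x) !(rip_compression srn) (ripC (V y)).
move=> phi pphi; rewrite (max_divergenceE vnM vnN cpPhi cpPsi srn sA)//.
set mu := compressed_measure V E phi; have ct : countably_additive mu.
  exact: (compressed_measure_ctbl vnM vnN cpPhi cpPsi srn sA).
have [th lth hth] := positive_normal_vector vnN pphi.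
have null S : borel_set S -> S `&` S0 = set0 -> mu S = 0.
  move=> bS' S'S; rewrite /mu /compressed_measure hth; last first.
    exact/(compression_N vnM vnN cpPhi cpPsi srn)/(bicommE srn sA).
  rewrite (vector_functional_compression srn) (_ : series _ = fun=> 0) ?lim_cst//.
  apply/funext => n; rewrite /series /= big1// => i _.
  by rewrite -(full (V (th i))) (E_orth hE)// rip0l.
have -> : sint mu I01 (hfun f) = sint mu setT (fun t => (g t - L)%:E).
  have [nu hnu] := measure_of ct; rewrite !(sintE _ _ hnu) integral_mkcond.
  apply: ae_eq_integral => //.
  - exact/(measurable_restrictT _ bI).
  - by apply/measurable_EFinP; exact: measurable_funB.
  - exists (~` S0); split; first exact: measurableC.
      rewrite hnu; last exact: measurableC.
      by rewrite null//; [exact: measurableC|rewrite setICl].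
    move=> t; apply: contra_not => /= St _.
    by rewrite patchE mem_set ?gE//; exact: SI.
rewrite (sint_shift _ ct mg gb) (compressed_integral pphi mg _ bT sT); last first.
  by move=> t; case/andP: (gb t).
have e1 : mu setT = complex.Re (phi (compression V idfun)).
  by rewrite /mu /compressed_measure; case: hE => _ -> _ _.
rewrite e1 -EFinB !hth//= (comp_addl _ _ th) (comp_scalel _ _ th).
have lT : l2 (compression V T \o th) by apply: l2_op => //; exact: (vn_bounded vnN).
have l1 : l2 (compression V idfun \o th) by apply: l2_op => //; exact: (vn_bounded vnN).
have l1' : l2 ((- L)%:C *: (compression V idfun \o th : nat -> H)) by exact: l2Z.
by rewrite (lbDl lT l1' lth) lbZl// mulNr.
Qed.

Lemma le_cp_rip F G T1 T2 (c : R) : le_cp M N F (scale_map c G) ->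
  pi_comm M pi T1 -> pi_comm M pi T2 ->
  (forall x, M x -> F x = Theta pi V T1 x) -> (forall x, M x -> G x = Theta pi V T2 x) ->
  forall v, rip (T1 v) v <= c * rip (T2 v) v.
Proof.
move=> FG c1 c2 hF hG v; have [s [os cs]] := vec_cvg srn v.
have [b1 _] := c1; have [b2 _] := c2.
have l1 : (fun n => rip (T1 (vec pi V (s n))) (vec pi V (s n))) @ \oo --> rip (T1 v) v.
  by apply: hcvg_rip2 => //; exact: hcvg_op.
have l2 : (fun n => c * rip (T2 (vec pi V (s n))) (vec pi V (s n))) @ \oo --> c * rip (T2 v) v.
  by apply: cvgMl_tmp; apply: hcvg_rip2 => //; exact: hcvg_op.
rewrite -(cvg_lim _ l1)// -(cvg_lim _ l2)//; apply: ler_lim; [exact: cvgP l1|exact: cvgP l2|].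
apply: nearW => n; rewrite -(gform_Theta vnM srn c1 hF (os n) (os n)).
rewrite -(gform_Theta vnM srn c2 hG (os n) (os n)) -gform_scale_map.
exact: (gform_le vnM FG (os n)).
Qed.

Let cA : pi_comm M pi A. Proof. exact: (bicomm_pi vnM srn (bicommA srn)). Qed.
Let cB : pi_comm M pi B. Proof. exact: (bicomm_pi vnM srn (bicommB vnM srn)). Qed.

(** The hypothesis means that [A <= c * (1 - A)], so the spectrum of [A] lies in [0, c / (c + 1)];
    the slightly larger [r] leaves room for a strict inequality. *)
Lemma E_below c : 0 < c -> le_cp M N Phi (scale_map c Psi) ->
  exists2 r, 0 < r < 1 & forall v, E `[0, r]%classic v = v.
Proof.
move=> c0 h; have ab := le_cp_rip h cA cB (PhiE srn) (PsiE srn).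
pose r := (2 * c + 1) / (2 * c + 2); have d0 : 0 < 2 * c + 2 by lra.
have r01 : 0 < r < 1 by apply/andP; split; rewrite /r ?divr_gt0 ?ltr_pdivrMr//; lra.
exists r => // v; have bS : borel_set `]r, +oo[%classic by exact: measurable_itv.
apply: (E_conull sA (Z := `]r, +oo[%classic)) => //; first exact: measurable_itv; last first.
  by move=> t /andP[t0 _] /=; rewrite !in_itv /= t0 andbT => /negP; rewrite -ltNge.
move=> w; set u := E _ w; have Eu : E `]r, +oo[%classic u = u by exact: (E_idem hE w bS).
have := A_bounds hA sA (a := r) (b := 1) bS (ltW (andP r01).1).
move=> /(_ _ _ Eu) /andP[]; last move=> h1 _.
  by move=> t; rewrite /= in_itv /= andbT => /ltW -> /andP[].
have := ab u; rewrite (A_B vnM srn) ripBl -/(nsq u).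
have : r * (2 * c + 2) = 2 * c + 1 by rewrite /r divfK// gt_eqF.
move=> hr hab; apply: nsq_eq0; have := nsq_ge0 u; nra.
Qed.

(** Here [1 - A <= c * A], so the spectrum of [A] lies in [1 / (c + 1), 1]. *)
Lemma E_above c : 0 < c -> le_cp M N Psi (scale_map c Phi) ->
  exists2 r, 0 < r < 1 & forall v, E `[r, 1]%classic v = v.
Proof.
move=> c0 h; have ab := le_cp_rip h cB cA (PsiE srn) (PhiE srn).
pose r := (2 * c + 2)^-1; have d0 : 0 < 2 * c + 2 by lra.
have r01 : 0 < r < 1 by apply/andP; split; rewrite /r ?invr_gt0 ?invf_lt1//; lra.
exists r => // v; have bS : borel_set `]-oo, r[%classic by exact: measurable_itv.
apply: (E_conull sA (Z := `]-oo, r[%classic)) => //; first exact: measurable_itv; last first.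
  by move=> t /andP[_ t1] /=; rewrite !in_itv /= t1 andbT => /negP; rewrite -ltNge.
move=> w; set u := E _ w; have Eu : E `]-oo, r[%classic u = u by exact: (E_idem hE w bS).
have := A_bounds hA sA (a := 0) (b := r) bS (lexx 0).
move=> /(_ _ _ Eu) /andP[]; last move=> _ h1.
  by move=> t; rewrite /= in_itv /= => /ltW -> /andP[->].
have := ab u; rewrite (A_B vnM srn) ripBl -/(nsq u).
have : r * (2 * c + 2) = 1 by rewrite /r mulVf// gt_eqF.
move=> hr hab; apply: nsq_eq0; have := nsq_ge0 u; nra.
Qed.

End bounded_divergence.

(** * Density and boundedness criteria for the maximal f-divergence *)

Theorem proposition4p11 (R : realType) (H0 H K : hilbertType R)
    (M : set (H0 -> H0)) (N : set (H -> H)) (f : R -> R)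
    (Phi Psi : (H0 -> H0) -> H -> H)
    (pi : (H0 -> H0) -> K -> K) (V : H -> K) (A' B' : K -> K)
    (E' : set R -> K -> K)
    (vnM : von_neumann M) (vnN : von_neumann N) (ocf : operator_convex f)
    (cpPhi : CP M N Phi) (cpPsi : CP M N Psi)
    (srn : minimal_SRN M Phi Psi pi V A' B')
    (specA : spectral_decomposition01 A' E') :
  let S := max_divergence N f V E' in
  [/\
      (finfty f = +oo /\ fzero f < +oo)%E ->
      (dense_domain N S <->
         abs_cont M N Phi Psi /\ dense (dom_sqrtQV f V E' `[0, 1[%classic))
      /\ ((exists2 c : R, 0 < c & le_cp M N Phi (scale_map c Psi)) ->
          bounded_form N S),
      (finfty f < +oo /\ fzero f = +oo)%E ->
      (dense_domain N S <->
         abs_cont M N Psi Phi /\ dense (dom_sqrtQV f V E' `]0, 1]%classic))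
      /\ ((exists2 c : R, 0 < c & le_cp M N Psi (scale_map c Phi)) ->
          bounded_form N S),
      (finfty f = +oo /\ fzero f = +oo)%E ->
      (dense_domain N S <->
         [/\ abs_cont M N Phi Psi, abs_cont M N Psi Phi
           & dense (dom_sqrtQV f V E' `]0, 1[%classic)])
      /\ ((exists2 c : R, 0 < c & le_cp M N Phi (scale_map c Psi)) ->
          (exists2 d : R, 0 < d & le_cp M N Psi (scale_map d Phi)) ->
          bounded_form N S)
    &
      (finfty f < +oo /\ fzero f < +oo)%E ->
      bounded_form N S].
Proof.
have cf := operator_convex_convex ocf.
have hE : spectral_measure E' by case: specA.
have bI : borel_set `[(0 : R), 1]%classic by exact: measurable_itv.
have z1 : borel_set [set (1 : R)] by exact: measurable_set1.
have z0 : borel_set [set (0 : R)] by exact: measurable_set1.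
have density Z D : borel_set Z -> Z `<=` `[0, 1]%classic -> `[0, 1]%classic `\` Z = D ->
    (forall t, Z t -> hfun f t = +oo%E) ->
    dense_domain N (max_divergence N f V E') <->
    (forall v, E' Z v = 0) /\ dense (dom_sqrtQV f V E' D).
  move=> bZ ZI DE hZ; have bD : borel_set D by rewrite -DE; exact: measurableD.
  split=> [dd|[Z0 dn]]; last first.
    exact: (dense_domain_intro vnM vnN cpPhi cpPsi srn specA cf bD bZ ZI DE hZ Z0 dn).
  split; first exact: (dense_domain_null vnM vnN cpPhi cpPsi srn specA cf bZ ZI DE hZ dd).
  exact: (dense_domain_dom vnM vnN cpPhi cpPsi srn specA cf bD bZ ZI DE hZ dd).
have ac1 := abs_cont_PhiPsi vnM vnN cpPhi cpPsi srn specA.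
have ac0 := abs_cont_PsiPhi vnM vnN cpPhi cpPsi srn specA.
have bounded a b C : 0 <= a -> b <= 1 -> (forall v, E' `[a, b]%classic v = v) ->
    (forall t, a <= t <= b -> (hfun f t <= C%:E)%E) -> bounded_form N (max_divergence N f V E').
  move=> a0 b1 full hC.
  apply: (bounded_form_of vnM vnN cpPhi cpPsi srn specA cf (S0 := `[a, b]%classic) (C := C)) => //.
  - exact: measurable_itv.
  - by move=> t; rewrite /= !in_itv /= => /andP[h1 h2]; apply/andP; split; lra.
move=> S; split.
- move=> [finf fz]; split=> [|[c c0 le]].
    rewrite ac1; apply: density => //.
    + by move=> t ->; rewrite /= in_itv /= ler01 lexx.
    + apply/seteqP; split=> t; rewrite /= !in_itv /=.
        by move=> [/andP[-> t1] /eqP tn]; rewrite lt_neqAle tn.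
      by move=> /andP[-> t1]; rewrite ltW//; split=> // e; rewrite e ltxx in t1.
    + by move=> t ->; rewrite hfun1.
  have [r /andP[r0 r1] full] := E_below vnM srn specA c0 le.
  have [C hC] := hfun_bounded_left cf r1 fz.
  exact: (bounded 0 r C (lexx _) (ltW r1)).
- move=> [finf fz]; split=> [|[c c0 le]].
    rewrite ac0; apply: density => //.
    + by move=> t ->; rewrite /= in_itv /= ler01 lexx.
    + apply/seteqP; split=> t; rewrite /= !in_itv /=.
        by move=> [/andP[t0 ->] /eqP tn]; rewrite andbT lt_neqAle eq_sym tn.
      by move=> /andP[t0 ->]; rewrite ltW//; split=> // e; rewrite e ltxx in t0.
    + by move=> t ->; rewrite hfun0.
  have [r /andP[r0 r1] full] := E_above vnM srn specA c0 le.
  have [C hC] := hfun_bounded_right cf r0 finf.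
  exact: (bounded r 1 C (ltW r0) (lexx _)).
- move=> [finf fz]; split=> [|[c c0 le] [d d0 le']].
    have bZ : borel_set ([set 0] `|` [set (1 : R)]) by exact: measurableU.
    have Z01 : (forall v, E' ([set 0] `|` [set 1]) v = 0) <->
        (forall v, E' [set 1] v = 0) /\ (forall v, E' [set 0] v = 0).
      split=> [h|[h1 h0] v]; last first.
        rewrite -[_ `|` _]setCK (E_setC hE); last exact: measurableC.
        rewrite setCU (E_setI hE); [|exact: measurableC..].
        by rewrite !(E_setC hE)// h1 h0 !subr0 subrr.
      have sub z v : ([set 0] `|` [set 1]) z -> E' [set z] v = 0.
        move=> hz; have bz : borel_set [set z] by exact: measurable_set1.
        rewrite (_ : [set z] = [set z] `&` ([set 0] `|` [set 1])); last first.
          by apply/seteqP; split=> t [] // ->.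
        by rewrite (E_setI hE)// h (op0 (E_bounded hE bz).1).
      by split=> v; apply: sub; [right|left].
    have := density ([set 0] `|` [set 1]) `]0, 1[%classic bZ.
    rewrite -/S => {}density; rewrite density; last 3 first.
    + by move=> t [->|->]; rewrite /= in_itv /= ler01 lexx.
    + apply/seteqP; split=> t; rewrite /= !in_itv /=.
        move=> [/andP[t0 t1] tn]; rewrite !lt_neqAle t0 t1 !andbT eq_sym.
        by apply/andP; split; apply/eqP => e; apply: tn; [left|right].
      move=> /andP[t0 t1]; rewrite !ltW//; split=> // -[e|e].
        by rewrite e ltxx in t0.
      by rewrite e ltxx in t1.
    + by move=> t [->|->]; rewrite ?hfun0 ?hfun1.
    by rewrite Z01 -ac1 -ac0; split=> [[[]]|[]].
  have [r /andP[r0 r1] full] := E_below vnM srn specA c0 le.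
  have [q /andP[q0 q1] full'] := E_above vnM srn specA d0 le'.
  have [C hC] := hfun_bounded_inside cf q0 r1.
  apply: (bounded q r C (ltW q0) (ltW r1)) => // v.
  have -> : `[q, r]%classic = `[0, r]%classic `&` `[q, 1]%classic.
    apply/seteqP; split=> t; rewrite /= !in_itv /=.
      by move=> /andP[t0 t1]; rewrite t0 t1 (le_trans (ltW q0))// (le_trans t1)// ltW.
    by move=> [/andP[_ ->] /andP[->]].
  by rewrite (E_setI hE) ?full ?full'//; exact: measurable_itv.
- move=> [finf fz].
  have h0 : 0 < 2^-1 :> R by rewrite invr_gt0.
  have h1 : 2^-1 < 1 :> R by rewrite invf_lt1// ltr1n.
  have [C1 hC1] := hfun_bounded_left cf h1 fz; have [C2 hC2] := hfun_bounded_right cf h0 finf.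
  apply: (bounded 0 1 (Num.max C1 C2)) => [//|//|v|t /andP[t0 t1]]; first exact: (E01 specA).
  rewrite EFin_max le_max; have [th|th] := leP t 2^-1.
    by rewrite hC1// t0.
  by rewrite hC2 ?orbT// (ltW th).
Qed.
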